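(* Assume $r:=\|C\|_\infty=\max_{1\le i\le N}\sum_{j=1}^N c_{ij}<1$, where $C=(c_{ij})$ is the matrix of $d$-Dobrushin interdependence coefficients of $\mu$. Let $P$ be the transition kernel of the Gibbs sampler. Then: (a) For any (Borel measurable) Lipschitzian function $f:(E^N,d_{L^1})\to\mathbb{R}$, any two initial distributions $\nu_1,\nu_2$ (Borel probability measures) on $E^N$ and any coupling $(Z_0(1),Z_0(2))$ of $(\nu_1,\nu_2)$ (i.e. a pair of $E^N$-valued random variables such that the law of $Z_0(j)$ is $\nu_j$, $j=1,2$), $$|\nu_1P^kf-\nu_2P^kf|\le r^k\,\max_{1\le i\le N}\mathbb{E}\,d\bigl(Z_0^i(1),Z_0^i(2)\bigr)\,\sum_{i=1}^N\delta_i(f),\qquad k\ge 1.$$ (b) In particular, for any initial distribution $\nu$ on $E^N$ and any coupling $(Z_0(1),Z_0(2))$ of $(\nu,\mu)$, $$W_{1,d_{L^1}}(\nu P^k,\mu)\le N r^k\max_{1\le i\le N}\mathbb{E}\,d\bigl(Z_0^i(1),Z_0^i(2)\bigr),\qquad k\ge1.$$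
   Context: Setting. $E$ is a Polish space with Borel $\sigma$-field $\mathscr{B}$; $d$ is a metric on $E$ such that $(x,y)\mapsto d(x,y)$ is lower semicontinuous on $E^2$ ($d$ need not generate the topology of $E$). $N\ge1$ is an integer; points of $E^N$ are written $x=(x^1,\dots,x^N)$, and $d_{L^1}(x,y):=\sum_{i=1}^N d(x^i,y^i)$ on $E^N$. $\mu$ is a Gibbs probability measure on $E^N$: $\mu(\mathrm{d}x)=\frac1Z e^{-V(x^1,\dots,x^N)}\pi(\mathrm{d}x^1)\cdots\pi(\mathrm{d}x^N)$, with $\pi$ a $\sigma$-finite measure on $E$, $V:E^N\to\mathbb{R}$ measurable and $Z=\int_{E^N} e^{-V}\,\mathrm{d}\pi^{\otimes N}\in(0,\infty)$. For $x\in E^N$, $1\le i\le N$, $\mu_i(\cdot|x)$ is the given (fixed version of the) regular conditional distribution under $\mu$ of $x^i$ knowing $(x^j)_{j\ne i}$ (a probability kernel on $E$ depending on $x$ only through $(x^j)_{j\neq i}$), i.e. $\mu_i(\mathrm{d}x^i|x)=\frac{e^{-V(x)}\pi(\mathrm{d}x^i)}{\int_E e^{-V(x)}\pi(\mathrm{d}x^i)}$. Wasserstein distance. For probability measures $\nu_1,\nu_2$ on a space with metric $\rho$, $W_{1,\rho}(\nu_1,\nu_2):=\inf_\pi\iint\rho(x,y)\,\pi(\mathrm{d}x,\mathrm{d}y)\in[0,\infty]$, the infimum being over all couplings $\pi$ of $\nu_1,\nu_2$. $\mathcal{M}_1^d(E)$ is the set of probability measures $\nu$ on $E$ with $\int_E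 d(x_0,x)\,\nu(\mathrm{d}x)<\infty$ for some fixed $x_0\in E$. Standing assumptions: $\int_{E^N} d(y^i,x_0^i)\,\mathrm{d}\mu(y)<\infty$ for all $i$ (with some fixed $x_0\in E^N$); $\mu_i(\cdot|x)\in\mathcal{M}_1^d(E)$ for all $i$ and all $x\in E^N$; and $x\mapsto\mu_i(\cdot|x)$ is Lipschitzian from $(E^N,d_{L^1})$ to $(\mathcal{M}_1^d(E),W_{1,d})$. Dobrushin coefficients. $c_{ij}:=\sup\frac{W_{1,d}(\mu_i(\cdot|x),\mu_i(\cdot|y))}{d(x^j,y^j)}$, $1\le i,j\le N$, the supremum over $x,y\in E^N$ with $x^k=y^k$ for all $k\ne j$ and $x^j\neq y^j$ (so $c_{ii}=0$); $C:=(c_{ij})$. Gibbs sampler. $\bar\mu_i(x,\mathrm{d}y)=\bigl(\prod_{j\ne i}\delta_{x^j}(\mathrm{d}y^j)\bigr)\otimes\mu_i(\mathrm{d}y^i|x)$ is the kernel on $E^N$ resampling coordinate $i$, and $P:=\bar\mu_1\bar\mu_2\cdots\bar\mu_N$, where $(K_1K_2)(x,A)=\int K_1(x,\mathrm{d}y)K_2(y,A)$ (coordinate 1 is updated first). $P^k$ is the $k$-th power, $P^kf(x)=\int f(y)P^k(x,\mathrm{d}y)$, $\nu P^k(A)=\int P^k(x,A)\nu(\mathrm{d}x)$, $\nu P^kf=\int P^kf\,\mathrm{d}\nu$. For $f:E^N\to\mathbb{R}$, $\delta_i(f):=\sup\frac{|f(x)-f(y)|}{d(x^i,y^i)}$ over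 $x,y$ with $x^j=y^j$ for all $j\ne i$ and $x^i\ne y^i$. Conventions: $0\cdot\infty=0$; the inequality in (a) is asserted whenever $\nu_1P^kf$ and $\nu_2P^kf$ are well defined, i.e. $P^kf$ is $\nu_1$- and $\nu_2$-integrable. *)

(* Defs.v *)
From HB Require Import structures.
From mathcomp Require Import all_boot all_order all_algebra.
From mathcomp Require Import all_classical all_reals all_analysis measurable_realfun.

Set Implicit Arguments.
Unset Strict Implicit.
Unset Printing Implicit Defensive.

Import Order.TTheory GRing.Theory Num.Theory.
Import numFieldNormedType.Exports.

Local Open Scope classical_set_scope.
Local Open Scope ring_scope.
Local Open Scope ereal_scope.

Definition is_metric (R : realType) (T : Type) (d : T -> T -> R) : Prop :=
  [/\ forall x y, (0 <= d x y)%R,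
      forall x y, d x y = 0%R <-> x = y,
      forall x y, d x y = d y x &
      forall x y z, (d x z <= d x y + d y z)%R].

Definition is_polish (R : realType) (E : topologicalType) : Prop :=
  (exists2 D : set E, countable D & dense D) /\
  exists rho : E -> E -> R,
    [/\ is_metric rho,
        forall x A, nbhs x A <->
          exists2 e : R, (0 < e)%R & [set y | (rho x y < e)%R] `<=` A &
        forall u : nat -> E,
          (forall e : R, (0 < e)%R -> exists n0, forall m n,
             (n0 <= m)%N -> (n0 <= n)%N -> (rho (u m) (u n) < e)%R) ->
          exists l : E, u @ \oo --> l].

(* Points of E^N are [N.-tuple (borel E)] with the product sigma-field, which is
   the Borel one when [E] is second countable.  Measurable types are pointed;
   this costs nothing here since [E] carries probability measures. *)
Definition borel (E : ptopologicalType) := g_sigma_algebraType (@open E).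

Definition dL1 (R : realType) (T : Type) (N : nat) (d : T -> T -> R)
    (x y : N.-tuple T) : R :=
  (\sum_(i < N) d (tnth x i) (tnth y i))%R.

Definition agree_off (T : Type) (N : nat) (i : 'I_N) (x y : N.-tuple T) : Prop :=
  forall j, j != i -> tnth x j = tnth y j.

Definition update (T : Type) (N : nat) (i : 'I_N) (x : N.-tuple T) (y : T) :
    N.-tuple T :=
  [tuple if j == i then y else tnth x j | j < N].

Section wasserstein.
Context {dT : measure_display} {T : measurableType dT} {R : realType}.

Definition is_coupling (g : probability (T * T)%type R)
    (nu1 nu2 : {measure set T -> \bar R}) : Prop :=
  forall A, measurable A ->
    g (A `*` [set: T]) = nu1 A /\ g ([set: T] `*` A) = nu2 A.

Definition W1 (rho : T -> T -> R) (nu1 nu2 : {measure set T -> \bar R}) : \bar R :=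
  ereal_inf [set \int[g]_p (rho p.1 p.2)%:E | g in
    [set g : probability (T * T)%type R | is_coupling g nu1 nu2]].

Definition M1d (d : T -> T -> R) (nu : {measure set T -> \bar R}) : Prop :=
  exists x0, \int[nu]_x (d x0 x)%:E < +oo.

Definition has_law {dO : measure_display} {O : measurableType dO}
    (P : probability O R) (Z : {RV P >-> T}) (nu : {measure set T -> \bar R}) :
    Prop :=
  forall A, measurable A -> distribution P Z A = nu A.

End wasserstein.

Section kernels.
Context {dT : measure_display} {T : measurableType dT} {R : realType}.

Section composition.
Variables K1 K2 : R.-pker T ~> T.

Let prob_comp x : mkcomp_noparam K1 K2 x [set: T] = 1.
Proof.
rewrite /mkcomp_noparam /= /kcomp_noparam.
under eq_integral do rewrite prob_kernel.
by rewrite integral_cst// mul1e prob_kernel.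
Qed.

HB.instance Definition _ :=
  isProbabilityKernel.Build _ _ _ _ R (mkcomp_noparam K1 K2) prob_comp.

(* [(K1 K2)(x, A) = \int K1(x, dy) K2(y, A)] *)
Definition kmul : R.-pker T ~> T := mkcomp_noparam K1 K2.

End composition.

Definition kid : R.-pker T ~> T := kdirac (@measurable_id _ T setT).

Definition kpow (K : R.-pker T ~> T) (k : nat) : R.-pker T ~> T :=
  iter k (kmul K) kid.

Definition kfun (K : R.-pker T ~> T) (f : T -> R) (x : T) : \bar R :=
  \int[K x]_y (f y)%:E.

Section action.
Variables (nu : probability T R) (K : R.-pker T ~> T).

Definition nuK (A : set T) : \bar R := \int[nu]_x K x A.

Let cst_nu : T -> {measure set T -> \bar R} := fun=> nu.

Let cst_meas U : measurable U -> measurable_fun [set: T] (cst_nu ^~ U).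
Proof. by move=> _; exact: (@measurable_cst _ _ _ _ setT (nu U)). Qed.

HB.instance Definition _ := isKernel.Build _ _ _ _ R cst_nu cst_meas.

Let cst_prob x : cst_nu x [set: T] = 1.
Proof. exact: probability_setT. Qed.

HB.instance Definition _ := Kernel_isProbability.Build _ _ _ _ R cst_nu cst_prob.

Let nuKE : nuK = kmul cst_nu K point. Proof. by []. Qed.

Let nuK0 : nuK set0 = 0. Proof. by rewrite nuKE measure0. Qed.

Let nuK_ge0 A : 0 <= nuK A. Proof. by rewrite nuKE. Qed.

Let nuK_sigma_additive : semi_sigma_additive nuK.
Proof. by rewrite nuKE; exact: measure_semi_sigma_additive. Qed.

HB.instance Definition _ :=
  isMeasure.Build _ _ _ nuK nuK0 nuK_ge0 nuK_sigma_additive.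

Let nuK_setT : nuK setT = 1. Proof. by rewrite nuKE prob_kernel. Qed.

HB.instance Definition _ := Measure_isProbability.Build _ _ _ nuK nuK_setT.

End action.
End kernels.

Section gibbs.
Context {dT : measure_display} {T : measurableType dT} {R : realType} {N : nat}.
Local Notation TN := (N.-tuple T).

(* On a sigma-finite space the values on boxes determine the product measure. *)
Definition is_power_measure (p : {measure set T -> \bar R})
    (pN : {measure set TN -> \bar R}) : Prop :=
  forall A : 'I_N -> set T, (forall i, measurable (A i)) ->
    pN [set x | forall i, A i (tnth x i)] = \prod_(i < N) p (A i).

Definition is_gibbs (p : {measure set T -> \bar R}) (V : TN -> R)
    (mu : {measure set TN -> \bar R}) : Prop :=
  exists2 pN : {measure set TN -> \bar R}, is_power_measure p pN &
    let Z := \int[pN]_x (expR (- V x))%:E in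
    [/\ 0 < Z, Z < +oo &
      forall A, measurable A -> mu A = (\int[pN]_(x in A) (expR (- V x))%:E) / Z].

(* The sigma-field generated by the coordinates other than [i]. *)
Definition sigma_off (i : 'I_N) : set (set TN) :=
  <<s [set B | exists j : 'I_N, exists A : set T,
         [/\ j != i, measurable A & B = [set x | A (tnth x j)]] ]>>.

Definition is_regular_conditional (mu : {measure set TN -> \bar R}) (i : 'I_N)
    (K : R.-pker TN ~> T) : Prop :=
  (forall x y, agree_off i x y -> forall A, measurable A -> K x A = K y A) /\
  (forall A B, measurable A -> sigma_off i B ->
    mu (B `&` [set x | A (tnth x i)]) = \int[mu]_(x in B) K x A).

(* The normalizing integral is finite only for mu-almost every x, so the
   explicit formula pins the conditional law down only almost everywhere. *)
Definition has_gibbs_density (p : {measure set T -> \bar R}) (V : TN -> R)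
    (mu : {measure set TN -> \bar R}) (i : 'I_N) (K : R.-pker TN ~> T) : Prop :=
  {ae mu, forall x, forall A, measurable A ->
     K x A = (\int[p]_(y in A) (expR (- V (update i x y)))%:E) /
             (\int[p]_y (expR (- V (update i x y)))%:E)}.

(* The suprema are taken in [0, +oo], hence the [maxe 0] for an empty family. *)
Definition dobrushin (d : T -> T -> R) (mui : 'I_N -> R.-pker TN ~> T)
    (i j : 'I_N) : \bar R :=
  maxe 0 (ereal_sup [set c | exists x y : TN,
    [/\ agree_off j x y, tnth x j <> tnth y j &
        c = W1 d (mui i x) (mui i y) / (d (tnth x j) (tnth y j))%:E]]).

Definition inf_norm (C : 'I_N -> 'I_N -> \bar R) : \bar R :=
  \big[maxe/-oo]_(i < N) \sum_(j < N) C i j.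

Definition delta (d : T -> T -> R) (f : TN -> R) (i : 'I_N) : \bar R :=
  maxe 0 (ereal_sup [set c | exists x y : TN,
    [/\ agree_off i x y, tnth x i <> tnth y i &
        c = (`|f x - f y| / d (tnth x i) (tnth y i))%:E]]).

Definition lipschitz_fun (d : T -> T -> R) (f : TN -> R) : Prop :=
  exists L : R, forall x y, (`|f x - f y| <= L * dL1 d x y)%R.

Definition lipschitz_kernel (d : T -> T -> R) (K : R.-pker TN ~> T) : Prop :=
  exists L : R, forall x y, W1 d (K x) (K y) <= (L * dL1 d x y)%:E.

Section resample.
Variables (i : 'I_N) (K : R.-pker TN ~> T).

Lemma measurable_update :
  measurable_fun [set: TN * T] (fun p => update i p.1 p.2).
Proof.
apply/measurable_fun_tnthP => j.
have [->|ji] := eqVneq j i.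
  rewrite (_ : _ \o _ = snd)//; apply/funext => -[x y] /=.
  by rewrite tnth_mktuple eqxx.
rewrite (_ : _ \o _ = (@tnth _ T ^~ j) \o fst); last first.
  by apply/funext => -[x y] /=; rewrite tnth_mktuple (negbTE ji).
by apply: measurableT_comp => //; exact: measurable_tnth.
Qed.

Lemma measurable_updater (x : TN) : measurable_fun [set: T] (update i x).
Proof.
exact: (measurableT_comp measurable_update (measurable_pair1 x)).
Qed.

(* The tensor product of the Dirac masses at [x^j], [j <> i], with [K x] at
   coordinate [i] is the image of [K x] under [y |-> update i x y]. *)
Definition resample_fun (x : TN) : set TN -> \bar R :=
  pushforward (K x) (update i x).

Let r0 x : resample_fun x set0 = 0.
Proof. by rewrite /resample_fun /pushforward preimage_set0 measure0. Qed.

Let r_ge0 x A : 0 <= resample_fun x A.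
Proof. by rewrite /resample_fun /pushforward. Qed.

Let r_sigma_additive x : semi_sigma_additive (resample_fun x).
Proof.
move=> F mF tF mUF; rewrite /resample_fun /pushforward preimage_bigcup.
apply: measure_semi_sigma_additive.
- by move=> n; rewrite -[X in measurable X]setTI; exact: measurable_updater.
- apply/trivIsetP => a b _ _ ab; rewrite -preimage_setI.
  by move/trivIsetP : tF => /(_ a b Logic.I Logic.I ab) ->; rewrite preimage_set0.
- rewrite -preimage_bigcup -[X in measurable X]setTI.
  exact: measurable_updater.
Qed.

HB.instance Definition _ x := isMeasure.Build _ _ _ (resample_fun x)
  (r0 x) (r_ge0 x) (@r_sigma_additive x).

Definition resample_meas (x : TN) : {measure set TN -> \bar R} := resample_fun x.

Let r_meas U : measurable U -> measurable_fun [set: TN] (resample_meas ^~ U).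
Proof.
move=> mU.
pose A := (fun p : TN * T => update i p.1 p.2) @^-1` U.
have mA : measurable A.
  by rewrite -[A]setTI; exact: measurable_update.
have := @measurable_fun_xsection_finite_kernel _ _ _ _ _ K A (mem_set mA).
rewrite (_ : (fun x => _) = resample_meas ^~ U)//; apply/funext => x /=.
by rewrite /resample_meas /= /resample_fun /pushforward xsectionE.
Qed.

HB.instance Definition _ := isKernel.Build _ _ _ _ R resample_meas r_meas.

Let r_prob x : resample_meas x [set: TN] = 1.
Proof.
by rewrite /resample_meas /= /resample_fun /pushforward preimage_setT prob_kernel.
Qed.

HB.instance Definition _ :=
  Kernel_isProbability.Build _ _ _ _ R resample_meas r_prob.

Definition resample : R.-pker TN ~> TN := resample_meas.

End resample.

(* [\big] nests to the right: coordinate 0 is updated first. *)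
Definition gibbs_sampler (mui : 'I_N -> R.-pker TN ~> T) : R.-pker TN ~> TN :=
  \big[kmul/kid]_(i < N) resample i (mui i).

End gibbs.

(* Main.v *)
(* The proof is by coupling. If (x, y) is distributed according to a coupling of
   the two current laws, resampling coordinate i of both points along a nearly
   optimal coupling of mu_i(.|x) and mu_i(.|y) replaces the expected distance a_i
   between the i-th coordinates by at most sum_j c_ij a_j and leaves the other a_j
   unchanged.  As in the Gauss-Seidel method, one sweep therefore multiplies
   max_i a_i by at most r.  This gives (b), since mu is invariant.  For (a), started from
   Dirac masses, it bounds the oscillation of P^k f, which is then integrated
   against the initial coupling.

   Choosing the couplings measurably in (x, y) needs no selection theorem.  Cut E
   into finitely many cells generated by the first n sets of a countable base, and
   replace d by its infimum c_n over pairs of cells.  Couplings of the two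
   conditional laws only matter through the masses p(s, t) they give to pairs of
   cells; admissible matrices p form a convex set, so averaging those with entries
   in a finite grid is a measurable choice.  Filling the cells with independent
   points gives couplings of cost at most sum_j c_ij d(x_j, y_j) + 1/n for c_n.
   Take a limit along an ultrafilter on all measurable rectangles: as the two
   marginals are fixed and tight, the limit extends to a measure.  Since d is lower
   semicontinuous, c_n increases to d, and the limit has the required cost.  The
   same construction glues two couplings along a common marginal, whence the
   triangle inequality for W_1. *)

Require Import Defs.
From HB Require Import structures.
From mathcomp Require Import all_boot all_order all_algebra.
From mathcomp Require Import all_classical all_reals all_analysis measurable_realfun.
From mathcomp Require Import ring lra.

Set Implicit Arguments.
Unset Strict Implicit.
Unset Printing Implicit Defensive.

Import Order.TTheory GRing.Theory Num.Theory.
Import numFieldNormedType.Exports.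

Local Open Scope classical_set_scope.
Local Open Scope ring_scope.
Local Open Scope ereal_scope.

(** * Regularity and tightness of measures on Polish metric spaces *)

(** The metric [d] need not generate the topology, so two metrics coexist: a Polish metric [rho]
    serves for tightness and regularity, [d] is only a cost, and the two meet in a countable base
    [B] through which the semicontinuity of [d] is expressed.

    The contraction is recorded as a nonnegative matrix bounding new coordinate costs linearly by
    old ones, not as a bound on their maximum. The right-hand side of (a) is a maximum of
    expectations; a pointwise bound by [max_j d(x_j, y_j)] would integrate to an expectation of a
    maximum, which is larger, whereas in a linear bound the maximum can be taken after integration.

    Part (a) is not read off a coupling of [nu1 P^k] and [nu2 P^k]: only [P^k f] is assumed
    integrable for the initial laws, and [f] may fail to be integrable for [nu1 P^k]. Hence the
    start from Dirac masses.

    The triangle inequality for [W1] is needed because Dobrushin coefficients only compare points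
    that differ in one coordinate. Costs live in [[0, +oo]], since the initial expectations may be
    infinite. *)

Lemma ultra_finite_cover (U : set_system nat) (n : nat) (F : nat -> set nat) :
  UltraFilter U -> (forall m, exists2 i, (i < n)%N & F i m) ->
  exists i, U (F i).
Proof.
move=> uU HF; apply: contrapT => /forallNP nU.
have : U (\bigcap_(i in `I_n) ~` F i).
  elim: n {HF} => [|n IH]; first by rewrite II0 bigcap_set0; exact: filterT.
  apply: (filterS (P := ~` F n `&` \bigcap_(i in `I_n) ~` F i)).
    move=> m [nF H] i /=.
    by rewrite ltnS leq_eqVlt => /predU1P[->//|/H].
  by apply: filterI => //; case: (in_ultra_setVsetC (F n) uU) => // /nU.
by move=> /filter_ex[m H]; have [i ni Fi] := HF m; exact: H Fi.
Qed.

Section metric.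
Context {T : Type} {R : realType}.
Implicit Types (rho : T -> T -> R) (A : set T).

Definition metric_open rho A :=
  forall x, A x -> exists2 e : R, (0 < e)%R & forall y, (rho x y < e)%R -> A y.

Definition cauchy_complete rho := forall u : nat -> T,
  (forall e : R, (0 < e)%R -> exists n0, forall m n,
     (n0 <= m)%N -> (n0 <= n)%N -> (rho (u m) (u n) < e)%R) ->
  exists l, forall e : R, (0 < e)%R -> exists n0, forall n, (n0 <= n)%N ->
     (rho (u n) l < e)%R.

Definition separable_metric rho := exists u : nat -> T,
  forall x (e : R), (0 < e)%R -> exists n, (rho x (u n) < e)%R.

(** Relative compactness, tested on sequences along an arbitrary ultrafilter. The limit is only
    asked to lie in [A], so [K] need not be closed. *)
Definition ultra_compact_in rho (K A : set T) :=
  forall (U : set_system nat), UltraFilter U -> forall x : nat -> T,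
    (forall n, K (x n)) ->
    exists2 l, A l & forall e : R, (0 < e)%R -> U [set n | (rho l (x n) < e)%R].

Lemma metric_open_bigcup rho (F : nat -> set T) :
  (forall n, metric_open rho (F n)) -> metric_open rho (\bigcup_n F n).
Proof.
move=> oF x [n _ /oF[e e0 eF]]; exists e => // y /eF Fy; by exists n.
Qed.

Lemma metric_openI rho A B : metric_open rho A -> metric_open rho B ->
  metric_open rho (A `&` B).
Proof.
move=> oA oB x [/oA[e e0 eA] /oB[f f0 fB]].
exists (Num.min e f); first by rewrite lt_min e0.
by move=> y; rewrite lt_min => /andP[/eA ? /fB].
Qed.

Lemma metric_open_bigcap rho (F : nat -> set T) n :
  (forall n, metric_open rho (F n)) ->
  metric_open rho (\bigcap_(i in `I_n) F i).
Proof.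
move=> oF; elim: n => [|n IH]; first by move=> x _; exists 1%R.
have -> : \bigcap_(i in `I_n.+1) F i = F n `&` \bigcap_(i in `I_n) F i.
  apply/seteqP; split => [x Fx|x [Fn Fx] i /=].
    by split=> [|i /= /ltnW]; apply: Fx => /=.
  by rewrite ltnS leq_eqVlt => /predU1P[->//|/Fx].
exact: metric_openI.
Qed.

Lemma metric_open_ball rho x e : is_metric rho ->
  metric_open rho [set y | (rho x y < e)%R].
Proof.
move=> [_ _ _ tri] y /= xy; exists (e - rho x y)%R; first by rewrite subr_gt0.
by move=> z yz; have := tri x y z; lra.
Qed.

(** The closed sets consist of the points at distance at least [1/(n+1)] from the complement of
    [A]. *)
Lemma metric_open_closed_bigcup rho A : is_metric rho -> metric_open rho A ->
  exists F : nat -> set T, [/\ A = \bigcup_n F n,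
    forall n, metric_open rho (~` F n) & nondecreasing_seq F].
Proof.
move=> mrho oA.
exists (fun n => [set x | forall y, ~ A y -> (n.+1%:R^-1 <= rho x y)%R]); split.
- apply/seteqP; split => [x Ax|x [n _ Fx]].
    have [e e0 eA] := oA x Ax.
    have [n ne] := ltr_add_invr e0; rewrite add0r in ne.
    exists n => // y nAy; rewrite leNgt; apply/negP => xy.
    by apply: nAy; apply: eA; exact: lt_trans ne.
  apply: contrapT => nAx; have := Fx x nAx.
  have [_ H _ _] := mrho; rewrite (proj2 (H x x))// => h.
  by move: h; rewrite leNgt invr_gt0 ltr0Sn.
- move=> n x /existsNP[y /not_implyP[nAy /negP]]; rewrite -ltNge => xy.
  exists (n.+1%:R^-1 - rho x y)%R; first by rewrite subr_gt0.
  have [_ _ sym tri] := mrho.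
  move=> z xz /(_ y nAy); have := tri z x y; rewrite (sym z x) => h1 h2.
  by move: (n.+1%:R^-1)%R xz h2 => k; lra.
- move=> n m nm; apply/subsetPset => x Fx y /Fx; apply: le_trans.
  by rewrite lef_pV2 ?posrE// ler_nat.
Qed.

(** At each scale the ultrafilter selects one ball of a finite cover. Any two selected balls share a
    point of the sequence, so their centres form a Cauchy sequence, and its limit is the one sought.
    Closedness of [F] puts it in [F]. *)
Lemma totally_bounded_ultra_compact rho (K F A : set T) (u : nat -> T) :
  is_metric rho -> cauchy_complete rho ->
  (forall k, exists n, forall x, K x ->
      exists2 i, (i < n)%N & (rho (u i) x < k.+1%:R^-1)%R) ->
  metric_open rho (~` F) -> F `<=` A ->
  ultra_compact_in rho (K `&` F) A.
Proof.
move=> [_ _ sym tri] crho tbK cF FA U uU x Kx.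
have /choice[j Uj] k : exists i, U [set m | (rho (u i) (x m) < k.+1%:R^-1)%R].
  have [n Hn] := tbK k; apply: (@ultra_finite_cover U n) => // m.
  by have [i ni h] := Hn _ (Kx m).1; exists i.
have half (e : R) : (0 < e)%R -> exists n0, forall m, (n0 <= m)%N ->
    (m.+1%:R^-1 < e / 2)%R.
  move=> e0; have e20 : (0 < e / 2)%R by rewrite divr_gt0.
  have [n ne] := ltr_add_invr e20; rewrite add0r in ne; exists n => m nm.
  by apply: le_lt_trans ne; rewrite lef_pV2 ?posrE// ler_nat.
have [l Hl] : exists l, forall e : R, (0 < e)%R -> exists n0, forall n,
    (n0 <= n)%N -> (rho (u (j n)) l < e)%R.
  apply: crho => e e0; have [n0 h0] := half _ e0; exists n0 => m n nm nn.
  have Umn : U ([set p | (rho (u (j m)) (x p) < m.+1%:R^-1)%R] `&`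
      [set p | (rho (u (j n)) (x p) < n.+1%:R^-1)%R]) by exact: filterI.
  have /filter_ex[p [/= pm pn]] := Umn.
  have := tri (u (j m)) (x p) (u (j n)); rewrite (sym (x p)) => h.
  have := h0 _ nm; have := h0 _ nn; move: pm pn.
  by move: (m.+1%:R^-1)%R (n.+1%:R^-1)%R => a b; lra.
have Ul (e : R) : (0 < e)%R -> U [set n | (rho l (x n) < e)%R].
  move=> e0; have [n0 h0] := half e e0.
  have [n1 h1] := Hl (e / 2)%R ltac:(by rewrite divr_gt0).
  pose m := maxn n0 n1.
  apply: filterS (Uj m) => p /= pm.
  have := tri l (u (j m)) (x p); rewrite (sym l (u _)).
  have := h0 m (leq_maxl _ _); have := h1 m (leq_maxr _ _); move: pm.
  by move: (m.+1%:R^-1)%R => a; lra.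
exists l => //; apply: FA; apply: contrapT => /cF[e e0 eF].
by have /filter_ex[p /= /eF] := Ul e e0; apply; exact: (Kx p).2.
Qed.

End metric.

Section polish_metric.
Context {dT : measure_display} {T : measurableType dT} {R : realType}.
Implicit Types (rho : T -> T -> R) (A : set T).

(** Stated for a bare distance function on a measurable type, without topology, so that it transfers
    to [dL1] on tuples with their product sigma-field. *)
Definition polish_metric rho :=
  [/\ is_metric rho, cauchy_complete rho, separable_metric rho &
      @measurable dT T = <<s metric_open rho >>].

Lemma measurable_metric_open rho A : polish_metric rho -> metric_open rho A ->
  measurable A.
Proof. by move=> [_ _ _ ->] oA; exact: sub_sigma_algebra. Qed.

Lemma measurable_tail (nu : probability T R) (F : nat -> set T) (e : R) :
  (0 < e)%R -> (forall n, measurable (F n)) -> nondecreasing_seq F ->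
  exists n, nu (\bigcup_n F n `\` F n) <= e%:E.
Proof.
move=> e0 mF ndF.
have mU : measurable (\bigcup_n F n) by exact: bigcup_measurable.
have mD n : measurable (\bigcup_n F n `\` F n) by exact: measurableD.
have := @nonincreasing_cvg_mu _ _ _ nu (fun n => \bigcup_n F n `\` F n)
  (le_lt_trans (probability_le1 _ (mD 0%N)) (ltry 1)) mD
  (bigcapT_measurable mD).
have ni : nonincreasing_seq (fun n => \bigcup_n F n `\` F n).
  by move=> n m nm; apply/subsetPset; apply: setDS; apply/subsetPset; exact: ndF.
move=> /(_ ni).
rewrite (_ : \bigcap_n _ = set0) ?measure0; last first.
  by apply/seteqP; split => // x H; have [[n _ Fx] _] := H 0%N I; case: (H n I).
move=> /fine_cvgP[ffin] /cvgrPdist_le /(_ _ e0) [n _ /(_ n (leqnn n))] /=.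
rewrite sub0r normrN ger0_norm ?fine_ge0// => h; exists n.
rewrite -(@fineK _ (nu _)) ?lee_fin//.
by apply: fin_num_measure; exact: measurableD.
Qed.


(** The sets that can be so approximated form a sigma-algebra containing the open sets. *)
Lemma metric_regular rho (nu : probability T R) A : polish_metric rho ->
  measurable A -> forall e : R, (0 < e)%R -> exists F O : set T,
  [/\ metric_open rho (~` F), metric_open rho O, F `<=` A, A `<=` O &
      nu (O `\` F) <= e%:E].
Proof.
move=> prho; have [mrho _ _ ->] := prho.
have mo B : metric_open rho B -> measurable B by exact: measurable_metric_open.
have mc B : metric_open rho (~` B) -> measurable B.
  by move=> /mo /measurableC; rewrite setCK.
suff : <<s metric_open rho >> `<=` [set A | forall e : R, (0 < e)%R ->
  exists F O : set T, [/\ metric_open rho (~` F), metric_open rho O, F `<=` A,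
  A `<=` O & nu (O `\` F) <= e%:E]] by move=> /[apply].
apply: smallest_sub; last first.
  move=> {}A oA e e0.
  have [F [AF cF ndF]] := metric_open_closed_bigcup mrho oA.
  have [n Fn] := measurable_tail nu e0 (fun n => mc _ (cF n)) ndF.
  exists (F n), A; split => //; last by rewrite [in X in nu X]AF.
  by rewrite AF => x Fx; exists n.
split.
- by move=> e e0; exists set0, set0; split => //;
    rewrite ?setC0 ?setD0 ?measure0 ?lee_fin ?ltW// => x _; exists 1%R.
- move=> {}A HA e /HA[F [ O [cF oO FA AO h]]]; exists (~` O), (~` F).
  rewrite setCK !setTD; split => //; [exact: subsetC|exact: subsetC|].
  by rewrite setDE setCK setIC -setDE.
- move=> B HB e e0.
  have e20 : (0 < e / 2)%R by rewrite divr_gt0.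
  have e2n n : (0 < e / 2 / (2 ^ n.+1)%:R)%R by rewrite divr_gt0// ltr0n expn_gt0.
  have /choice[F /choice[ O FO ]] := fun n => HB n _ (e2n n).
  have oO n : metric_open rho (O n) by have [] := FO n.
  have cF n : metric_open rho (~` F n) by have [] := FO n.
  have mF n : measurable (F n) by exact: mc.
  have mO n : measurable (O n) by exact: mo.
  (* A countable union of closed sets need not be closed: the inner approximation is a finite union
     [G m], at the price of [e / 2], and the approximations of the single sets share the other half
     geometrically. *)
  pose G n := \bigcup_(i in `I_n.+1) F i.
  have cG n : metric_open rho (~` G n).
    by rewrite setC_bigcup; exact: metric_open_bigcap.
  have GF : \bigcup_n G n = \bigcup_n F n.
    apply/seteqP; split => [x [n _ [m _ Fm]]|x [n _ Fx]]; first by exists m.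
    by exists n => //; exists n => /=.
  have ndG : nondecreasing_seq G.
    move=> n m nm; apply/subsetPset => x [i /= ni Fi]; exists i => //=.
    exact: leq_trans nm.
  have [m hm] := measurable_tail nu e20 (fun n => mc _ (cG n)) ndG.
  exists (G m), (\bigcup_n O n); split => //.
  + exact: metric_open_bigcup.
  + by move=> x [i _ Fi]; exists i => //; have [_ _ + _ _] := FO i; exact.
  + by move=> x [i _ Fi]; exists i => //; have [_ _ _ + _] := FO i; exact.
  have sub : \bigcup_n O n `\` G m `<=`
      (\bigcup_n G n `\` G m) `|` \bigcup_n (O n `\` F n).
    move=> x [[n _ On] nG]; have [Gx|nGx] := pselect ((\bigcup_n G n) x).
      by left.
    by right; exists n => //; split => // Fn; apply: nGx; rewrite GF; exists n.
  have mD : measurable (\bigcup_n (O n `\` F n)).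
    by apply: bigcup_measurable => n _; exact: measurableD.
  have mG : measurable (\bigcup_n G n `\` G m).
    apply: measurableD; last exact: mc.
    by apply: bigcup_measurable => n _; exact: mc.
  apply: (le_trans (le_measure nu _ _ sub)); rewrite ?inE.
  + apply: measurableD; last exact: mc.
    exact: bigcup_measurable.
  + exact: measurableU.
  apply: (le_trans (measureU2 _ mG mD)).
  rewrite [e]splitr EFinD; apply: leeD => //.
  apply: le_trans (epsilon_trick0 xpredT (ltW e20)).
  apply: (le_trans (measure_sigma_subadditive nu _ mD (@subset_refl _ _))).
    by move=> n; exact: measurableD.
  by apply: lee_nneseries => // n _; have [] := FO n.
Qed.

(** Ulam's argument: at scale [k], finitely many balls centred on the dense sequence carry all the
    mass up to [e / 2^(k+1)]; intersecting over [k] leaves a totally bounded set. *)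
Lemma metric_tight rho (nu : probability T R) (u : nat -> T) :
  polish_metric rho ->
  (forall x (e : R), (0 < e)%R -> exists n, (rho x (u n) < e)%R) ->
  forall e : R, (0 < e)%R -> exists K, [/\ measurable K, nu (~` K) <= e%:E &
    forall k, exists n, forall x, K x ->
      exists2 i, (i < n)%N & (rho (u i) x < k.+1%:R^-1)%R].
Proof.
move=> prho du e e0; have [mrho _ _ _] := prho; have [_ _ sym _] := mrho.
pose B k i := [set x | (rho (u i) x < k.+1%:R^-1)%R].
have mB k i : measurable (B k i).
  exact/measurable_metric_open/metric_open_ball.
pose G k n := \bigcup_(i in `I_n.+1) B k i.
have mG k n : measurable (G k n) by apply: bigcup_measurable => i _.
have ndG k : nondecreasing_seq (G k).
  move=> n m nm; apply/subsetPset => x [i /= ni Bi]; exists i => //=.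
  exact: leq_trans nm.
have GT k : \bigcup_n G k n = setT.
  apply/seteqP; split => // x _.
  have [n xn] := du x k.+1%:R^-1%R ltac:(by rewrite invr_gt0).
  by exists n => //; exists n => //=; rewrite /B/= sym.
have e2n k : (0 < e / (2 ^ k.+1)%:R)%R by rewrite divr_gt0// ltr0n expn_gt0.
have /choice[n nG] := fun k => measurable_tail nu (e2n k) (mG k) (ndG k).
have mK : measurable (\bigcap_k G k (n k)) by exact: bigcapT_measurable.
exists (\bigcap_k G k (n k)); split => //.
- rewrite setC_bigcap.
  have mC : measurable (\bigcup_k ~` G k (n k)).
    by apply: bigcup_measurable => k _; exact: measurableC.
  apply: (le_trans (measure_sigma_subadditive nu _ mC (@subset_refl _ _))).
    by move=> k; exact: measurableC.
  apply: le_trans (epsilon_trick0 xpredT (ltW e0)).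
  apply: lee_nneseries => [k _ _ |k _]; first exact: measure_ge0.
  by rewrite -setTD -(GT k); exact: nG.
- move=> k; exists (n k).+1 => x /(_ k I)[i /= ik Bi]; exists i => //.
Qed.

Lemma ultra_compact_regular rho (nu : probability T R) A : polish_metric rho ->
  measurable A -> forall e : R, (0 < e)%R -> exists K : set T,
  [/\ measurable K, K `<=` A, nu (A `\` K) <= e%:E & ultra_compact_in rho K A].
Proof.
move=> prho mA e e0; have [mrho crho [u du] _] := prho.
have e20 : (0 < e / 2)%R by rewrite divr_gt0.
have [F [ O [cF oO FA AO h]]] := metric_regular nu prho mA e20.
have [K [mK nK tK]] := metric_tight nu prho du e20.
have mF : measurable F.
  by rewrite -(setCK F); apply/measurableC/(measurable_metric_open prho).
have mO := measurable_metric_open prho oO.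
exists (K `&` F); split => //.
- exact: measurableI.
- by move=> x [_ /FA].
- have sub : A `\` (K `&` F) `<=` ~` K `|` (O `\` F).
    move=> x [Ax nKF]; have [Kx|] := pselect (K x); last by left.
    by right; split => [|Fx]; [exact: AO|exact: nKF].
  have mKF : measurable (~` K `|` (O `\` F)).
    by apply: measurableU; [exact: measurableC|exact: measurableD].
  apply: (le_trans (le_measure nu _ _ sub)); rewrite ?inE//.
    by apply: measurableD => //; exact: measurableI.
  rewrite [e]splitr EFinD; apply: le_trans (leeD nK h).
  by apply: measureU2; [exact: measurableC|exact: measurableD].
- exact: (totally_bounded_ultra_compact mrho crho tK).
Qed.

Lemma outer_regular rho (nu : probability T R) A : polish_metric rho ->
  measurable A -> forall e : R, (0 < e)%R -> exists O : set T,
  [/\ metric_open rho O, A `<=` O & nu (O `\` A) <= e%:E].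
Proof.
move=> prho mA e e0.
have [F [ O [cF oO FA AO h]]] := metric_regular nu prho mA e0.
have mF : measurable F.
  by rewrite -(setCK F); apply/measurableC/(measurable_metric_open prho).
have mO := measurable_metric_open prho oO.
exists O; split => //; apply: le_trans h; apply: le_measure; rewrite ?inE.
- exact: measurableD.
- exact: measurableD.
- exact: setDS.
Qed.

End polish_metric.

(** * Extension of biadditive set functions on rectangles *)

Section rectangle.
Context {d1 d2 : measure_display} {T1 : measurableType d1}
  {T2 : measurableType d2}.

Definition rectangle : set (set (T1 * T2)) :=
  [set S | exists A B, [/\ measurable A, measurable B & S = A `*` B]].

Lemma rectangle_proj S : rectangle S ->
  [/\ measurable (fst @` S), measurable (snd @` S) &
      S = (fst @` S) `*` (snd @` S)].
Proof.
move=> [A [B [mA mB ->]]].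
have [A0|/set0P[a Aa]] := eqVneq A set0.
  by rewrite A0 set0X !image_set0 set0X; split => //.
have [B0|/set0P[b Bb]] := eqVneq B set0.
  by rewrite B0 setX0 !image_set0 setX0; split => //.
have -> : fst @` (A `*` B) = A.
  by apply/seteqP; split => [_ [[x y] [Ax _]] <-//|x Ax]; exists (x, b).
have -> : snd @` (A `*` B) = B.
  by apply/seteqP; split => [_ [[x y] [_ By]] <-//|y By]; exists (a, y).
by [].
Qed.

Lemma rectangle0 : rectangle set0.
Proof. by exists set0, set0; rewrite set0X; split. Qed.

Lemma rectangleI : setI_closed rectangle.
Proof.
move=> _ _ [A [B [mA mB ->]]] [A' [B' [mA' mB' ->]]].
by exists (A `&` A'), (B `&` B'); rewrite setXI; split => //; exact: measurableI.
Qed.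

Lemma rectangle_semiD : semi_setD_closed rectangle.
Proof.
move=> _ _ [A [B [mA mB ->]]] [A' [B' [mA' mB' ->]]].
pose X := (A `\` A') `*` B; pose Y := (A `&` A') `*` (B `\` B').
exists [set X; Y]; split.
- exact: finite_set2.
- move=> _ [->|->].
    by exists (A `\` A'), B; split => //; exact: measurableD.
  by exists (A `&` A'), (B `\` B'); split => //;
    [exact: measurableI|exact: measurableD].
- rewrite bigcup_setU !bigcup_set1; apply/seteqP; split => [[x y]|[x y]].
    move=> [/= [Ax By] nAB]; have [A'x|nA'x] := pselect (A' x); last by left.
    by right; split => //; split => // B'y; exact: nAB.
  move=> [[[/= Ax nA'x] By]|[[/= Ax A'x] [By nB'y]]].
    by split => // -[].
  by split => // -[].
- move=> P Q [->|->] [->|->] // [[x y]].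
    by move=> [[[/= _ nA] _] [[_ /= /nA]]].
  by move=> [[[/= _ A'x] _] [[_ /= nA] _]].
Qed.

End rectangle.

(** An alias that does not carry the product sigma-field, so that the semiring of rectangles can be
    declared on it. *)
Definition rectangle_type (T1 T2 : Type) := (T1 * T2)%type.

HB.instance Definition _ d1 d2 (T1 : measurableType d1) (T2 : measurableType d2)
  := Pointed.on (rectangle_type T1 T2).

HB.instance Definition _ d1 d2 (T1 : measurableType d1) (T2 : measurableType d2)
  := @isSemiRingOfSets.Build default_measure_display (rectangle_type T1 T2)
       rectangle rectangle0 rectangleI rectangle_semiD.

Section image_probability.
Context {d1 d2 : measure_display} {T1 : measurableType d1}
  {T2 : measurableType d2} {R : realType}.

Definition image_probability (P : probability T1 R) (f : T1 -> T2)
    (mf : measurable_fun [set: T1] f) : probability T2 R :=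
  distribution P (HB.pack_for {mfun T1 >-> T2} f (isMeasurableFun.Build _ _ _ _ f mf)).

Lemma ge0_integral_image_probability (P : probability T1 R) (f : T1 -> T2)
    (mf : measurable_fun [set: T1] f) (g : T2 -> \bar R) :
  measurable_fun [set: T2] g -> (forall y, 0 <= g y) ->
  \int[image_probability P mf]_y g y = \int[P]_x g (f x).
Proof. by move=> mg g0; rewrite ge0_integral_distribution. Qed.

End image_probability.

Section bimeasure.
Context {d1 d2 : measure_display} {T1 : measurableType d1}
  {T2 : measurableType d2} {R : realType}.

(** Only finite partitions are considered, because limits along an ultrafilter preserve finite sums
    but not series. *)
Definition rectangle_additive (b : set T1 -> set T2 -> R) :=
  forall (F : nat -> set T1) (G : nat -> set T2) n A B,
    (forall k, measurable (F k)) -> (forall k, measurable (G k)) ->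
    measurable A -> measurable B ->
    trivIset setT (fun k => F k `*` G k) ->
    A `*` B = \big[setU/set0]_(k < n) (F k `*` G k) ->
    b A B = (\sum_(k < n) b (F k) (G k))%R.

Section properties.
Variable b : set T1 -> set T2 -> R.
Hypothesis b_ge0 : forall A B, measurable A -> measurable B -> (0 <= b A B)%R.
Hypothesis b_add : rectangle_additive b.

Lemma rectangle_additiveUl A A' B : measurable A -> measurable A' ->
  measurable B -> A `&` A' = set0 -> b (A `|` A') B = (b A B + b A' B)%R.
Proof.
move=> mA mA' mB AA'.
rewrite (b_add (F := bigcup2 A A') (G := fun=> B) (n := 2%N)) //=.
- by rewrite !big_ord_recl big_ord0 /= addr0.
- move=> [|[|k]] //=.
- exact: measurableU.
- move=> [|[|i]] [|[|j]]//= _ _ [[x y]] [[]//= + _ []//=];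
    by move=> h1 h2 _; have : (A `&` A') x by []; rewrite AA'.
- rewrite !big_ord_recl big_ord0 /= setU0.
  by apply/seteqP; rewrite /setX /setU; split => -[x y] /=; tauto.
Qed.

Lemma rectangle_additiveUr A B B' : measurable A -> measurable B ->
  measurable B' -> B `&` B' = set0 -> b A (B `|` B') = (b A B + b A B')%R.
Proof.
move=> mA mB mB' BB'.
rewrite (b_add (F := fun=> A) (G := bigcup2 B B') (n := 2%N)) //=.
- by rewrite !big_ord_recl big_ord0 /= addr0.
- by move=> [|[|k]] //=.
- exact: measurableU.
- move=> [|[|i]] [|[|j]]//= _ _ [[x y]] [[]//= _ + []//=];
    by move=> h1 _ h2; have : (B `&` B') y by []; rewrite BB'.
- rewrite !big_ord_recl big_ord0 /= setU0.
  by apply/seteqP; rewrite /setX /setU; split => -[x y] /=; tauto.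
Qed.

Lemma rectangle_additiveDl A K B : measurable A -> measurable K -> measurable B ->
  K `<=` A -> b A B = (b K B + b (A `\` K) B)%R.
Proof.
move=> mA mK mB KA; rewrite -rectangle_additiveUl//; first by rewrite setDUK.
- exact: measurableD.
- by rewrite setDIK.
Qed.

Lemma rectangle_additiveDr A B K : measurable A -> measurable B -> measurable K ->
  K `<=` B -> b A B = (b A K + b A (B `\` K))%R.
Proof.
move=> mA mB mK KB; rewrite -rectangle_additiveUr//; first by rewrite setDUK.
- exact: measurableD.
- by rewrite setDIK.
Qed.

Lemma rectangle_additive_le A A' B B' : measurable A -> measurable A' ->
  measurable B -> measurable B' -> A `<=` A' -> B `<=` B' ->
  (b A B <= b A' B')%R.
Proof.
move=> mA mA' mB mB' AA' BB'.
rewrite (rectangle_additiveDl mA' mA mB' AA') (rectangle_additiveDr mA mB' mB BB').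
by rewrite -addrA lerDl addr_ge0// b_ge0//; exact: measurableD.
Qed.

(** This is how marginals control errors: the loss from shrinking both sides is dominated by values
    of [b] on strips, which are marginal masses. *)
Lemma rectangle_additive_diff A K B L : measurable A -> measurable K ->
  measurable B -> measurable L -> K `<=` A -> L `<=` B ->
  (b A B <= b K L + b (A `\` K) setT + b setT (B `\` L))%R.
Proof.
move=> mA mK mB mL KA LB.
rewrite (rectangle_additiveDl mA mK mB KA) (rectangle_additiveDr mK mB mL LB).
rewrite -!addrA lerD2l addrC lerD// rectangle_additive_le//; exact: measurableD.
Qed.

End properties.

Section extension.
Variables (rho1 : T1 -> T1 -> R) (rho2 : T2 -> T2 -> R).
Hypotheses (prho1 : polish_metric rho1) (prho2 : polish_metric rho2).
Variables (nu1 : probability T1 R) (nu2 : probability T2 R).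
Variable b : set T1 -> set T2 -> R.
Hypothesis b_ge0 : forall A B, measurable A -> measurable B -> (0 <= b A B)%R.
Hypothesis b_add : rectangle_additive b.
Hypothesis b_marg1 : forall A, measurable A -> (b A setT)%:E = nu1 A.
Hypothesis b_marg2 : forall B, measurable B -> (b setT B)%:E = nu2 B.

(** The sides are read off [S] by projection; the absolute value makes the function nonnegative on
    all sets, rectangles or not. *)
Let mu (S : set (rectangle_type T1 T2)) : \bar R :=
  (`|b (fst @` S) (snd @` S)|)%:E.

Let muE A B : measurable A -> measurable B -> mu (A `*` B) = (b A B)%:E.
Proof.
move=> mA mB; rewrite /mu.
have [|m1 m2 e] := @rectangle_proj _ _ _ _ (A `*` B); first by exists A, B.
rewrite ger0_norm ?b_ge0//; congr EFin; apply/esym.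
(* If one side is empty, the projections lose the other one; the one-piece partition shows that [b]
   agrees on both pairs of sides. *)
rewrite (b_add (F := fun k => if k == 0%N then fst @` (A `*` B) else set0)
  (G := fun=> snd @` (A `*` B)) (n := 1%N)) //=.
- by rewrite big_ord_recl big_ord0 addr0.
- by move=> [|k] //=.
- by move=> [|i] [|j] // _ _ [[x y]] [[]//= ? ? []//].
- by rewrite big_ord_recl big_ord0 setU0 /= -e.
Qed.

Let mu_ge0 S : 0 <= mu S.
Proof. by rewrite lee_fin. Qed.

Let mu_additive : measure_function.semi_additive mu.
Proof.
move=> F n mF tF mU.
have /choice[A /choice[B AB]] k := mF k.
have mA k : measurable (A k) by have [] := AB k.
have mB k : measurable (B k) by have [] := AB k.
have FE k : F k = A k `*` B k by have [] := AB k.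
have [C [D [mC mD UE]]] := mU; rewrite UE muE//.
rewrite (b_add (F := A) (G := B) (n := n))//.
- by rewrite -sumEFin; apply: eq_bigr => i _; rewrite FE muE.
- by rewrite (_ : (fun k => _) = F)//; apply/funext => k; rewrite FE.
- by rewrite -UE; apply: eq_bigr => i _; rewrite FE.
Qed.

HB.instance Definition _ := isContent.Build _ _ _ mu mu_ge0 mu_additive.

(** Compactness argument: shrink the sides of [S] to compact sets, enlarge those of each [F k] to
    open sets, extract a finite subcover and use finite subadditivity. Each of the four marginal
    errors is allotted [e / 4], spread over a geometric series for the two coming from the [F k]. *)
Let mu_sub : measurable_subset_sigma_subadditive mu.
Proof.
move=> S F mF mS SF.
have /choice[A /choice[B AB]] k := mF k.
have mA k : measurable (A k) by have [] := AB k.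
have mB k : measurable (B k) by have [] := AB k.
have FE k : F k = A k `*` B k by have [] := AB k.
have [C [D [mC mD SE]]] := mS.
apply/lee_addgt0Pr => e e0.
have e4 : (0 < e / 4)%R by rewrite divr_gt0.
have e2n n : (0 < e / 4 / (2 ^ n.+1)%:R)%R by rewrite divr_gt0// ltr0n expn_gt0.
have [K [mK KC nK cK]] := ultra_compact_regular nu1 prho1 mC e4.
have [L [mL LD nL cL]] := ultra_compact_regular nu2 prho2 mD e4.
have /choice[V hV] := fun n => outer_regular nu1 prho1 (mA n) (e2n n).
have /choice[W hW] := fun n => outer_regular nu2 prho2 (mB n) (e2n n).
have oV n : metric_open rho1 (V n) by have [] := hV n.
have oW n : metric_open rho2 (W n) by have [] := hW n.
have mV n : measurable (V n) by exact: measurable_metric_open (oV n).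
have mW n : measurable (W n) by exact: measurable_metric_open (oW n).
have [m cover] : exists m, K `*` L `<=` \big[setU/set0]_(n < m) (V n `*` W n).
  (* Otherwise pick [z m] outside the first [m] open rectangles. Both coordinates converge along the
     same ultrafilter, and the limit lies in the open rectangle of some index [n], which then
     contains [z m] for some [m > n]. *)
  apply: contrapT => /forallNP H.
  have /choice[z hz] : forall m, exists z, (K `*` L) z /\
      ~ (\big[setU/set0]_(n < m) (V n `*` W n)) z.
    by move=> m; have /existsNP[z /not_implyP] := H m; exists z.
  have [U [uU subU]] := @ultraFilterLemma _ (nbhs \oo) _.
  have [l1 Cl1 Ul1] := cK U uU (fst \o z) (fun n => (hz n).1.1).
  have [l2 Dl2 Ul2] := cL U uU (snd \o z) (fun n => (hz n).1.2).
  have [n _] : (\bigcup_n F n) (l1, l2) by apply: SF; rewrite SE.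
  rewrite FE => -[/= Anl Bnl].
  have [_ AV _] := hV n; have [_ BW _] := hW n.
  have [e1 e10 Ve] := oV n _ (AV _ Anl).
  have [e2 e20 We] := oW n _ (BW _ Bnl).
  have Un : U [set m | (n < m)%N] by apply: subU; exact: nbhs_infty_gt.
  have Uall : U ([set m | (n < m)%N] `&` ([set m | (rho1 l1 (z m).1 < e1)%R] `&`
      [set m | (rho2 l2 (z m).2 < e2)%R])).
    by apply: filterI => //; apply: filterI; [exact: Ul1|exact: Ul2].
  have /filter_ex[m [/= nm [/Ve Vz /We Wz]]] := Uall.
  apply: (hz m).2; rewrite -(bigcup_mkord _ (fun n => V n `*` W n)); exists n => //.
have bKL : mu (K `*` L) <= \sum_(n < m) mu (V n `*` W n).
  apply: (@content_subadditive _ _ _ mu _ (fun n => V n `*` W n)) => //.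
  - by move=> n _; exists (V n), (W n).
  - by exists K, L.
have bVW n : mu (V n `*` W n) <=
    mu (F n) + ((e / 4 / (2 ^ n.+1)%:R)%:E + (e / 4 / (2 ^ n.+1)%:R)%:E).
  have [_ AV nV] := hV n; have [_ BW nW] := hW n.
  rewrite FE !muE//; apply: (@le_trans _ _
    (b (A n) (B n) + b (V n `\` A n) setT + b setT (W n `\` B n))%:E).
    by rewrite lee_fin rectangle_additive_diff.
  rewrite -addrA 2!EFinD leeD2l// leeD//.
    by rewrite b_marg1//; exact: measurableD.
  by rewrite b_marg2//; exact: measurableD.
rewrite SE muE//; apply: (@le_trans _ _
    (b K L + b (C `\` K) setT + b setT (D `\` L))%:E).
  by rewrite lee_fin rectangle_additive_diff.
have -> : e%:E = ((e / 4)%:E + (e / 4)%:E) + ((e / 4)%:E + (e / 4)%:E) :> \bar R.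
  by rewrite -!EFinD; congr EFin; field.
rewrite !addeA EFinD; apply: leeD; last first.
  by rewrite b_marg2//; exact: measurableD.
rewrite EFinD; apply: leeD; last first.
  by rewrite b_marg1//; exact: measurableD.
rewrite -addeA -muE//; apply: (le_trans bKL).
apply: (@le_trans _ _ (\sum_(n <oo) mu (V n `*` W n))).
  by rewrite -(big_mkord xpredT (fun n => mu (V n `*` W n)));
    apply: nneseries_lim_ge => *; exact: mu_ge0.
apply: (@le_trans _ _ (\sum_(n <oo) (mu (F n) + ((e / 4 / (2 ^ n.+1)%:R)%:E
   + (e / 4 / (2 ^ n.+1)%:R)%:E)))).
  by apply: lee_nneseries => [*|n _]; [exact: mu_ge0|exact: bVW].
have p0 n : 0 <= (e / 4 / (2 ^ n.+1)%:R)%:E by rewrite lee_fin ltW.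
rewrite nneseriesD; last 2 first.
- by move=> *; exact: mu_ge0.
- by move=> *; exact: adde_ge0.
rewrite leeD2l// nneseriesD; [|by move=> *; exact: p0..].
by apply: leeD; apply: epsilon_trick0; exact: ltW.
Qed.

HB.instance Definition _ :=
  Content_SigmaSubAdditive_isMeasure.Build _ _ _ mu mu_sub.

Let mu_extE A B : measurable A -> measurable B ->
  measure_extension mu (A `*` B) = (b A B)%:E.
Proof.
move=> mA mB; rewrite -muE// -[RHS]measurable_mu_extE//.
by exists A, B.
Qed.

Let mu_extT : measure_extension mu setT = 1.
Proof. by rewrite -setXTT mu_extE// b_marg1// probability_setT. Qed.

HB.instance Definition _ :=
  Measure_isProbability.Build _ _ _ (measure_extension mu) mu_extT.

Lemma bimeasure_extension : exists g : probability (T1 * T2)%type R,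
  forall A B, measurable A -> measurable B -> g (A `*` B) = (b A B)%:E.
Proof.
pose I := g_sigma_algebraType (@measurable _ (rectangle_type T1 T2)).
(* The identity, transporting the extension from the sigma-field generated by rectangles to the
   product sigma-field. *)
pose f : I -> (T1 * T2)%type := fun x => x.
have mf : measurable_fun [set: I] f.
  apply/measurable_fun_pairP; split => _ A mA; rewrite setTI;
    apply: sub_sigma_algebra.
    by exists A, setT; split => //; rewrite setXT.
  by exists setT, A; split => //; rewrite setTX.
exists (image_probability (measure_extension mu) mf) => A B mA mB.
exact: mu_extE.
Qed.

End extension.
End bimeasure.

(** * Limits of couplings along ultrafilters *)

(** The image of an ultrafilter clusters in the compact segment, and an ultrafilter converges to its
    cluster points. *)
Lemma ultra_bounded_cvg (R : realType) (U : set_system nat) (f : nat -> R)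
    (a b : R) :
  UltraFilter U -> (forall n, (a <= f n <= b)%R) -> exists l : R, f @ U --> l.
Proof.
move=> uU fab; have := @segment_compact R a b.
move=> /(_ (f @ U) _)[].
  suff : U (f @^-1` [set` `[a, b]%R]) by [].
  by apply: (@filterS _ _ _ setT) => [n _ /=|]; [rewrite in_itv/= fab|exact: filterT].
move=> l [_ cl]; exists l => V Vl.
have [//|UnV] := in_ultra_setVsetC (f @^-1` V) uU.
by have [x [/= nVx Vx]] := cl (~` V) V UnV Vl.
Qed.

Lemma cvg_sumr (R : realType) (I J : Type) (r : seq I) (F : set_system J)
    (f : I -> J -> R) (l : I -> R) : Filter F ->
  (forall i, f i @ F --> l i) ->
  (fun n => \sum_(i <- r) f i n)%R @ F --> (\sum_(i <- r) l i)%R.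
Proof.
move=> FF fl; elim: r => [|i r IH].
  by under eq_fun do rewrite big_nil; rewrite big_nil; exact: cvg_cst.
under eq_fun do rewrite big_cons; rewrite big_cons.
by apply: cvgD; [exact: fl|exact: IH].
Qed.

Section limit_coupling.
Context {d1 d2 : measure_display} {T1 : measurableType d1}
  {T2 : measurableType d2} {R : realType}.
Variables (rho1 : T1 -> T1 -> R) (rho2 : T2 -> T2 -> R).
Hypotheses (prho1 : polish_metric rho1) (prho2 : polish_metric rho2).

(* The limit is sigma-additive because its two marginals are fixed and tight; the
   approximations b n need not be measures. *)
Lemma limit_coupling (nu1 : probability T1 R) (nu2 : probability T2 R)
    (b : nat -> set T1 -> set T2 -> R) :
  (forall n A B, measurable A -> measurable B -> (0 <= b n A B)%R) ->
  (forall n, rectangle_additive (b n)) ->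
  (forall n A, measurable A -> (b n A setT)%:E <= nu1 A) ->
  (forall n B, measurable B -> (b n setT B)%:E <= nu2 B) ->
  (forall n, (1 - n.+1%:R^-1 <= b n setT setT)%R) ->
  exists (U : set_system nat) (g : probability (T1 * T2)%type R),
  [/\ UltraFilter U, \oo `<=` U,
    forall A, measurable A -> g (A `*` setT) = nu1 A,
    forall B, measurable B -> g (setT `*` B) = nu2 B &
    forall A B, measurable A -> measurable B ->
      (fun n => b n A B) @ U --> fine (g (A `*` B))].
Proof.
move=> b_ge0 b_add b_m1 b_m2 b_mass.
have [U [uU subU]] := @ultraFilterLemma _ (nbhs \oo) _.
have b1 n A B : measurable A -> measurable B -> (0 <= b n A B <= 1)%R.
  move=> mA mB; rewrite b_ge0//=.
  have := rectangle_additive_le (b_ge0 n) (b_add n) mA measurableT mB measurableT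
    (@subsetT _ _) (@subsetT _ _).
  move=> /le_trans; apply.
  rewrite -lee_fin (le_trans (b_m1 n _ measurableT))//.
  by rewrite probability_setT.
pose beta A B := lim ((fun n => b n A B) @ U).
have cvgb A B : measurable A -> measurable B ->
    (fun n => b n A B) @ U --> beta A B.
  move=> mA mB.
  have [l Ul] := ultra_bounded_cvg uU (fun n => b1 n _ _ mA mB).
  by apply/cvg_ex; exists l.
have ge0 A B : measurable A -> measurable B -> (0 <= beta A B)%R.
  move=> mA mB; apply: limr_ge; first by apply/cvg_ex; exists (beta A B); exact: cvgb.
  by apply: nearW => n; exact: b_ge0.
have add : rectangle_additive beta.
  move=> F G n A B mF mG mA mB tFG AB; apply: cvg_lim => //.
  rewrite (_ : (fun _ => _) = (fun m => \sum_(k < n) b m (F k) (G k))%R).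
    by apply: cvg_sumr => k; exact: cvgb.
  by apply/funext => m; exact: b_add.
have betaTT : beta setT setT = 1%R.
  apply: cvg_lim => //; apply/cvgrPdist_le => e e0.
  apply: subU; have [N Ne] := ltr_add_invr e0; rewrite add0r in Ne.
  exists N => // n /= Nn; rewrite ger0_norm.
    have := b_mass n; have : (n.+1%:R^-1 <= e)%R.
      by apply/ltW/(le_lt_trans _ Ne); rewrite lef_pV2 ?posrE// ler_nat.
    by move: (n.+1%:R^-1)%R => a; lra.
  by rewrite subr_ge0; have /andP[] := b1 n _ _ measurableT measurableT.
have le1 A : measurable A -> (beta A setT)%:E <= nu1 A.
  move=> mA; rewrite -(@fineK _ (nu1 A)) ?fin_num_measure// lee_fin.
  apply: limr_le; first by apply/cvg_ex; exists (beta A setT); exact: cvgb.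
  by apply: nearW => n; rewrite -lee_fin fineK ?fin_num_measure// b_m1.
have le2 B : measurable B -> (beta setT B)%:E <= nu2 B.
  move=> mB; rewrite -(@fineK _ (nu2 B)) ?fin_num_measure// lee_fin.
  apply: limr_le; first by apply/cvg_ex; exists (beta setT B); exact: cvgb.
  by apply: nearW => n; rewrite -lee_fin fineK ?fin_num_measure// b_m2.
(* Equality from inequality: the bound holds for [A] and for its complement, and the total masses
   agree. *)
have m1 A : measurable A -> (beta A setT)%:E = nu1 A.
  move=> mA; apply/eqP; rewrite eq_le le1//=.
  have mCA := measurableC mA.
  have := le1 _ mCA; rewrite probability_setC//.
  have := rectangle_additiveUl add mA mCA measurableT (setICr A).
  have [a ea] : exists a, nu1 A = a%:E.
    by exists (fine (nu1 A)); rewrite fineK// fin_num_measure.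
  by rewrite setUv betaTT ea => h; rewrite -EFinB !lee_fin; move: h; lra.
have m2 B : measurable B -> (beta setT B)%:E = nu2 B.
  move=> mB; apply/eqP; rewrite eq_le le2//=.
  have mCB := measurableC mB.
  have := le2 _ mCB; rewrite probability_setC//.
  have := rectangle_additiveUr add measurableT mB mCB (setICr B).
  have [a ea] : exists a, nu2 B = a%:E.
    by exists (fine (nu2 B)); rewrite fineK// fin_num_measure.
  by rewrite setUv betaTT ea => h; rewrite -EFinB !lee_fin; move: h; lra.
have [g gE] := bimeasure_extension prho1 prho2 ge0 add m1 m2.
exists U, g; split => //.
- by move=> A mA; rewrite gE// m1.
- by move=> B mB; rewrite gE// m2.
- by move=> A B mA mB; rewrite gE//; exact: cvgb.
Qed.

End limit_coupling.

(** * Polish spaces and their finite powers *)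

(** By separability an open set is a countable union of balls [C n k] centred on the dense sequence.
    This serves for [dL1], whose balls are measurable for the product sigma-field. *)
Lemma measurable_open_of_ball {dT : measure_display} {T : measurableType dT}
    {R : realType} (rho : T -> T -> R) (A : set T) :
  is_metric rho -> separable_metric rho ->
  (forall x e, measurable [set y | (rho x y < e)%R]) ->
  metric_open rho A -> measurable A.
Proof.
move=> [ge0 _ sym tri] [u du] mB oA.
pose C n k := if pselect ([set y | (rho (u n) y < k.+1%:R^-1)%R] `<=` A)
  then [set y | (rho (u n) y < k.+1%:R^-1)%R] else set0.
have -> : A = \bigcup_n \bigcup_k C n k.
  apply/seteqP; split => [x Ax|x [n _ [k _]]]; last first.
    by rewrite /C; case: pselect => // sub; exact: sub.
  have [e e0 eA] := oA x Ax.
  have e20 : (0 < e / 2)%R by rewrite divr_gt0.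
  have [k ke] := ltr_add_invr e20; rewrite add0r in ke.
  have [n xn] := du x k.+1%:R^-1%R ltac:(by rewrite invr_gt0).
  exists n => //; exists k => //; rewrite /C; case: pselect => [sub|nsub] /=.
    by rewrite /= sym.
  exfalso; apply: nsub => y /= uy; apply: eA; apply: (le_lt_trans (tri x (u n) y)).
  by rewrite (splitr e) ltrD//; exact: lt_trans ke.
apply: bigcup_measurable => n _; apply: bigcup_measurable => k _.
by rewrite /C; case: pselect => h /=; [exact: mB|exact: measurable0].
Qed.

Lemma polish_metric_borel {R : realType} {E : ptopologicalType} :
  is_polish R E -> exists rho : borel E -> borel E -> R,
    polish_metric rho /\ forall A : set E, open A <-> metric_open rho A.
Proof.
move=> [[D cD dD] [rho [mrho nrho crho]]]; exists rho.
have [ge0 eq0 sym tri] := mrho.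
have oE (A : set E) : open A <-> metric_open rho A.
  rewrite openE; split => H x /H.
    by move=> /nrho.
  by move=> h; apply/nrho.
split => //; split => //.
- move=> u /crho[l ul]; exists l => e e0.
  have : nbhs l [set y | (rho l y < e)%R] by apply/nrho; exists e.
  by move=> /ul[n _ nu]; exists n => m /nu/=; rewrite sym.
- have /countable_injP[f finj] := cD.
  exists (fun n => xget point [set y | D y /\ f y = n]) => x e e0.
  have [||y [xy Dy]] := dD [set y | (rho x y < e)%R].
    + by exists x => /=; rewrite (proj2 (eq0 x x)).
    + by apply: (proj2 (oE _)); exact: metric_open_ball.
  exists (f y); case: xgetP => [z zE [Dz fz]|/(_ y)[]//].
  by move: zE; rewrite (finj z y) ?inE// => ->.
- rewrite /measurable/=; congr (<<s _ >>); apply/seteqP; split => A; by move=> /oE.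
Qed.

Section polish_tuple.
Context {dT : measure_display} {T : measurableType dT} {R : realType} {N : nat}.
Variable rho : T -> T -> R.
Hypothesis prho : polish_metric rho.

Let mrho : is_metric rho. Proof. by have [] := prho. Qed.

Lemma dL1_metric (d : T -> T -> R) : is_metric d -> is_metric (@dL1 R T N d).
Proof.
move=> [ge0 eq0 sym tri]; split.
- by move=> x y; exact: sumr_ge0.
- move=> x y; rewrite /dL1; split => [/eqP|->]; last by rewrite big1// => i _; exact/eq0.
  rewrite psumr_eq0// => /allP H; apply/eq_from_tnth => i; apply/eq0/eqP.
  by have := H i (mem_index_enum i); rewrite implyTb.
- by move=> x y; apply: eq_bigr => i _; exact: sym.
- by move=> x y z; rewrite /dL1 -big_split/=; exact: ler_sum.
Qed.

Lemma le_dL1 (d : T -> T -> R) (x y : N.-tuple T) i : is_metric d ->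
  (d (tnth x i) (tnth y i) <= dL1 d x y)%R.
Proof. by move=> [ge0 _ _ _]; rewrite /dL1 (bigD1 i)//= lerDl sumr_ge0. Qed.

Lemma metric_open_tnth (i : 'I_N) (A : set T) :
  metric_open rho A -> metric_open (@dL1 R T N rho) [set x | A (tnth x i)].
Proof.
move=> oA x /= /oA[e e0 eA]; exists e => // y xy; apply: eA.
by apply: le_lt_trans xy; exact: le_dL1.
Qed.

Lemma polish_metric_tuple : polish_metric (@dL1 R T N rho).
Proof.
have [_ crho [u du] mE] := prho; have [ge0 eq0 sym tri] := mrho.
have mdL1 := dL1_metric mrho.
have sep : separable_metric (@dL1 R T N rho).
  exists (fun n => if unpickle n is Some s then map_tuple u (s : N.-tuple nat)
                  else [tuple point | i < N]) => x e e0.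
  (* Dividing by [N.+1] keeps the sum of [N] such terms strictly below [e], also when [N] is 0. *)
  have N0 : (0 < e / N.+1%:R)%R by rewrite divr_gt0.
  have /choice[s hs] := fun i : 'I_N => du (tnth x i) _ N0.
  exists (pickle [tuple s i | i < N]); rewrite pickleK.
  apply: (@le_lt_trans _ _ (\sum_(i < N) (e / N.+1%:R))%R).
    by apply: ler_sum => i _; rewrite tnth_map tnth_mktuple ltW.
  rewrite sumr_const card_ord -[ltLHS]mulr_natr mulrAC ltr_pdivrMr//.
  by rewrite ltr_pM2l// ltr_nat.
split => //.
- move=> v cv.
  have /choice[l hl] i : exists l, forall e : R, (0 < e)%R -> exists n0,
      forall n, (n0 <= n)%N -> (rho (tnth (v n) i) l < e)%R.
    apply: crho => e /cv[n0 h0]; exists n0 => m n nm nn.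
    by apply: le_lt_trans (h0 m n nm nn); exact: le_dL1.
  exists [tuple l i | i < N] => e e0.
  have N0 : (0 < e / N.+1%:R)%R by rewrite divr_gt0.
  have /choice[n0 h0] := fun i => hl i _ N0.
  exists (\max_(i < N) n0 i)%N => n nn.
  apply: (@le_lt_trans _ _ (\sum_(i < N) (e / N.+1%:R))%R).
    apply: ler_sum => i _; rewrite tnth_mktuple ltW//; apply: h0.
    by apply: leq_trans nn; exact: leq_bigmax.
  rewrite sumr_const card_ord -[ltLHS]mulr_natr mulrAC ltr_pdivrMr//.
  by rewrite ltr_pM2l// ltr_nat.
- apply/seteqP; split; last first.
    apply: smallest_sub; first exact: sigma_algebra_measurable.
    move=> A; apply: measurable_open_of_ball => // x e.
    rewrite -[X in measurable X]setTI.
    have mf : measurable_fun [set: N.-tuple T] (@dL1 R T N rho x).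
      apply: measurable_sum => i.
      apply: (@measurableT_comp _ _ _ _ _ _ (rho (tnth x i))); last first.
        exact: measurable_tnth.
      apply: measurability (RGenOInfty.measurableE R) _ => _ [_ [a ->] <-].
      rewrite setTI; apply: (measurable_metric_open prho) => y/=.
      rewrite in_itv/= andbT => ay; exists (rho (tnth x i) y - a)%R.
        by rewrite subr_gt0.
      move=> z yz; rewrite /= in_itv/= andbT.
      by have := tri (tnth x i) z y; rewrite (sym z); lra.
    have := mf measurableT [set` `]-oo, e[%R] (measurable_itv _).
    by rewrite (_ : _ @^-1` _ = [set y | (dL1 rho x y < e)%R])//;
      apply/seteqP; split => y /=; rewrite in_itv.
  apply: smallest_sub; first exact: smallest_sigma_algebra.
  rewrite -bigcup_seq => _ [i _ [A mA <-]]; rewrite setTI.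
  move: A mA; rewrite mE; apply: smallest_sub.
    split.
    - by rewrite preimage_set0; exact: sigma_algebra0.
    - move=> A mA; rewrite setTD preimage_setC; exact: sigma_algebraC.
    - by move=> F mF; rewrite preimage_bigcup; exact: sigma_algebra_bigcup.
  by move=> A oA; apply: sub_sigma_algebra; exact: metric_open_tnth.
Qed.

End polish_tuple.

(** * Discretization of lower semicontinuous costs *)

Section finite_code.
Context {dO : measure_display} {O : measurableType dO} {R : realType}.

Definition measurable_code (S : Type) (f : O -> S) :=
  forall s, measurable [set w | f w = s].

Lemma fin_valE (S : finType) (f : O -> S) (phi : S -> R) w :
  (phi (f w) = \sum_s phi s * \1_[set w | f w = s] w)%R.
Proof.
rewrite (bigD1 (f w))//= indicE mem_set// mulr1 big1 ?addr0// => s sf.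
by rewrite indicE memNset ?mulr0//= => fs; rewrite fs eqxx in sf.
Qed.

Lemma measurable_fin_val (S : finType) (f : O -> S) (phi : S -> R) :
  measurable_code f -> measurable_fun [set: O] (fun w => phi (f w)).
Proof.
move=> mf; rewrite (_ : (fun w => _) =
  (fun w => \sum_s phi s * \1_[set w | f w = s] w)%R).
  apply: measurable_sum => s; apply: measurable_funM => //.
by apply/funext => w; exact: fin_valE.
Qed.

Lemma integral_fin_val (m : {measure set O -> \bar R}) (S : finType)
    (f : O -> S) (phi : S -> R) :
  measurable_code f -> (forall s, (0 <= phi s)%R) ->
  \int[m]_w (phi (f w))%:E = \sum_s (phi s)%:E * m [set w | f w = s].
Proof.
move=> mf phi0.
under eq_integral do rewrite fin_valE -sumEFin.
rewrite ge0_integral_sum//.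
- apply: eq_bigr => s _; under eq_integral do rewrite EFinM.
  have mi := @measurable_indic _ _ R setT _ (mf s).
  rewrite ge0_integralZl_EFin//; last exact/measurable_EFinP.
  by rewrite integral_indic ?setIT//; exact: mf.
- move=> s; apply/measurable_EFinP; apply: measurable_funM => //.
- by move=> s w _; rewrite lee_fin mulr_ge0.
Qed.

Lemma measurable_code_pair (S S' : Type) (f : O -> S) (g : O -> S') :
  measurable_code f -> measurable_code g -> measurable_code (fun w => (f w, g w)).
Proof.
move=> mf mg [s t]; rewrite (_ : [set w | _] = [set w | f w = s] `&` [set w | g w = t]).
  exact: measurableI.
by apply/seteqP; split => w /= [-> ->].
Qed.

Lemma measurable_code_preimage (S : finType) (f : O -> S) (P : set S) :
  measurable_code f -> measurable [set w | P (f w)].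
Proof.
move=> mf; rewrite (_ : [set w | _] = \bigcup_(s in P) [set w | f w = s]).
  by apply: fin_bigcup_measurable => //; exact: finite_finset.
by apply/seteqP; split => [w Pw|w [s Ps /= ->]//]; exists (f w).
Qed.

End finite_code.

Lemma measurable_code_comp {d1 d2 : measure_display} {T1 : measurableType d1}
    {T2 : measurableType d2} (S : Type) (f : T2 -> S) (g : T1 -> T2) :
  measurable_code f -> measurable_fun [set: T1] g -> measurable_code (f \o g).
Proof. by move=> mf mg s; have := mg measurableT _ (mf s); rewrite setTI. Qed.

Section cells.
Context {dT : measure_display} {T : measurableType dT} {R : realType}.

Definition measurable_base (rho : T -> T -> R) (B : nat -> set T) :=
  (forall k, measurable (B k)) /\
  forall A x, metric_open rho A -> A x -> exists2 k, B k x & B k `<=` A.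

Lemma polish_metric_base (rho : T -> T -> R) : polish_metric rho ->
  exists B, measurable_base rho B.
Proof.
move=> prho; have [mrho _ [u du] _] := prho; have [_ _ sym tri] := mrho.
pose b (p : nat * nat) := [set y | (rho (u p.1) y < p.2.+1%:R^-1)%R].
exists (fun k => if unpickle k is Some p then b p else set0); split.
  move=> k; case: unpickle => [p|//].
  exact/(measurable_metric_open prho)/metric_open_ball.
move=> A x oA Ax; have [e e0 eA] := oA x Ax.
have e20 : (0 < e / 2)%R by rewrite divr_gt0.
have [k ke] := ltr_add_invr e20; rewrite add0r in ke.
have [n xn] := du x k.+1%:R^-1%R ltac:(by rewrite invr_gt0).
exists (pickle (n, k)); rewrite pickleK /b/=; first by rewrite sym.
move=> y /= uy; apply: eA; apply: (le_lt_trans (tri x (u n) y)).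
by rewrite (splitr e) ltrD//; exact: lt_trans ke.
Qed.

Variable B : nat -> set T.

(** The fibres are the cells of level [n]: two points share a cell when no [B k] with [k < n]
    separates them. *)
Definition code n (x : T) : {ffun 'I_n -> bool} := [ffun k : 'I_n => x \in B k].

Lemma code_mono n m x y : (n <= m)%N -> code m x = code m y -> code n x = code n y.
Proof.
move=> nm /ffunP H; apply/ffunP => k.
by have := H (widen_ord nm k); rewrite !ffunE.
Qed.

Lemma measurable_code_code n : (forall k, measurable (B k)) ->
  measurable_code (code n).
Proof.
move=> mB s.
rewrite (_ : [set w | _] = \bigcap_(k in [set: 'I_n])
    (if s k then B k else ~` B k)).
  apply: fin_bigcap_measurable; first exact: finite_finset.
  by move=> k _; case: (s k) => //; exact: measurableC.
apply/seteqP; split => [x <- k _|x H].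
  by rewrite ffunE; case: ifPn => [/set_mem//|/negP nB Bx]; apply/nB/mem_set.
apply/ffunP => k; rewrite ffunE; have := H k I.
by case: (s k) => h; [exact/mem_set|exact/memNset].
Qed.

Variable d : T -> T -> R.
Hypothesis d_ge0 : forall x y, (0 <= d x y)%R.

(** If one of the cells is empty, this is the infimum of the empty set, which is 0; the cost is thus
    nonnegative everywhere. *)
Definition cell_cost n (st : {ffun 'I_n -> bool} * {ffun 'I_n -> bool}) : R :=
  inf [set r | exists x y, [/\ code n x = st.1, code n y = st.2 & r = d x y]].

Lemma cell_cost_ge0 n st : (0 <= @cell_cost n st)%R.
Proof.
rewrite /cell_cost; set E := [set r | _].
have [->|/set0P E0] := eqVneq E set0; first by rewrite inf0.
by apply: lb_le_inf => // _ [x [y [_ _ ->]]].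
Qed.

Lemma cell_cost_le n x y : (cell_cost (code n x, code n y) <= d x y)%R.
Proof. by apply: ge_inf; [exists 0%R => _ [? [? [_ _ ->]]]|exists x, y]. Qed.

Lemma le_cell_cost n x y a : (forall x' y', code n x' = code n x ->
  code n y' = code n y -> (a <= d x' y')%R) -> (a <= cell_cost (code n x, code n y))%R.
Proof.
move=> H; apply: lb_le_inf; first by exists (d x y), x, y.
by move=> _ [x' [y' [/= ? ? ->]]]; exact: H.
Qed.

Lemma cell_cost_mono x y :
  nondecreasing_seq (fun n => cell_cost (code n x, code n y)).
Proof.
move=> n m nm; apply: le_cell_cost => x' y' xx' yy'.
rewrite -(code_mono nm xx') -(code_mono nm yy'); exact: cell_cost_le.
Qed.

Hypothesis mB : forall k, measurable (B k).

Hypothesis d_lsc : forall x y a, (a < d x y)%R -> exists k l,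
  [/\ B k x, B l y & forall x' y', B k x' -> B l y' -> (a < d x' y')%R].

(** Semicontinuity gives base sets [B k] and [B l] on which [d] exceeds [d x y - e]; once [n] is
    larger than [k] and [l], they contain the cells of [x] and [y]. *)
Lemma cvg_cell_cost x y : (fun n => cell_cost (code n x, code n y)) @ \oo --> d x y.
Proof.
apply/cvgrPdist_le => e e0.
have [k [l [kx ly H]]] : exists k l, [/\ B k x, B l y &
    forall x' y', B k x' -> B l y' -> (d x y - e < d x' y')%R].
  by apply: d_lsc; rewrite ltrBlDr ltrDl.
exists (maxn k l).+1 => // n /=; rewrite gtn_max => /andP[kn ln].
rewrite ger0_norm ?subr_ge0 ?cell_cost_le// lerBlDr -lerBlDl.
apply: le_cell_cost => x' y' /ffunP xx' /ffunP yy'; apply/ltW/H.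
- by have := xx' (Ordinal kn); rewrite !ffunE/= (mem_set kx) => /set_mem.
- by have := yy' (Ordinal ln); rewrite !ffunE/= (mem_set ly) => /set_mem.
Qed.

Context {dO : measure_display} {O : measurableType dO}.
Variables (X Y : O -> T).
Hypotheses (mX : measurable_fun [set: O] X) (mY : measurable_fun [set: O] Y).

Let mcode n : measurable_code (fun w => (code n (X w), code n (Y w))).
Proof.
by apply: measurable_code_pair; apply: measurable_code_comp => //;
  exact: measurable_code_code.
Qed.

Lemma measurable_lsc_cost : measurable_fun [set: O] (fun w => d (X w) (Y w)).
Proof.
apply: (@measurable_fun_cvg _ _ _ _
  (fun n w => cell_cost (code n (X w), code n (Y w)))).
  by move=> n; exact: (measurable_fin_val (@cell_cost n) (@mcode n)).
by move=> w _; exact: cvg_cell_cost.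
Qed.

Variable m : {measure set O -> \bar R}.

(** Monotone convergence. The discretized costs involve the measure only through finitely many
    cells, so bounds on them survive a limit along an ultrafilter. *)
Lemma integral_lsc_cost_le (M : \bar R) :
  (forall n, \sum_st (@cell_cost n st)%:E *
    m [set w | (code n (X w), code n (Y w)) = st] <= M) ->
  \int[m]_w (d (X w) (Y w))%:E <= M.
Proof.
move=> HM.
have -> : \int[m]_w (d (X w) (Y w))%:E =
    limn (fun n => \int[m]_w (cell_cost (code n (X w), code n (Y w)))%:E).
  rewrite -monotone_convergence//.
  - apply: eq_integral => w _; apply/esym/cvg_lim => //.
    by apply: cvg_EFin; [exact: nearW|exact: cvg_cell_cost].
  - move=> n; apply/measurable_EFinP.
    exact: (measurable_fin_val (@cell_cost n) (@mcode n)).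
  - by move=> n w _; rewrite lee_fin cell_cost_ge0.
  - by move=> w _ n n' nn'; rewrite lee_fin; exact: cell_cost_mono.
apply: lime_le.
  apply: ereal_nondecreasing_is_cvgn => n n' nn'; apply: ge0_le_integral => //.
  - by move=> w _; rewrite lee_fin cell_cost_ge0.
  - apply/measurable_EFinP.
    exact: (measurable_fin_val (@cell_cost n) (@mcode n)).
  - apply/measurable_EFinP.
    exact: (measurable_fin_val (@cell_cost n') (@mcode n')).
  - by move=> w _; rewrite lee_fin; exact: cell_cost_mono.
apply: nearW => n; rewrite (integral_fin_val m (@mcode n))//.
exact: cell_cost_ge0.
Qed.

Lemma le_integral_lsc_cost n :
  \sum_st (@cell_cost n st)%:E * m [set w | (code n (X w), code n (Y w)) = st] <=
  \int[m]_w (d (X w) (Y w))%:E.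
Proof.
rewrite -(integral_fin_val m (@mcode n)); last exact: cell_cost_ge0.
apply: ge0_le_integral => //.
- by move=> w _; rewrite lee_fin cell_cost_ge0.
- apply/measurable_EFinP.
  exact: (measurable_fin_val (@cell_cost n) (@mcode n)).
- exact/measurable_EFinP/measurable_lsc_cost.
- by move=> w _; rewrite lee_fin cell_cost_le.
Qed.

End cells.

Section subcell.
Context {dT : measure_display} {T : measurableType dT} (B : nat -> set T).

(** A common point is required, so an empty fine cell lies in no coarse one. *)
Definition subcell m (s : {ffun 'I_m -> bool}) n (t : {ffun 'I_n -> bool}) :=
  `[< exists2 x, code B n x = t & code B m x = s >].

Lemma subcellE m n (s : {ffun 'I_m -> bool}) x : (m <= n)%N ->
  subcell s (code B n x) = (code B m x == s).
Proof.
move=> mn; apply/asboolP/eqP => [[y /(code_mono mn) -> //]|xs].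
by exists x.
Qed.

End subcell.

(** * Couplings prescribed on pairs of cells *)

Section kernel_probability.
Context {d1 d2 : measure_display} {X : measurableType d1} {Y : measurableType d2}
  {R : realType}.

Variable K : R.-pker X ~> Y.

(** The values of a kernel are typed as measures only; this copy carries the probability
    structure. *)
Definition kernel_probability (x : X) : set Y -> \bar R := K x.

HB.instance Definition _ x := Measure.on (kernel_probability x).
Let kernel_probability_setT x : kernel_probability x setT = 1.
Proof. exact: prob_kernel. Qed.

HB.instance Definition _ x := Measure_isProbability.Build _ _ _
  (kernel_probability x) (kernel_probability_setT x).

End kernel_probability.

Lemma integral_probability_cst {d : measure_display} {T : measurableType d}
    {R : realType} (P : probability T R) (r : \bar R) : \int[P]_x r = r.
Proof.
rewrite integral_cst// -[RHS]mule1; congr (_ * _); exact: probability_setT.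
Qed.

Lemma measure_code_partition {d : measure_display} {T : measurableType d}
    {R : realType} (m : {measure set T -> \bar R}) (S : finType) (c : T -> S)
    (A : set T) : measurable_code c -> measurable A ->
  \sum_s m (A `&` [set x | c x = s]) = m A.
Proof.
move=> mc mA; have := @integral_fin_val _ _ _ (mrestr m mA) _ c (fun=> 1%R) mc.
rewrite integral_cst// mul1e => /(_ (fun=> ler01)) h.
have <- : mrestr m mA setT = m A by rewrite /mrestr setTI.
by rewrite h; apply: eq_bigr => s _; rewrite mul1e /mrestr setIC.
Qed.

Lemma measurable_inv_ge0 {d : measure_display} {T : measurableType d}
    {R : realType} (f : T -> R) : measurable_fun [set: T] f ->
  (forall x, (0 <= f x)%R) -> measurable_fun [set: T] (fun x => (f x)^-1)%R.
Proof.
(* Inversion as the power [-1]; at 0 both conventions give 0. *)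
move=> mf f0; rewrite (_ : (fun x => _) = (@powR R ^~ (-1)%R) \o f).
  by apply: measurableT_comp => //; exact: measurable_powR.
by apply/funext => x /=; rewrite powR_inv1.
Qed.

Section cell_coupling.
Context {dO d1 d2 : measure_display} {O : measurableType dO}
  {T1 : measurableType d1} {T2 : measurableType d2} {R : realType}.
Variables (g : probability O R) (k1 : O -> probability T1 R)
  (k2 : O -> probability T2 R).
Hypothesis mk1 : forall A, measurable A -> measurable_fun [set: O] (k1 ^~ A).
Hypothesis mk2 : forall A, measurable A -> measurable_fun [set: O] (k2 ^~ A).
Variables (S1 S2 : finType) (c1 : T1 -> S1) (c2 : T2 -> S2).
Hypotheses (mc1 : measurable_code c1) (mc2 : measurable_code c2).
Variable p : S1 * S2 -> O -> R.
Hypothesis mp : forall st, measurable_fun [set: O] (p st).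
Hypothesis p_ge0 : forall st w, (0 <= p st w)%R.
Hypothesis p_marg1 : forall w s,
  (\sum_t p (s, t) w <= fine (k1 w [set x | c1 x = s]))%R.
Hypothesis p_marg2 : forall w t,
  (\sum_s p (s, t) w <= fine (k2 w [set y | c2 y = t]))%R.

(** The conditional probability of [A] given cell [s], equal to 0 when the cell is null; by
    [p_marg1], [p] puts no mass on such a cell. *)
Let q1 A s w : R :=
  (fine (k1 w (A `&` [set x | c1 x = s])) / fine (k1 w [set x | c1 x = s]))%R.
Let q2 B t w : R :=
  (fine (k2 w (B `&` [set y | c2 y = t])) / fine (k2 w [set y | c2 y = t]))%R.

Definition cell_density (A : set T1) (B : set T2) (w : O) : R :=
  (\sum_st p st w * (q1 A st.1 w * q2 B st.2 w))%R.

(* Conditionally on the cells (s, t), which are drawn with probability p (s, t) w,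
   the two coordinates are independent with laws k1 w and k2 w. *)
Definition cell_coupling (A : set T1) (B : set T2) : R :=
  fine (\int[g]_w (cell_density A B w)%:E).

Let q1_ge0 A s w : (0 <= q1 A s w)%R.
Proof. by rewrite divr_ge0// fine_ge0. Qed.

Let q2_ge0 A s w : (0 <= q2 A s w)%R.
Proof. by rewrite divr_ge0// fine_ge0. Qed.

Let ratio_le1 d (T : measurableType d) (P : probability T R) (A C : set T) :
  measurable A -> measurable C -> (fine (P (A `&` C)) / fine (P C) <= 1)%R.
Proof.
move=> mA mC; have [->|C0] := eqVneq (fine (P C)) 0%R; first by rewrite invr0 mulr0.
have Cgt0 : (0 < fine (P C))%R by rewrite lt_neqAle eq_sym C0 fine_ge0.
rewrite ler_pdivrMr// mul1r fine_le ?fin_num_measure//; first exact: measurableI.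
by apply: le_measure; rewrite ?inE//; exact: measurableI.
Qed.

Let q1_le1 A s w : measurable A -> (q1 A s w <= 1)%R.
Proof. by move=> mA; exact: ratio_le1. Qed.

Let q2_le1 A s w : measurable A -> (q2 A s w <= 1)%R.
Proof. by move=> mA; exact: ratio_le1. Qed.

Lemma cell_density_ge0 A B w : (0 <= cell_density A B w)%R.
Proof. by apply: sumr_ge0 => st _; apply: mulr_ge0 => //; exact: mulr_ge0. Qed.

Lemma cell_density_le A B w : measurable A -> measurable B ->
  (cell_density A B w <= \sum_st p st w)%R.
Proof.
move=> mA mB; apply: ler_sum => st _; rewrite ler_piMr//.
by rewrite mulr_ile1// ?q1_le1 ?q2_le1.
Qed.

Lemma sum_cell_mass w : (\sum_st p st w <= 1)%R.
Proof.
rewrite (eq_bigr (fun st => p (st.1, st.2) w)); last by case.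
rewrite -(pair_bigA _ (fun s t => p (s, t) w))/=.
apply: (@le_trans _ _ (\sum_s fine (k1 w [set x | c1 x = s]))%R).
  by apply: ler_sum => s _.
rewrite -lee_fin -sumEFin.
under eq_bigr do rewrite fineK ?fin_num_measure//.
rewrite -(probability_setT (k1 w)) -(measure_code_partition (k1 w) mc1 measurableT).
by under [leRHS]eq_bigr do rewrite setTI.
Qed.

Lemma measurable_cell_density A B : measurable A -> measurable B ->
  measurable_fun [set: O] (cell_density A B).
Proof.
move=> mA mB; apply: measurable_sum => st; apply: measurable_funM => //.
have m1 X : measurable X -> measurable_fun [set: O] (fun w => fine (k1 w X)).
  by move=> mX; apply: measurableT_comp => //; exact: mk1.
have m2 X : measurable X -> measurable_fun [set: O] (fun w => fine (k2 w X)).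
  by move=> mX; apply: measurableT_comp => //; exact: mk2.
apply: measurable_funM; apply: measurable_funM.
- by apply: m1; exact: measurableI.
- by apply: measurable_inv_ge0 => [|w]; [exact: m1|exact: fine_ge0].
- by apply: m2; exact: measurableI.
- by apply: measurable_inv_ge0 => [|w]; [exact: m2|exact: fine_ge0].
Qed.

Lemma cell_couplingE A B : measurable A -> measurable B ->
  (cell_coupling A B)%:E = \int[g]_w (cell_density A B w)%:E.
Proof.
move=> mA mB; rewrite fineK// ge0_fin_numE; last first.
  by apply: integral_ge0 => w _; rewrite lee_fin cell_density_ge0.
apply: (@le_lt_trans _ _ (\int[g]_w 1)); last first.
  rewrite integral_cst// mul1e; by rewrite (le_lt_trans (probability_le1 _ _)) ?ltry.
apply: ge0_le_integral => //.
- by move=> w _; rewrite lee_fin cell_density_ge0.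
- exact/measurable_EFinP/measurable_cell_density.
- by move=> w _; rewrite lee_fin (le_trans (cell_density_le _ _ _))// sum_cell_mass.
Qed.

Lemma cell_coupling_ge0 A B : (0 <= cell_coupling A B)%R.
Proof.
rewrite fine_ge0//; apply: integral_ge0 => w _.
by rewrite lee_fin cell_density_ge0.
Qed.

(** For fixed [w] and a fixed pair of cells, the summand is a constant multiple of the product of
    [k1 w] and [k2 w] restricted to these cells. *)
Lemma cell_coupling_additive : rectangle_additive cell_coupling.
Proof.
move=> F G n A B mF mG mA mB tFG AB; apply: EFin_inj.
rewrite cell_couplingE// -sumEFin.
under [RHS]eq_bigr do rewrite cell_couplingE//.
rewrite -ge0_integral_sum//; last 2 first.
- by move=> k; exact/measurable_EFinP/measurable_cell_density.
- by move=> k w _; rewrite lee_fin cell_density_ge0.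
apply: eq_integral => w _; rewrite sumEFin; congr EFin.
rewrite /cell_density exchange_big/=; apply: eq_bigr => -[s t] _ /=.
rewrite -mulr_sumr; congr (_ * _)%R; rewrite /q1 /q2.
set C := [set x | c1 x = s]; set D := [set y | c2 y = t].
have mC : measurable C by exact: mc1.
have mD : measurable D by exact: mc2.
under eq_bigr do rewrite mulrACA.
rewrite mulrACA -mulr_suml; congr (_ * _)%R.
apply: EFin_inj; rewrite -sumEFin.
have E X Y : measurable X -> measurable Y ->
    (fine (k1 w (X `&` C)) * fine (k2 w (Y `&` D)))%:E =
    ((k1 w) \x (k2 w)) ((X `&` C) `*` (Y `&` D)).
  move=> mX mY; rewrite product_measure1E; [|exact: measurableI..].
  by rewrite EFinM !fineK// fin_num_measure//; exact: measurableI.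
rewrite E//; under [RHS]eq_bigr do rewrite E//.
pose H k := (F k `&` C) `*` (G k `&` D).
have mH k : measurable (H k) by apply: measurableX; exact: measurableI.
have tH : trivIset setT H.
  apply/trivIsetP => i j _ _ ij; move/trivIsetP : tFG => /(_ i j I I ij) FG0.
  apply/seteqP; split => // -[x y] [[[Fx _] [Gx _]] [[Fx' _] [Gx' _]]].
  by have : (F i `*` G i `&` F j `*` G j) (x, y) by []; rewrite FG0.
have -> : (A `&` C) `*` (B `&` D) = \big[setU/set0]_(k < n) H k.
  by rewrite setXI AB big_distrl/=; apply: eq_bigr => k _; rewrite /H setXI.
exact: (measure_bigsetU (k1 w \x k2 w) mH tH).
Qed.

(** On unions of cells the conditional probabilities are 0 or 1, except for null cells, where [p]
    vanishes; only the masses [p] remain. *)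
Lemma cell_coupling_code (P : pred S1) (Q : pred S2) :
  (cell_coupling [set x | P (c1 x)] [set y | Q (c2 y)])%:E =
  \int[g]_w (\sum_(st | P st.1 && Q st.2) p st w)%:E.
Proof.
have mP : measurable [set x | P (c1 x)].
  exact: (@measurable_code_preimage _ _ _ c1 [set s | P s]).
have mQ : measurable [set y | Q (c2 y)].
  exact: (@measurable_code_preimage _ _ _ c2 [set s | Q s]).
rewrite cell_couplingE//; apply: eq_integral => w _; congr EFin.
rewrite [RHS]big_mkcond/=; apply: eq_bigr => -[s t] _ /=.
have p0l : fine (k1 w [set x | c1 x = s]) = 0%R -> p (s, t) w = 0%R.
  move=> h; apply/eqP; rewrite eq_le p_ge0 andbT -h.
  by apply: le_trans (p_marg1 w s); rewrite (bigD1 t)//= lerDl sumr_ge0.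
have p0r : fine (k2 w [set x | c2 x = t]) = 0%R -> p (s, t) w = 0%R.
  move=> h; apply/eqP; rewrite eq_le p_ge0 andbT -h.
  by apply: le_trans (p_marg2 w t); rewrite (bigD1 s)//= lerDl sumr_ge0.
have [->|pn0] := eqVneq (p (s, t) w) 0%R; first by rewrite mul0r if_same.
have -> : q1 [set x | P (c1 x)] s w = (P s)%:R%R.
  rewrite /q1; case: (boolP (P s)) => Ps.
    have -> : [set x | P (c1 x)] `&` [set x | c1 x = s] = [set x | c1 x = s].
      by apply/seteqP; split => [x []//|x /= xs]; split => //=; rewrite xs.
    by rewrite divff//; apply: contra_neq pn0; exact: p0l.
  have -> : [set x | P (c1 x)] `&` [set x | c1 x = s] = set0.
    by apply/seteqP; split => // x [/= Px xs]; rewrite -xs Px in Ps.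
  by rewrite measure0 mul0r.
have -> : q2 [set x | Q (c2 x)] t w = (Q t)%:R%R.
  rewrite /q2; case: (boolP (Q t)) => Qt.
    have -> : [set x | Q (c2 x)] `&` [set x | c2 x = t] = [set x | c2 x = t].
      by apply/seteqP; split => [x []//|x /= xt]; split => //=; rewrite xt.
    by rewrite divff//; apply: contra_neq pn0; exact: p0r.
  have -> : [set x | Q (c2 x)] `&` [set x | c2 x = t] = set0.
    by apply/seteqP; split => // x [/= Qx xt]; rewrite -xt Qx in Qt.
  by rewrite measure0 mul0r.
by rewrite -natrM mulnb; case: (_ && _); rewrite ?mulr1 ?mulr0.
Qed.

Lemma cell_coupling_mass :
  (cell_coupling setT setT)%:E = \int[g]_w (\sum_st p st w)%:E.
Proof.
have E (T S : Type) (c : T -> S) : [set x | xpredT (c x)] = [set: T].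
  by apply/seteqP; split.
by have := cell_coupling_code xpredT xpredT; rewrite (E _ _ c1) (E _ _ c2).
Qed.

(** Only an inequality, because row sums of [p] may fall short of the cell masses of [k1 w]; total
    masses tending to 1 restore equality in the limit. *)
Lemma cell_coupling_marg1 A : measurable A ->
  (cell_coupling A setT)%:E <= \int[g]_w k1 w A.
Proof.
move=> mA; rewrite cell_couplingE//; apply: ge0_le_integral => //.
- by move=> w _; rewrite lee_fin cell_density_ge0.
- exact/measurable_EFinP/measurable_cell_density.
- exact: mk1.
move=> w _; rewrite -(measure_code_partition (k1 w) mc1 mA).
rewrite -[leRHS](@eq_bigr _ _ _ _ _ _
  (fun s => (fine (k1 w (A `&` [set x | c1 x = s])))%:E)); last first.
  by move=> s _; rewrite fineK// fin_num_measure//; exact: measurableI.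
rewrite sumEFin lee_fin /cell_density.
rewrite (eq_bigr (fun st =>
  p (st.1, st.2) w * (q1 A st.1 w * q2 setT st.2 w))%R); last by case.
rewrite -(pair_bigA _ (fun s t => p (s, t) w * (q1 A s w * q2 setT t w))%R)/=.
apply: ler_sum => s _.
apply: (@le_trans _ _ ((\sum_t p (s, t) w) * q1 A s w)%R).
  rewrite mulr_suml; apply: ler_sum => t _; rewrite ler_wpM2l// ler_piMr//.
  exact: q2_le1.
apply: (@le_trans _ _ (fine (k1 w [set x | c1 x = s]) * q1 A s w)%R).
  by rewrite ler_wpM2r.
rewrite /q1; have [->|k0] := eqVneq (fine (k1 w [set x | c1 x = s])) 0%R.
  by rewrite mul0r fine_ge0.
by rewrite mulrC divfK.
Qed.

Lemma cell_coupling_marg2 B : measurable B ->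
  (cell_coupling setT B)%:E <= \int[g]_w k2 w B.
Proof.
move=> mB; rewrite cell_couplingE//; apply: ge0_le_integral => //.
- by move=> w _; rewrite lee_fin cell_density_ge0.
- exact/measurable_EFinP/measurable_cell_density.
- exact: mk2.
move=> w _; rewrite -(measure_code_partition (k2 w) mc2 mB).
rewrite -[leRHS](@eq_bigr _ _ _ _ _ _
  (fun s => (fine (k2 w (B `&` [set x | c2 x = s])))%:E)); last first.
  by move=> s _; rewrite fineK// fin_num_measure//; exact: measurableI.
rewrite sumEFin lee_fin /cell_density.
rewrite (eq_bigr (fun st =>
  p (st.1, st.2) w * (q1 setT st.1 w * q2 B st.2 w))%R); last by case.
rewrite -(pair_bigA _ (fun s t => p (s, t) w * (q1 setT s w * q2 B t w))%R)/=.
rewrite exchange_big/=; apply: ler_sum => t _.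
apply: (@le_trans _ _ ((\sum_s p (s, t) w) * q2 B t w)%R).
  rewrite mulr_suml; apply: ler_sum => s _; rewrite ler_wpM2l// ler_piMl//.
  exact: q1_le1.
apply: (@le_trans _ _ (fine (k2 w [set x | c2 x = t]) * q2 B t w)%R).
  by rewrite ler_wpM2r.
rewrite /q2; have [->|k0] := eqVneq (fine (k2 w [set x | c2 x = t])) 0%R.
  by rewrite mul0r fine_ge0.
by rewrite mulrC divfK.
Qed.

(** Meant for cells of a coordinate that is not resampled: its value is determined by [w], so unless
    the current points lie in these cells, one of the two sides is null. *)
Lemma cell_coupling_null (A : set T1) (B : set T2) (D : set O) :
  measurable A -> measurable B -> measurable D ->
  (forall w, ~ D w -> k1 w A = 0 \/ k2 w B = 0) ->
  (cell_coupling A B)%:E <= g D.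
Proof.
move=> mA mB mD H; rewrite cell_couplingE//.
have -> : g D = \int[g]_w (\1_D w)%:E by rewrite integral_indic ?setIT.
apply: ge0_le_integral => //.
- by move=> w _; rewrite lee_fin cell_density_ge0.
- exact/measurable_EFinP/measurable_cell_density.
- exact/measurable_EFinP/measurable_indic.
move=> w _; rewrite lee_fin indicE; case: (boolP (w \in D)) => [_|/negP wD].
  by rewrite (le_trans (cell_density_le _ _ _))// sum_cell_mass.
have nDw : ~ D w by move=> /mem_set.
rewrite /cell_density big1// => -[s t] _ /=.
have null0 d (T : measurableType d) (P : probability T R) (X C : set T) :
    measurable X -> measurable C -> P X = 0 -> P (X `&` C) = 0.
  move=> mX mC X0; apply/eqP; rewrite -measure_le0 -X0.
  by apply: le_measure; rewrite ?inE//; exact: measurableI.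
case: (H w nDw) => h.
  by rewrite /q1 null0// mul0r mul0r mulr0.
by rewrite /q2 null0// mul0r mulr0 mulr0.
Qed.

End cell_coupling.

Section cell_coupling_limit.
Context {dO d1 d2 : measure_display} {O : measurableType dO}
  {T1 : measurableType d1} {T2 : measurableType d2} {R : realType}.
Variables (g : probability O R) (k1 : O -> probability T1 R)
  (k2 : O -> probability T2 R).
Hypothesis mk1 : forall A, measurable A -> measurable_fun [set: O] (k1 ^~ A).
Hypothesis mk2 : forall A, measurable A -> measurable_fun [set: O] (k2 ^~ A).
Variables (S1 S2 : nat -> finType).
Variables (c1 : forall n, T1 -> S1 n) (c2 : forall n, T2 -> S2 n).
Hypothesis mc1 : forall n, measurable_code (@c1 n).
Hypothesis mc2 : forall n, measurable_code (@c2 n).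
Variable p : forall n, S1 n * S2 n -> O -> R.
Hypothesis mp : forall n st, measurable_fun [set: O] (@p n st).
Hypothesis p_ge0 : forall n st w, (0 <= @p n st w)%R.
Hypothesis p_marg1 : forall n w s,
  (\sum_t @p n (s, t) w <= fine (k1 w [set x | @c1 n x = s]))%R.
Hypothesis p_marg2 : forall n w t,
  (\sum_s @p n (s, t) w <= fine (k2 w [set y | @c2 n y = t]))%R.
Hypothesis p_mass : forall n w, (1 - n.+1%:R^-1 <= \sum_st @p n st w)%R.
Variables (rho1 : T1 -> T1 -> R) (rho2 : T2 -> T2 -> R).
Hypotheses (prho1 : polish_metric rho1) (prho2 : polish_metric rho2).
Variables (nu1 : probability T1 R) (nu2 : probability T2 R).
Hypothesis k1_nu1 : forall A, measurable A -> \int[g]_w k1 w A <= nu1 A.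
Hypothesis k2_nu2 : forall A, measurable A -> \int[g]_w k2 w A <= nu2 A.

Lemma cell_coupling_limit :
  exists (U : set_system nat) (G : probability (T1 * T2)%type R),
  [/\ UltraFilter U, \oo `<=` U,
    forall A, measurable A -> G (A `*` setT) = nu1 A,
    forall B, measurable B -> G (setT `*` B) = nu2 B &
    forall A B, measurable A -> measurable B ->
      (fun n => cell_coupling g k1 k2 (@c1 n) (@c2 n) (@p n) A B) @ U -->
      fine (G (A `*` B))].
Proof.
apply: (limit_coupling prho1 prho2).
- by move=> n A B _ _; apply: cell_coupling_ge0; exact: p_ge0.
- by move=> n; exact: (cell_coupling_additive g mk1 mk2 (@mc1 n) (@mc2 n)
    (@mp n) (@p_ge0 n) (@p_marg1 n)).
- move=> n A mA; apply: le_trans (k1_nu1 mA).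
  exact: (cell_coupling_marg1 g mk1 mk2 (@mc1 n) (@mc2 n) (@mp n) (@p_ge0 n)).
- move=> n A mA; apply: le_trans (k2_nu2 mA).
  exact: (cell_coupling_marg2 g mk1 mk2 (@mc1 n) (@mc2 n) (@mp n) (@p_ge0 n)).
- move=> n; rewrite -lee_fin (cell_coupling_mass g mk1 mk2 (@mc1 n) (@mc2 n)
    (@mp n) (@p_ge0 n) (@p_marg1 n) (@p_marg2 n)).
  have -> : (1 - n.+1%:R^-1)%:E = \int[g]_w (1 - n.+1%:R^-1 : R)%:E.
    by rewrite integral_probability_cst.
  apply: ge0_le_integral => //.
  + by move=> w _; rewrite lee_fin subr_ge0 invf_le1// ler1n.
  + by apply/measurable_EFinP; apply: measurable_sum => st; exact: mp.
  + by move=> w _; rewrite lee_fin.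
Qed.

End cell_coupling_limit.

(** * Gluing and the Wasserstein distance *)

Lemma integral_marginal {d1 d2 : measure_display} {T1 : measurableType d1}
    {T2 : measurableType d2} {R : realType} (g : probability T1 R)
    (m : {measure set T2 -> \bar R}) (f : T1 -> T2) (h : T2 -> \bar R) :
  measurable_fun [set: T1] f ->
  (forall A, measurable A -> g (f @^-1` A) = m A) ->
  measurable_fun [set: T2] h -> (forall y, 0 <= h y) ->
  \int[g]_x h (f x) = \int[m]_y h y.
Proof.
move=> mf gm mh h0; rewrite -(ge0_integral_image_probability g mf)//.
by apply: eq_measure_integral => A mA _; exact: gm.
Qed.

Section wasserstein.
Context {dT : measure_display} {T : measurableType dT} {R : realType}.
Implicit Types (nu : {measure set T -> \bar R}) (d : T -> T -> R).

Lemma W1_ge0 d nu1 nu2 : (forall x y, 0 <= d x y)%R -> 0 <= W1 d nu1 nu2.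
Proof.
move=> d0; apply: le_ereal_inf_tmp => _ [g _ <-].
by apply: integral_ge0 => x _; rewrite lee_fin.
Qed.

Lemma W1_le d nu1 nu2 (g : probability (T * T)%type R) : is_coupling g nu1 nu2 ->
  W1 d nu1 nu2 <= \int[g]_p (d p.1 p.2)%:E.
Proof. by move=> h; apply: ereal_inf_lbound; exists g. Qed.

Lemma W1_lt d nu1 nu2 a : W1 d nu1 nu2 < a ->
  exists2 g : probability (T * T)%type R, is_coupling g nu1 nu2 &
    \int[g]_p (d p.1 p.2)%:E < a.
Proof. by move=> /ereal_inf_lt[_ [g gc <-] ga]; exists g. Qed.

End wasserstein.

Lemma measurable_base_separates {dT : measure_display} {T : measurableType dT}
    {R : realType} (rho : T -> T -> R) (B : nat -> set T) (x y : T) :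
  is_metric rho -> measurable_base rho B ->
  (forall n, code B n x = code B n y) -> x = y.
Proof.
move=> mrho [_ bB] H; have [ge0 eq0 sym _] := mrho.
apply: contrapT => xy.
have [|k Bkx kS] := bB _ x (metric_open_ball (x := x) (e := rho x y) mrho).
  rewrite /= (proj2 (eq0 x x))// lt_neqAle ge0 andbT.
  by apply/eqP => /esym/eq0.
have /ffunP/(_ ord_max) := H k.+1; rewrite !ffunE/= (mem_set Bkx).
by move=> /esym/set_mem/kS/=; rewrite ltxx.
Qed.

Section lsc_metric.
Context {dT : measure_display} {T : measurableType dT} {R : realType}.

(* A metric that is lower semicontinuous for the topology of a Polish metric,
   the latter being seen through a countable base. *)
Definition lsc_metric (rho d : T -> T -> R) (B : nat -> set T) :=
  [/\ polish_metric rho, measurable_base rho B, is_metric d &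
      forall x y a, (a < d x y)%R -> exists k l,
      [/\ B k x, B l y & forall x' y', B k x' -> B l y' -> (a < d x' y')%R]].

Variables (rho d : T -> T -> R) (B : nat -> set T).
Hypothesis lscd : lsc_metric rho d B.

Lemma measurable_lsc_metric {dO : measure_display} {O : measurableType dO}
    (X Y : O -> T) : measurable_fun [set: O] X -> measurable_fun [set: O] Y ->
  measurable_fun [set: O] (fun w => (d (X w) (Y w))%:E).
Proof.
move=> mX mY; have [_ [mB _] [d0 _ _ _] lsc] := lscd.
exact/measurable_EFinP/(measurable_lsc_cost d0 mB lsc mX mY).
Qed.

Lemma W1_refl (nu : probability T R) : W1 d nu nu <= 0.
Proof.
have [_ _ [d0 eq0 _ _] _] := lscd.
have mD : measurable_fun [set: T] (fun x : T => (x, x)).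
  by apply: measurable_fun_pair.
apply: (le_trans (@W1_le _ _ _ _ _ _ (image_probability nu mD) _)).
  move=> A mA; split; congr (nu _); apply/seteqP; split => x //=.
    by case.
  by case.
rewrite ge0_integral_image_probability/=.
- by rewrite integral0_eq// => x _; rewrite (proj2 (eq0 x x)).
- exact: measurable_lsc_metric.
- by move=> y; rewrite lee_fin.
Qed.

(** No disintegration: the couplings become laws [Q1] and [Q2] of pairs, coupled so that the second
    point of the first pair and the first point of the second fall in the same cell. This is
    possible since both have law [nu2], and in the limit these two middle points coincide. *)
Lemma coupling_gluing (nu1 nu2 nu3 : {measure set T -> \bar R})
    (q1 q2 : probability (T * T)%type R) :
  is_coupling q1 nu1 nu2 -> is_coupling q2 nu2 nu3 ->
  exists2 q : probability (T * T)%type R, is_coupling q nu1 nu3 &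
    \int[q]_p (d p.1 p.2)%:E <=
      \int[q1]_p (d p.1 p.2)%:E + \int[q2]_p (d p.1 p.2)%:E.
Proof.
move=> cq1 cq2; have [prho bB mdd lsc] := lscd; have [mB _] := bB.
have [d_ge0 eq0 sym tri] := mdd.
have [mrho _ _ _] := prho.
(* Pairs are encoded as 2-tuples so that [polish_metric_tuple] applies. *)
pose X := (2.-tuple T); pose i0 : 'I_2 := ord0; pose i1 : 'I_2 := ord_max.
pose pt (p : T * T) : X := [tuple of [:: p.1; p.2]].
have mpt : measurable_fun [set: T * T] pt.
  apply/measurable_fun_tnthP => i; have [->|->] : i = i0 \/ i = i1.
    by case: i => [[|[|//]]] h; [left|right]; exact/val_inj.
  - exact: measurable_fst.
  - exact: measurable_snd.
pose Q1 := image_probability q1 mpt; pose Q2 := image_probability q2 mpt.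
have m0 : measurable_fun [set: X] (fun x : X => tnth x i0) by exact: measurable_tnth.
have m1 : measurable_fun [set: X] (fun x : X => tnth x i1) by exact: measurable_tnth.
pose c1 n (x : X) := code B n (tnth x i1).
pose c2 n (x : X) := code B n (tnth x i0).
have mc1 n : measurable_code (c1 n).
  by apply: (measurable_code_comp (g := fun x : X => tnth x i1)) => //;
    exact: measurable_code_code.
have mc2 n : measurable_code (c2 n).
  by apply: (measurable_code_comp (g := fun x : X => tnth x i0)) => //;
    exact: measurable_code_code.
have Q1E n s : Q1 [set x | c1 n x = s] = nu2 [set x | code B n x = s].
  rewrite -(cq1 [set x | code B n x = s] _).2; last exact: measurable_code_code.
  by congr (q1 _); apply/seteqP; split => -[x y]; rewrite /= /c1 /=; tauto.
have Q2E n s : Q2 [set x | c2 n x = s] = nu2 [set x | code B n x = s].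
  rewrite -(cq2 [set x | code B n x = s] _).1; last exact: measurable_code_code.
  by congr (q2 _); apply/seteqP; split => -[x y]; rewrite /= /c2 /=; tauto.
(* The diagonal matrix of the cell masses of [nu2]; the kernels are the constant laws [Q1] and
   [Q2]. *)
pose p n (st : {ffun 'I_n -> bool} * {ffun 'I_n -> bool}) (w : X) : R :=
  ((st.1 == st.2)%:R * fine (Q1 [set x | c1 n x = st.1]))%R.
have p_ge0 n st w : (0 <= p n st w)%R by rewrite mulr_ge0// fine_ge0.
have pE1 n s w : (\sum_t p n (s, t) w = fine (Q1 [set x | c1 n x = s]))%R.
  rewrite (bigD1 s)//= /p/= eqxx mul1r big1 ?addr0// => t ts.
  by rewrite eq_sym (negbTE ts) mul0r.
have pE2 n t w : (\sum_s p n (s, t) w = fine (Q2 [set x | c2 n x = t]))%R.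
  rewrite (bigD1 t)//= /p/= eqxx mul1r big1 ?addr0 ?Q2E ?Q1E// => s ts.
  by rewrite (negbTE ts) mul0r.
have mk1 A : measurable A -> measurable_fun [set: X] (fun=> Q1 A) by [].
have mk2 A : measurable A -> measurable_fun [set: X] (fun=> Q2 A) by [].
have mp n st : measurable_fun [set: X] (p n st) by exact: measurable_cst.
have pl1 n w s : (\sum_t p n (s, t) w <= fine (Q1 [set x | c1 n x = s]))%R.
  by rewrite pE1.
have pl2 n w t : (\sum_s p n (s, t) w <= fine (Q2 [set x | c2 n x = t]))%R.
  by rewrite pE2.
have pm n w : (1 - n.+1%:R^-1 <= \sum_st p n st w)%R.
  apply: (@le_trans _ _ 1%R); first by rewrite lerBlDr lerDl.
  rewrite (eq_bigr (fun st => p n (st.1, st.2) w)); last by case.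
  rewrite -(pair_bigA _ (fun s t => p n (s, t) w))/=.
  under eq_bigr do rewrite pE1.
  rewrite -lee_fin -sumEFin -(probability_setT Q1).
  rewrite -(measure_code_partition Q1 (mc1 n) measurableT).
  by apply: lee_sum => s _; rewrite setTI fineK// fin_num_measure//; exact: mc1.
have intc (Q : probability X R) A : measurable A -> \int[Q1]_w Q A <= Q A.
  by move=> mA; rewrite integral_probability_cst.
have [U [g [uU subU g1 g2 gb]]] := cell_coupling_limit mk1 mk2 mc1 mc2 mp p_ge0
  pl1 pl2 pm (polish_metric_tuple (N := 2) prho) (polish_metric_tuple (N := 2) prho)
  (intc Q1) (intc Q2).
(* At levels [n >= m] the approximations give exactly 0: equal cells of level [n] lie in the same
   cell of level [m]. *)
have diag m s t : s != t -> g ([set x | c1 m x = s] `*` [set y | c2 m y = t]) = 0.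
  move=> st; have mst : measurable ([set x | c1 m x = s] `*` [set y | c2 m y = t]).
    by apply: measurableX; [exact: mc1|exact: mc2].
  rewrite -(@fineK _ (g _)) ?fin_num_measure//; congr EFin.
  have /(cvg_lim (@Rhausdorff R)) <- := gb _ _ (mc1 m s) (mc2 m t).
  apply: cvg_lim => //.
  apply: cvg_near_cst; apply: subU; exists m => // n /= mn.
  have -> : [set x | c1 m x = s] = [set x | subcell B s (c1 n x)].
    by apply/seteqP; split => x /=; rewrite /c1 subcellE// => /eqP.
  have -> : [set x | c2 m x = t] = [set x | subcell B t (c2 n x)].
    by apply/seteqP; split => x /=; rewrite /c2 subcellE// => /eqP.
  apply: EFin_inj; rewrite (cell_coupling_code Q1 mk1 mk2 (mc1 n) (mc2 n)
    (mp n) (p_ge0 n) (pl1 n) (pl2 n)).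
  rewrite integral0_eq// => w _; rewrite big1// => -[s' t'] /= /andP[].
  rewrite /p/=; have [<-|] := eqVneq s' t'; last by rewrite mul0r.
  move=> /asboolP[x xs' xs] /asboolP[y ys' yt]; move: st.
  by rewrite -xs -yt (code_mono mn (etrans xs' (esym ys'))) eqxx.
have mZ1 : measurable_fun [set: X * X] (fun z => tnth z.1 i1).
  exact: measurableT_comp m1 measurable_fst.
have mZ2 : measurable_fun [set: X * X] (fun z => tnth z.2 i0).
  exact: measurableT_comp m0 measurable_snd.
have mZ0 : measurable_fun [set: X * X] (fun z => tnth z.1 i0).
  exact: measurableT_comp m0 measurable_fst.
have mZ3 : measurable_fun [set: X * X] (fun z => tnth z.2 i1).
  exact: measurableT_comp m1 measurable_snd.
have mid : {ae g, forall z, tnth z.1 i1 = tnth z.2 i0}.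
  (* Off this null set the middle points share their cell at every level, and the base separates
     points. *)
  pose D := \bigcup_n \bigcup_(st in [set st | st.1 != st.2])
    ([set x | c1 n x = st.1] `*` [set y | c2 n y = st.2]).
  have mC n st : measurable ([set x | c1 n x = st.1] `*` [set y | c2 n y = st.2]).
    by apply: measurableX; [exact: mc1|exact: mc2].
  have mD n : measurable (\bigcup_(st in [set st | st.1 != st.2])
      ([set x | c1 n x = st.1] `*` [set y | c2 n y = st.2])).
    by apply: fin_bigcup_measurable => //; exact: finite_finset.
  exists D; split.
  - by apply: bigcup_measurable => n _; exact: mD.
  - apply/eqP; rewrite -measure_le0.
    apply: (le_trans (measure_sigma_subadditive g mD _ (@subset_refl _ _))).
      by apply: bigcup_measurable => n _; exact: mD.
    rewrite eseries0// => n _ _; apply/eqP; rewrite -measure_le0.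
    have fD : finite_set [set st : {ffun 'I_n -> bool} * {ffun 'I_n -> bool} |
        st.1 != st.2] by exact: finite_finset.
    apply: (le_trans (content_sub_fsum g fD _ (mD n) (@subset_refl _ _))) => //.
    by rewrite fsbig1// => -[s t] /= st; exact: diag.
  - move=> z /= zne; apply: contrapT => nD; apply: zne.
    apply: (measurable_base_separates mrho bB) => n.
    apply/eqP; apply: contrapT => /negP ne; apply: nD.
    by exists n => //; exists (code B n (tnth z.1 i1), code B n (tnth z.2 i0)).
have mq : measurable_fun [set: X * X] (fun z => (tnth z.1 i0, tnth z.2 i1)).
  exact: measurable_fun_pair.
have gq1 A : measurable A -> g ((fun z => (tnth z.1 i0, tnth z.1 i1)) @^-1` A) = q1 A.
  move=> mA; have mA' : measurable ((fun x : X => (tnth x i0, tnth x i1)) @^-1` A).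
    by rewrite -[X in measurable X]setTI; apply: measurable_fun_pair.
  rewrite -[RHS](_ : Q1 ((fun x : X => (tnth x i0, tnth x i1)) @^-1` A) = _).
    by rewrite -g1// setXT.
  by congr (q1 _); apply/seteqP; split => -[x y].
have gq2 A : measurable A -> g ((fun z => (tnth z.2 i0, tnth z.2 i1)) @^-1` A) = q2 A.
  move=> mA; have mA' : measurable ((fun x : X => (tnth x i0, tnth x i1)) @^-1` A).
    by rewrite -[X in measurable X]setTI; apply: measurable_fun_pair.
  rewrite -[RHS](_ : Q2 ((fun x : X => (tnth x i0, tnth x i1)) @^-1` A) = _).
    by rewrite -g2// setTX.
  by congr (q2 _); apply/seteqP; split => -[x y].
have mdd0 : measurable_fun [set: T * T] (fun p : T * T => (d p.1 p.2)%:E).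
  exact: measurable_lsc_metric.
exists (image_probability g mq).
  move=> A mA; split.
    rewrite -(cq1 A mA).1 -gq1; last exact: measurableX.
    by congr (g _); apply/seteqP; split => -[x y] /=; tauto.
  rewrite -(cq2 A mA).2 -gq2; last exact: measurableX.
  by congr (g _); apply/seteqP; split => -[x y] /=; tauto.
rewrite ge0_integral_image_probability//=; last by move=> y; rewrite lee_fin.
rewrite -(integral_marginal (measurable_fun_pair mZ0 mZ1) gq1 mdd0); last first.
  by move=> y; rewrite lee_fin.
rewrite -(integral_marginal (measurable_fun_pair mZ2 mZ3) gq2 mdd0); last first.
  by move=> y; rewrite lee_fin.
rewrite -ge0_integralD//=; last 4 first.
- by move=> y _; rewrite lee_fin.
- exact: measurable_lsc_metric.
- by move=> y _; rewrite lee_fin.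
- exact: measurable_lsc_metric.
apply: ae_ge0_le_integral => //.
- by move=> z _; rewrite lee_fin.
- exact: measurable_lsc_metric.
- by move=> z _; rewrite adde_ge0// lee_fin.
- by apply: emeasurable_funD; exact: measurable_lsc_metric.
apply: filterS mid => z e _; rewrite -EFinD lee_fin.
by rewrite -e; exact: tri.
Qed.

Lemma W1_triangle (nu1 nu2 nu3 : {measure set T -> \bar R}) :
  W1 d nu1 nu3 <= W1 d nu1 nu2 + W1 d nu2 nu3.
Proof.
have [_ _ [d0 _ _ _] _] := lscd.
have [->|n12] := eqVneq (W1 d nu1 nu2) +oo.
  by rewrite addye ?leey// gt_eqF// (lt_le_trans _ (W1_ge0 _ _ d0)).
have [->|n23] := eqVneq (W1 d nu2 nu3) +oo.
  by rewrite addey ?leey// gt_eqF// (lt_le_trans _ (W1_ge0 _ _ d0)).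
have f12 : W1 d nu1 nu2 \is a fin_num by rewrite ge0_fin_numE ?W1_ge0// ltey.
have f23 : W1 d nu2 nu3 \is a fin_num by rewrite ge0_fin_numE ?W1_ge0// ltey.
apply/lee_addgt0Pr => e e0.
have e2 : (0 < (e / 2)%:E :> \bar R) by rewrite lte_fin divr_gt0.
have h12 : W1 d nu1 nu2 < W1 d nu1 nu2 + (e / 2)%:E by rewrite lteDl.
have h23 : W1 d nu2 nu3 < W1 d nu2 nu3 + (e / 2)%:E by rewrite lteDl.
have [g1 c1 l1] := W1_lt h12.
have [g2 c2 l2] := W1_lt h23.
have [q cq hq] := coupling_gluing c1 c2.
apply: (le_trans (W1_le _ cq)); apply: (le_trans hq).
by rewrite (splitr e) EFinD [leRHS]addeACA; apply: leeD; [exact: ltW l1|exact: ltW l2].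
Qed.

End lsc_metric.

(** * Measurable choice of transport plans *)

Section plan_selection.
Context {dO : measure_display} {O : measurableType dO} {R : realType}.
Variables (S1 S2 : finType) (a : S1 -> O -> R) (b : S2 -> O -> R).
Variables (phi : S1 * S2 -> R) (h : O -> R).
Hypothesis ma : forall s, measurable_fun [set: O] (a s).
Hypothesis mb : forall t, measurable_fun [set: O] (b t).
Hypothesis phi_ge0 : forall st, (0 <= phi st)%R.
Hypothesis mh : measurable_fun [set: O] h.

(** Marginals are only bounded above, and mass and cost may miss their targets by [e]: rounding the
    entries down to a grid then spoils nothing but the mass. *)
Definition transport_plan (e : R) (q : S1 * S2 -> R) (w : O) :=
  [/\ forall st, (0 <= q st)%R, forall s, (\sum_t q (s, t) <= a s w)%R,
      forall t, (\sum_s q (s, t) <= b t w)%R, (1 - e <= \sum_st q st)%R &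
      (\sum_st phi st * q st <= h w + e)%R].

Let grid M := {ffun S1 * S2 -> 'I_M.+1}.
Let val M (f : grid M) (st : S1 * S2) : R := ((f st : nat)%:R / M%:R)%R.

Let good M e (f : grid M) (w : O) : bool := `[< transport_plan e (val f) w >].

Let measurable_good M e (f : grid M) : measurable [set w | good e f w].
Proof.
have le_meas (u : R) (F : O -> R) : measurable_fun [set: O] F ->
    measurable [set w | (u <= F w)%R].
  move=> mF; rewrite (_ : [set w | _] = F @^-1` `[u, +oo[).
    by have := mF measurableT _ (measurable_itv `[u, +oo[); rewrite setTI.
  by apply/seteqP; split => w /=; rewrite in_itv/= andbT.
have cst_meas (P : Prop) : measurable [set w : O | P].
  have [p|np] := pselect P.
    by rewrite (_ : [set _ | _] = setT)//; apply/seteqP; split.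
  by rewrite (_ : [set _ | _] = set0)//; apply/seteqP; split.
rewrite (_ : [set w | _] = [set w | forall st, (0 <= val f st)%R] `&`
  (\bigcap_(s in [set: S1]) [set w | (\sum_t val f (s, t) <= a s w)%R] `&`
  (\bigcap_(t in [set: S2]) [set w | (\sum_s val f (s, t) <= b t w)%R] `&`
  ([set w | (1 - e <= \sum_st val f st)%R] `&`
   [set w | (\sum_st phi st * val f st <= h w + e)%R])))).
  apply: measurableI; first exact: cst_meas.
  apply: measurableI.
    apply: fin_bigcap_measurable => [|s _]; first exact: finite_finset.
    exact: le_meas.
  apply: measurableI.
    apply: fin_bigcap_measurable => [|t _]; first exact: finite_finset.
    exact: le_meas.
  apply: measurableI; first exact: cst_meas.
  by apply: le_meas; apply: measurable_funD.
apply/seteqP; split => w /=.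
  move=> /asboolP[h1 h2 h3 h4 h5]; split; first exact: h1.
  by split=> [s _|]; [exact: h2|split=> [t _|]; [exact: h3|split]].
by move=> [h1 [h2 [h3 [h4 h5]]]]; apply/asboolP; split => // s; by [exact: h2|exact: h3].
Qed.

(** Truncation lowers each entry by at most [1/M], so the mass lost is at most the number of entries
    over [M], hence at most [e / 2]. *)
Lemma exists_grid_plan (e : R) (q : S1 * S2 -> R) w : (0 < e)%R ->
  transport_plan (e / 2) q w -> (forall st, (q st <= 1)%R) ->
  forall M, (#|{: S1 * S2}|%:R <= M%:R * (e / 2))%R -> (0 < M)%N ->
  exists f : grid M, good e f w.
Proof.
move=> e0 [q0 qa qb qm qh] q1 M Me M0.
have M0' : (0 < M%:R :> R)%R by rewrite ltr0n.
have ltM st : (Num.truncn (q st * M%:R) < M.+1)%N.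
  have t0 : (0 <= q st * M%:R)%R by rewrite mulr_ge0.
  rewrite ltnS -(ler_nat R); apply: (@le_trans _ _ (q st * M%:R)%R).
    by rewrite truncn_le.
  by rewrite ler_piMl.
exists [ffun st => Ordinal (ltM st)]; set f := [ffun st => _].
have vle st : (val f st <= q st)%R.
  by rewrite /val ffunE/= ler_pdivrMr// truncn_le mulr_ge0.
have vge st : (q st - M%:R^-1 <= val f st)%R.
  rewrite /val ffunE/= lerBlDr -[X in (_ <= _ + X)%R]mul1r -mulrDl.
  have qM : (0 <= q st * M%:R)%R by rewrite mulr_ge0.
  by have /andP[_ /ltW] := truncn_itv qM; rewrite -ler_pdivlMr// -natr1.
apply/asboolP; split.
- by move=> st; rewrite divr_ge0.
- by move=> s; apply: le_trans (qa s); apply: ler_sum.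
- by move=> t; apply: le_trans (qb t); apply: ler_sum.
- apply: (@le_trans _ _ (\sum_st (q st - M%:R^-1))%R); last exact: ler_sum.
  rewrite sumrB sumr_const -[(M%:R^-1 *+ _)%R]mulr_natl.
  have : (#|{: S1 * S2}|%:R * M%:R^-1 <= e / 2)%R by rewrite ler_pdivrMr// mulrC.
  by move: qm; lra.
- apply: (@le_trans _ _ (\sum_st phi st * q st)%R); last by lra.
  by apply: ler_sum => st _; rewrite ler_wpM2l.
Qed.

(* A measurable choice without a selection theorem: transport plans form a convex
   set, so one averages all the admissible plans of a finite grid. *)
Lemma measurable_plan (e : R) : (0 < e)%R ->
  (forall w, exists2 q : S1 * S2 -> R, transport_plan (e / 2) q w &
     forall st, (q st <= 1)%R) ->
  exists2 p : S1 * S2 -> O -> R, (forall st, measurable_fun [set: O] (p st)) &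
    forall w, transport_plan e (p ^~ w) w.
Proof.
move=> e0 hq; have e20 : (0 < e / 2)%R by rewrite divr_gt0.
pose M := (Num.truncn (#|{: S1 * S2}|%:R / (e / 2))%R).+1.
have hM : (#|{: S1 * S2}|%:R <= M%:R * (e / 2))%R.
  rewrite -ler_pdivrMr//.
  have c0 : (0 <= #|{: S1 * S2}|%:R / (e / 2))%R by rewrite divr_ge0// ltW.
  by have /andP[_ /ltW] := truncn_itv c0.
(* [cnt w] counts the admissible grid plans at [w]. It is positive, so [avg] is a genuine mean and
   preserves upper and lower bounds. *)
pose G (f : grid M) (w : O) : R := (good e f w)%:R%R.
pose cnt w := (\sum_f G f w)%R.
have G0 f w : (0 <= G f w)%R by [].
have cnt_gt0 w : (0 < cnt w)%R.
  have [q hq1 q1] := hq w.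
  have [f gf] := exists_grid_plan e0 hq1 q1 hM (ltn0Sn _).
  by rewrite /cnt (bigD1 f)//= ltr_pwDl ?sumr_ge0// /G gf.
have mG f : measurable_fun [set: O] (G f).
  rewrite (_ : G f = \1_[set w | good e f w]).
    exact: (measurable_indic (measurable_good e f)).
  by apply/funext => w; rewrite indicE /G; congr ((_ : bool)%:R)%R;
    apply/idP/idP => [/mem_set|/set_mem].
have mcnt : measurable_fun [set: O] cnt by exact: measurable_sum.
pose avg (u : grid M -> R) w := ((\sum_f G f w * u f) / cnt w)%R.
have avg_le u w c : (forall f, good e f w -> u f <= c)%R -> (avg u w <= c)%R.
  move=> uc; rewrite ler_pdivrMr// mulr_sumr; apply: ler_sum => f _.
  by rewrite /G; case: (boolP (good e f w)) => [/uc|_]; rewrite ?mul1r ?mulr1 ?mul0r ?mulr0.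
have avg_ge u w c : (forall f, good e f w -> c <= u f)%R -> (c <= avg u w)%R.
  move=> uc; rewrite ler_pdivlMr// mulr_sumr; apply: ler_sum => f _.
  by rewrite /G; case: (boolP (good e f w)) => [/uc|_]; rewrite ?mul1r ?mulr1 ?mul0r ?mulr0.
have avg_sum (I : finType) (u : I -> grid M -> R) w :
    (\sum_i avg (u i) w = avg (fun f => \sum_i u i f) w)%R.
  rewrite /avg -mulr_suml exchange_big/=; congr (_ / _)%R.
  by apply: eq_bigr => f _; rewrite mulr_sumr.
exists (fun st => avg (fun f => val f st)).
  move=> st; apply: measurable_funM.
    by apply: measurable_sum => f; apply: measurable_funM.
  by apply: measurable_inv_ge0 => // w; exact: ltW.
move=> w; split.
- by move=> st; apply: avg_ge => f /asboolP[].
- by move=> s; rewrite avg_sum; apply: avg_le => f /asboolP[].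
- by move=> t; rewrite avg_sum; apply: avg_le => f /asboolP[].
- by rewrite avg_sum; apply: avg_ge => f /asboolP[].
- rewrite (eq_bigr (fun st => avg (fun f => phi st * val f st)%R w)); last first.
    move=> st _; rewrite /avg mulrA mulr_sumr; congr (_ / _)%R.
    by apply: eq_bigr => f _; rewrite mulrCA.
  by rewrite avg_sum; apply: avg_le => f /asboolP[].
Qed.

End plan_selection.

(** * Coupling one step of the Gibbs sampler *)

Lemma ultra_limit_le {R : realType} (U : set_system nat) (f : nat -> R) (l a : R) :
  ProperFilter U -> f @ U --> l -> U [set n | (f n <= a)%R] -> (l <= a)%R.
Proof.
move=> PU fl fa; have <- := cvg_lim (@Rhausdorff R) fl.
by apply: limr_le => //; apply/cvg_ex; exists l.
Qed.

Lemma pair_cellE (T1 T2 S1 S2 : Type) (f : T1 -> S1) (g : T2 -> S2) s t :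
  [set w | (f w.1, g w.2) = (s, t)] = [set x | f x = s] `*` [set y | g y = t].
Proof. by apply/seteqP; split => -[x y] /= [-> ->]. Qed.

(** A pair of fine cells lies in at most one pair of coarse cells, so the sum has at most one term,
    an infimum over larger sets. It has none if a fine cell is empty. *)
Lemma cell_cost_refine {dT : measure_display} {T : measurableType dT}
    {R : realType} (B : nat -> set T) (d : T -> T -> R) l n
    (st' : {ffun 'I_n -> bool} * {ffun 'I_n -> bool}) :
  (forall x y, (0 <= d x y)%R) -> (l <= n)%N ->
  (\sum_(st : {ffun 'I_l -> bool} * {ffun 'I_l -> bool} |
      subcell B st.1 st'.1 && subcell B st.2 st'.2) cell_cost B d st
   <= cell_cost B d st')%R.
Proof.
move=> d0 ln; have [[x [y xy]]|nxy] := pselect (exists x y,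
    (code B n x, code B n y) = st').
  rewrite -xy (bigD1 (code B l x, code B l y))/= ?subcellE ?eqxx//.
  rewrite big1 ?addr0; first exact: cell_cost_mono.
  move=> [s t] /= /andP[]; rewrite !subcellE// => /andP[/eqP <- /eqP <-].
  by rewrite eqxx.
rewrite big1 ?cell_cost_ge0// => -[s t] /= /andP[/asboolP[x xs _] /asboolP[y yt _]].
by exfalso; apply: nxy; exists x, y; rewrite xs yt; case: (st').
Qed.

Section step.
Context {dT : measure_display} {T : measurableType dT} {R : realType} {N : nat}.
Variables (rho d : T -> T -> R) (B : nat -> set T).
Hypothesis lscd : lsc_metric rho d B.
Local Notation TN := (N.-tuple T).

Let mB k : measurable (B k).
Proof. by have [_ [+ _] _ _] := lscd; exact. Qed.

Let d_ge0 x y : (0 <= d x y)%R.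
Proof. by have [_ _ [+ _ _ _] _] := lscd; exact. Qed.

Let lsc : forall x y a, (a < d x y)%R -> exists k l,
  [/\ B k x, B l y & forall x' y', B k x' -> B l y' -> (a < d x' y')%R].
Proof. by have [_ _ _ +] := lscd. Qed.

Definition coord_cost (g : probability (TN * TN)%type R) (j : 'I_N) : \bar R :=
  \int[g]_z (d (tnth z.1 j) (tnth z.2 j))%:E.

Let tcode n (j : 'I_N) (x : TN) := code B n (tnth x j).

Let mtcode n j : measurable_code (tcode n j).
Proof.
apply: (measurable_code_comp (g := fun x : TN => tnth x j)).
  exact: measurable_code_code.
exact: measurable_tnth.
Qed.

Let mtnth1 (j : 'I_N) : measurable_fun [set: TN * TN] (fun z => tnth z.1 j).
Proof. exact: measurableT_comp (measurable_tnth j) measurable_fst. Qed.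

Let mtnth2 (j : 'I_N) : measurable_fun [set: TN * TN] (fun z => tnth z.2 j).
Proof. exact: measurableT_comp (measurable_tnth j) measurable_snd. Qed.

Lemma measurable_coord_cost (j : 'I_N) : measurable_fun [set: TN * TN]
  (fun z => (d (tnth z.1 j) (tnth z.2 j))%:E).
Proof. exact: (measurable_lsc_metric lscd (@mtnth1 j) (@mtnth2 j)). Qed.

Lemma coord_cost_le_cells (g : probability (TN * TN)%type R) j (M : \bar R) :
  (forall n, \sum_st (@cell_cost _ _ _ B d n st)%:E *
     g ([set x | tcode n j x = st.1] `*` [set y | tcode n j y = st.2]) <= M) ->
  coord_cost g j <= M.
Proof.
move=> HM; apply: (integral_lsc_cost_le d_ge0 mB lsc (@mtnth1 j) (@mtnth2 j)) => n.
apply: le_trans (HM n); apply: lee_sum => -[s t] _ /=.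
by rewrite (pair_cellE (tcode n j) (tcode n j)).
Qed.

Lemma cells_le_coord_cost (g : probability (TN * TN)%type R) j n :
  \sum_st (@cell_cost _ _ _ B d n st)%:E *
     g ([set x | tcode n j x = st.1] `*` [set y | tcode n j y = st.2])
  <= coord_cost g j.
Proof.
apply: le_trans (le_integral_lsc_cost d_ge0 mB lsc (@mtnth1 j) (@mtnth2 j) g n).
apply: lee_sum => -[s t] _ /=.
by rewrite (pair_cellE (tcode n j) (tcode n j)).
Qed.

Variables (i : 'I_N) (K : R.-pker TN ~> T) (h : TN * TN -> R).
Hypothesis mh : measurable_fun [set: TN * TN] h.
Hypothesis h_ge0 : forall z, (0 <= h z)%R.
Hypothesis Kh : forall z, W1 d (K z.1) (K z.2) <= (h z)%:E.

Let k1 (z : TN * TN) := kernel_probability (resample i K) z.1.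
Let k2 (z : TN * TN) := kernel_probability (resample i K) z.2.

Let mk1 A : measurable A -> measurable_fun [set: TN * TN] (k1 ^~ A).
Proof.
move=> mA; apply: (measurableT_comp (f := fun x => resample i K x A)) => //.
exact: measurable_kernel.
Qed.

Let mk2 A : measurable A -> measurable_fun [set: TN * TN] (k2 ^~ A).
Proof.
move=> mA; apply: (measurableT_comp (f := fun x => resample i K x A)) => //.
exact: measurable_kernel.
Qed.

Let tnth_update (x : TN) y : tnth (update i x y) i = y.
Proof. by rewrite tnth_mktuple eqxx. Qed.

Lemma resample_coord (x : TN) (A : set T) :
  resample i K x [set z | A (tnth z i)] = K x A.
Proof.
rewrite /resample /= /resample_meas /= /resample_fun /pushforward /=.
by congr (K x _); apply/seteqP; split => y /=; rewrite tnth_update.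
Qed.

Lemma resample_coord_off (x : TN) j (A : set T) : j != i -> ~ A (tnth x j) ->
  resample i K x [set z | A (tnth z j)] = 0.
Proof.
move=> ji nA; rewrite /resample /= /resample_meas /= /resample_fun /pushforward /=.
rewrite (_ : _ @^-1` _ = set0) ?measure0//; apply/seteqP; split => // y /=.
by rewrite tnth_mktuple (negbTE ji).
Qed.

(** The cell masses of a nearly optimal coupling at the fixed point [z] form a plan; measurability
    in [z] comes later, from [measurable_plan]. *)
Lemma exists_transport_plan (e : R) n z : (0 < e)%R ->
  exists2 q : {ffun 'I_n -> bool} * {ffun 'I_n -> bool} -> R,
    transport_plan (fun s z => fine (k1 z [set x | tcode n i x = s]))
      (fun t z => fine (k2 z [set x | tcode n i x = t])) (@cell_cost _ _ _ B d n)
      h e q z & forall st, (q st <= 1)%R.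
Proof.
move=> e0; have [Q cQ QW] : exists2 Q : probability (T * T)%type R,
    is_coupling Q (K z.1) (K z.2) & \int[Q]_p (d p.1 p.2)%:E < (h z + e)%:E.
  apply: W1_lt; apply: le_lt_trans (Kh z) _.
  by rewrite lte_fin ltrDl.
have mC s : measurable [set x | code B n x = s] by exact: measurable_code_code.
have mCC s t : measurable ([set x | code B n x = s] `*` [set y | code B n y = t]).
  by apply: measurableX; exact: mC.
have fstE s : k1 z [set x | tcode n i x = s] = Q ([set x | code B n x = s] `*` setT).
  by rewrite (cQ _ (mC s)).1 -(resample_coord z.1).
have sndE t : k2 z [set x | tcode n i x = t] = Q (setT `*` [set x | code B n x = t]).
  by rewrite (cQ _ (mC t)).2 -(resample_coord z.2).
exists (fun st => fine (Q ([set x | code B n x = st.1] `*` [set y | code B n y = st.2]))).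
  split.
  - by move=> st; rewrite fine_ge0.
  - move=> s; rewrite fstE -lee_fin -sumEFin fineK ?fin_num_measure//; last first.
      by apply: measurableX; [exact: mC|].
    rewrite -(measure_code_partition Q (c := fun p => code B n p.2)); last 2 first.
    + apply: measurable_code_comp; last exact: measurable_snd.
      exact: measurable_code_code.
    + by apply: measurableX; [exact: mC|].
    apply: lee_sum => t _; rewrite fineK ?fin_num_measure//.
    rewrite (_ : _ `&` _ = [set x | code B n x = s] `*` [set y | code B n y = t])//.
    by apply/seteqP; split => -[x y] /=; tauto.
  - move=> t; rewrite sndE -lee_fin -sumEFin fineK ?fin_num_measure//; last first.
      by apply: measurableX; [|exact: mC].
    rewrite -(measure_code_partition Q (c := fun p => code B n p.1)); last 2 first.
    + apply: measurable_code_comp; last exact: measurable_fst.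
      exact: measurable_code_code.
    + by apply: measurableX; [|exact: mC].
    apply: lee_sum => s _; rewrite fineK ?fin_num_measure//.
    rewrite (_ : _ `&` _ = [set x | code B n x = s] `*` [set y | code B n y = t])//.
    by apply/seteqP; split => -[x y] /=; tauto.
  - apply: (@le_trans _ _ 1%R); first by rewrite lerBlDr lerDl ltW.
    rewrite -lee_fin -sumEFin -(probability_setT Q).
    rewrite -(measure_code_partition Q (c := fun p => (code B n p.1, code B n p.2)))//.
      apply: lee_sum => -[s t] _; rewrite setTI fineK ?fin_num_measure//.
      by rewrite (pair_cellE (code B n) (code B n)).
    apply: measurable_code_pair; apply: measurable_code_comp;
      by [exact: measurable_code_code|exact: measurable_fst|exact: measurable_snd].
  - rewrite -lee_fin -sumEFin; apply: le_trans (ltW QW).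
    apply: le_trans (le_integral_lsc_cost d_ge0 mB lsc measurable_fst measurable_snd Q n).
    apply: lee_sum => -[s t] _; rewrite EFinM fineK ?fin_num_measure//.
    by rewrite (pair_cellE (code B n) (code B n)).
move=> st; rewrite -lee_fin fineK ?fin_num_measure//; exact: probability_le1.
Qed.

(** The cells used for the coupling record coordinate [i] only. Another coordinate keeps its value
    under resampling, so each pair of its cells receives at most the mass that [g] gave it, and its
    cost cannot increase. *)
Lemma step_coupling (nu1 nu2 : probability TN R) (g : probability (TN * TN)%type R) :
  is_coupling g nu1 nu2 ->
  exists g' : probability (TN * TN)%type R,
  [/\ is_coupling g' (nuK nu1 (resample i K)) (nuK nu2 (resample i K)),
      coord_cost g' i <= \int[g]_z (h z)%:E &
      forall j, j != i -> coord_cost g' j <= coord_cost g j].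
Proof.
move=> cg; have [prho bB mdd _] := lscd.
have ma n s : measurable_fun [set: TN * TN]
    (fun z => fine (k1 z [set x | tcode n i x = s])).
  by apply: measurableT_comp => //; apply: mk1; exact: mtcode.
have mb n t : measurable_fun [set: TN * TN]
    (fun z => fine (k2 z [set x | tcode n i x = t])).
  by apply: measurableT_comp => //; apply: mk2; exact: mtcode.
have cc0 n st : (0 <= @cell_cost _ _ _ B d n st)%R by exact: cell_cost_ge0.
have en n : (0 < n.+1%:R^-1 :> R)%R by rewrite invr_gt0.
have en2 n : (0 < n.+1%:R^-1 / 2 :> R)%R by rewrite divr_gt0.
have plan n : {p : {ffun 'I_n -> bool} * {ffun 'I_n -> bool} -> TN * TN -> R |
    (forall st, measurable_fun [set: TN * TN] (p st)) /\
    forall w, transport_plan (fun s z => fine (k1 z [set x | tcode n i x = s]))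
      (fun t z => fine (k2 z [set x | tcode n i x = t])) (@cell_cost _ _ _ B d n)
      h n.+1%:R^-1 (p ^~ w) w}.
  apply: cid; have [p p1 p2] := measurable_plan (ma n) (mb n) (cc0 n) mh (en n)
    (fun w => exists_transport_plan n w (en2 n)).
  by exists p.
pose p n := sval (plan n).
have mp n st : measurable_fun [set: TN * TN] (p n st).
  exact: (svalP (plan n)).1.
have hp n w : transport_plan (fun s z => fine (k1 z [set x | tcode n i x = s]))
      (fun t z => fine (k2 z [set x | tcode n i x = t])) (@cell_cost _ _ _ B d n)
      h n.+1%:R^-1 (p n ^~ w) w.
  exact: (svalP (plan n)).2.
have p0 n st w : (0 <= p n st w)%R.
  by have [H _ _ _ _] := hp n w; exact: H.
have pl1 n w s : (\sum_t p n (s, t) w <= fine (k1 w [set x | tcode n i x = s]))%R.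
  by have [_ H _ _ _] := hp n w; exact: H.
have pl2 n w t : (\sum_s p n (s, t) w <= fine (k2 w [set x | tcode n i x = t]))%R.
  by have [_ _ H _ _] := hp n w; exact: H.
have pm n w : (1 - n.+1%:R^-1 <= \sum_st p n st w)%R by have [] := hp n w.
have nu1E A : measurable A -> \int[g]_w k1 w A <= nuK nu1 (resample i K) A.
  move=> mA; rewrite /nuK.
  rewrite (integral_marginal (m := nu1) (f := fst) (h := fun x => resample i K x A))//.
  - by move=> A' mA'; rewrite -(cg _ mA').1 setXT.
  - exact: measurable_kernel.
have nu2E A : measurable A -> \int[g]_w k2 w A <= nuK nu2 (resample i K) A.
  move=> mA; rewrite /nuK.
  rewrite (integral_marginal (m := nu2) (f := snd) (h := fun x => resample i K x A))//.
  - by move=> A' mA'; rewrite -(cg _ mA').2 setTX.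
  - exact: measurable_kernel.
have [U [G [uU subU G1 G2 Gb]]] := cell_coupling_limit mk1 mk2 (@mtcode ^~ i)
  (@mtcode ^~ i) mp p0 pl1 pl2 pm (polish_metric_tuple prho) (polish_metric_tuple prho)
  nu1E nu2E.
exists G; split; first by move=> A mA; rewrite G1// G2.
- apply: coord_cost_le_cells => l.
  have [->|hfin] := eqVneq (\int[g]_z (h z)%:E) +oo; first exact: leey.
  have hnum : \int[g]_z (h z)%:E \is a fin_num.
    rewrite ge0_fin_numE ?ltey//; apply: integral_ge0 => z _.
    by rewrite lee_fin.
  apply/lee_addgt0Pr => e e0.
  have mC m s : measurable [set x | tcode m i x = s] by exact: mtcode.
  have mCC s t : measurable ([set x | tcode l i x = s] `*` [set y | tcode l i y = t]).
    by apply: measurableX; exact: mtcode.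
  rewrite -(fineK hnum) -EFinD.
  rewrite (eq_bigr (fun st => (cell_cost B d st * fine (G ([set x | tcode l i x = st.1]
      `*` [set y | tcode l i y = st.2])))%:E)); last first.
    by move=> st _; rewrite EFinM fineK// fin_num_measure.
  rewrite sumEFin lee_fin.
  pose b n (st : {ffun 'I_l -> bool} * {ffun 'I_l -> bool}) :=
    cell_coupling g k1 k2 (tcode n i) (tcode n i) (p n) [set x | tcode l i x = st.1]
      [set y | tcode l i y = st.2].
  apply: (ultra_limit_le (U := U) (f := fun n => (\sum_st cell_cost B d st * b n st)%R)).
    apply: cvg_sumr => st; apply: cvgM; first exact: cvg_cst.
    exact: Gb.
  apply: subU; have [m me] := ltr_add_invr e0; rewrite add0r in me.
  (* [n >= l] makes cells of level [n] refine those of level [l]; [n >= m] brings the slack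
     [1/(n+1)] below [e]. *)
  exists (maxn l m) => // n /=; rewrite geq_max => /andP[ln mn].
  have bE st : (b n st)%:E = \int[g]_w (\sum_(st' | subcell B st.1 st'.1 &&
      subcell B st.2 st'.2) p n st' w)%:E.
    rewrite -(cell_coupling_code g mk1 mk2 (@mtcode n i) (@mtcode n i) (mp n) (p0 n)
      (pl1 n) (pl2 n)); congr (_%:E); congr cell_coupling.
    - by apply/seteqP; split => x /=; rewrite subcellE// => /eqP.
    - by apply/seteqP; split => x /=; rewrite subcellE// => /eqP.
  have ms (P : pred ({ffun 'I_n -> bool} * {ffun 'I_n -> bool})) :
      measurable_fun [set: TN * TN] (fun w => (\sum_(st | P st) p n st w)%R).
    rewrite (_ : (fun w => _) = (fun w => \sum_st if P st then p n st w else 0)%R).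
      by apply: measurable_sum => st; case: (P st); [exact: mp|exact: measurable_cst].
    by apply/funext => w; rewrite big_mkcond.
  rewrite -lee_fin -sumEFin.
  pose F (st : {ffun 'I_l -> bool} * {ffun 'I_l -> bool}) (w : TN * TN) : R :=
    (cell_cost B d st * \sum_(st' | subcell B st.1 st'.1 &&
      subcell B st.2 st'.2) p n st' w)%R.
  have F0 st w : (0 <= F st w)%R.
    by apply: mulr_ge0; [exact: cc0|apply: sumr_ge0 => st' _; exact: p0].
  have mF st : measurable_fun [set: TN * TN] (F st).
    by apply: measurable_funM; [exact: measurable_cst|exact: ms].
  have FE st : (cell_cost B d st * b n st)%:E = \int[g]_w (F st w)%:E.
    rewrite EFinM bE; under [RHS]eq_integral do rewrite EFinM.
    rewrite (ge0_integralZl_EFin g measurableT _ _ (cc0 l st))//.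
      by move=> w _; rewrite lee_fin; apply: sumr_ge0 => st' _; exact: p0.
    by apply/measurable_EFinP; exact: ms.
  rewrite (eq_bigr _ (fun st _ => FE st)) -ge0_integral_sum//; last 2 first.
  - by move=> st; exact/measurable_EFinP.
  - by move=> st w _; rewrite lee_fin.
  apply: (@le_trans _ _ (\int[g]_w ((h w)%:E + n.+1%:R^-1%:E))).
    apply: ge0_le_integral => //.
    - by move=> w _; apply: sume_ge0 => st _; rewrite lee_fin.
    - apply: emeasurable_sum => st; exact/measurable_EFinP.
    - by apply: emeasurable_funD => //; exact/measurable_EFinP.
    move=> w _; rewrite -EFinD sumEFin lee_fin; have [_ _ _ _] := hp n w.
    (* Exchanging the sums collects, for each fine pair [st'], the coarse pairs containing it. *)
    apply: le_trans; rewrite /F; under eq_bigr do rewrite mulr_sumr.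
    rewrite (exchange_big_dep xpredT)//=; apply: ler_sum => st' _.
    by rewrite -mulr_suml ler_wpM2r// cell_cost_refine.
  have h0 w : setT w -> 0 <= (h w)%:E by rewrite lee_fin.
  have n0 (w : TN * TN) : setT w -> 0 <= (n.+1%:R^-1)%:E :> \bar R.
    by rewrite lee_fin ltW.
  rewrite (ge0_integralD g measurableT h0 _ n0)//; last exact/measurable_EFinP.
  rewrite integral_probability_cst EFinD fineK// leeD2l// lee_fin.
  by apply/ltW/(le_lt_trans _ me); rewrite lef_pV2 ?posrE// ler_nat.
- move=> j ji; apply: coord_cost_le_cells => l.
  apply: le_trans (cells_le_coord_cost g j l); apply: lee_sum => -[s t] _ /=.
  apply: lee_wpmul2l; first by rewrite lee_fin cc0.
  have mst : measurable ([set x | tcode l j x = s] `*` [set y | tcode l j y = t]).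
    by apply: measurableX; exact: mtcode.
  rewrite -(@fineK _ (G _)) ?fin_num_measure// -(@fineK _ (g _)) ?fin_num_measure//.
  rewrite lee_fin.
  apply: (ultra_limit_le _ (Gb _ _ (@mtcode l j s) (@mtcode l j t))).
  apply: (filterS _ filterT) => n _ /=; rewrite -lee_fin [leRHS]fineK ?fin_num_measure//.
  apply: (cell_coupling_null g mk1 mk2 (@mtcode n i) (@mtcode n i) (mp n) (p0 n)
    (pl1 n)) => //; [exact: mtcode|exact: mtcode|].
  move=> [x y] /= /not_andP[nx|ny]; [left|right].
    exact: (resample_coord_off (A := [set u | code B l u = s])).
  exact: (resample_coord_off (A := [set u | code B l u = t])).
Qed.

End step.

(** * Contraction matrices *)

Section integral_nuK.
Context {dT : measure_display} {T : measurableType dT} {R : realType}.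
Variables (nu : probability T R) (K : R.-pker T ~> T).

Let cst_nu : T -> {measure set T -> \bar R} := fun=> nu.

Let cst_meas U : measurable U -> measurable_fun [set: T] (cst_nu ^~ U).
Proof. by move=> _; exact: (@measurable_cst _ _ _ _ setT (nu U)). Qed.

HB.instance Definition _ := isKernel.Build _ _ _ _ R cst_nu cst_meas.

Let cst_prob x : cst_nu x [set: T] = 1.
Proof. exact: probability_setT. Qed.

HB.instance Definition _ := Kernel_isProbability.Build _ _ _ _ R cst_nu cst_prob.

(** In [integral_kcomp] the second kernel also sees the starting point, hence this copy of [K] that
    ignores it. *)
Let K_snd : T * T -> {measure set T -> \bar R} := fun p => K p.2.

Let K_snd_meas U : measurable U -> measurable_fun [set: T * T] (K_snd ^~ U).
Proof.
move=> mU; apply: (measurableT_comp (f := fun x => K x U)) => //.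
exact: measurable_kernel.
Qed.

HB.instance Definition _ := isKernel.Build _ _ _ _ R K_snd K_snd_meas.

Let K_snd_prob x : K_snd x [set: T] = 1.
Proof. exact: prob_kernel. Qed.

HB.instance Definition _ := Kernel_isProbability.Build _ _ _ _ R K_snd K_snd_prob.

Lemma integral_nuK (f : T -> \bar R) : (forall x, 0 <= f x) ->
  measurable_fun [set: T] f ->
  \int[nuK nu K]_y f y = \int[nu]_x \int[K x]_y f y.
Proof.
move=> f0 mf; rewrite -[RHS](integral_kcomp cst_nu K_snd point f0 mf).
by apply: eq_measure_integral.
Qed.

End integral_nuK.

Section nuK_theory.
Context {dT : measure_display} {T : measurableType dT} {R : realType}.

Lemma nuK_kmul (nu : probability T R) (K1 K2 : R.-pker T ~> T) A : measurable A ->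
  nuK nu (kmul K1 K2) A = nuK (nuK nu K1) K2 A.
Proof.
move=> mA; rewrite [RHS]/nuK integral_nuK//.
exact: measurable_kernel.
Qed.

Lemma nuK_kid (nu : probability T R) A : measurable A -> nuK nu kid A = nu A.
Proof.
move=> mA; rewrite /nuK; under eq_integral do rewrite /kid /kdirac /= /dirac.
by rewrite integral_indic// setIT.
Qed.

Lemma nuK_dirac (x : T) (K : R.-pker T ~> T) A : measurable A ->
  nuK \d_x K A = K x A.
Proof.
move=> mA; rewrite /nuK integral_dirac//; last exact: measurable_kernel.
by rewrite diracT mul1e.
Qed.

Lemma eq_nuK (nu nu' : probability T R) (K : R.-pker T ~> T) A :
  (forall B, measurable B -> nu B = nu' B) -> measurable A ->
  nuK nu K A = nuK nu' K A.
Proof.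
by move=> e mA; apply: eq_measure_integral => B mB _; exact: e.
Qed.

Lemma eq_coupling (g : probability (T * T)%type R)
    (m1 m2 m1' m2' : {measure set T -> \bar R}) :
  (forall A, measurable A -> m1 A = m1' A) ->
  (forall A, measurable A -> m2 A = m2' A) ->
  is_coupling g m1 m2 -> is_coupling g m1' m2'.
Proof. by move=> e1 e2 cg A mA; rewrite -e1// -e2//; exact: cg. Qed.

End nuK_theory.

Section contraction.
Context {dT : measure_display} {T : measurableType dT} {R : realType} {N : nat}.
Variables (d : T -> T -> R).
Local Notation TN := (N.-tuple T).
Hypothesis d_ge0 : forall x y, (0 <= d x y)%R.

(** The bound holds for all initial laws at once: Dirac masses turn it into pointwise estimates, an
    invariant law into convergence. *)
Definition contracts (P : R.-pker TN ~> TN) (A : 'M[R]_N) :=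
  (forall i j, (0 <= A i j)%R) /\
  forall (nu1 nu2 : probability TN R) (g : probability (TN * TN)%type R),
    is_coupling g nu1 nu2 ->
  exists2 g' : probability (TN * TN)%type R,
    is_coupling g' (nuK nu1 P) (nuK nu2 P) &
    forall i, coord_cost d g' i <= \sum_j (A i j)%:E * coord_cost d g j.

Lemma coord_cost_ge0 g (i : 'I_N) : 0 <= coord_cost d g i.
Proof. by apply: integral_ge0 => z _; rewrite lee_fin. Qed.

Lemma contracts_kid : contracts kid 1%:M.
Proof.
split; first by move=> i j; rewrite mxE.
move=> nu1 nu2 g cg; exists g.
  by apply: eq_coupling cg => A mA; exact/esym/nuK_kid.
move=> i; rewrite (bigD1 i)//= mxE eqxx mul1e leeDl// sume_ge0// => j _.
by rewrite mule_ge0// ?lee_fin ?mxE// coord_cost_ge0.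
Qed.

(** [P] acts first, so its matrix stands on the right. *)
Lemma contracts_kmul (P Q : R.-pker TN ~> TN) (A C : 'M[R]_N) :
  contracts P A -> contracts Q C -> contracts (kmul P Q) (C *m A).
Proof.
move=> [A0 cP] [C0 cQ]; split.
  by move=> i j; rewrite mxE; apply: sumr_ge0 => k _; rewrite mulr_ge0.
move=> nu1 nu2 g /cP[g' /cQ[g'' cg'' h''] h']; exists g''.
  by apply: eq_coupling cg'' => B mB; exact/esym/nuK_kmul.
move=> i; apply: le_trans (h'' i) _.
apply: (@le_trans _ _ (\sum_k (C i k)%:E * \sum_j (A k j)%:E * coord_cost d g j)).
  by apply: lee_sum => k _; apply: lee_wpmul2l => //; rewrite lee_fin.
rewrite (eq_bigr (fun k => \sum_j (C i k)%:E * ((A k j)%:E * coord_cost d g j)));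
    last first.
  move=> k _; rewrite ge0_sume_distrr// => j _.
  by rewrite mule_ge0// ?lee_fin// coord_cost_ge0.
rewrite exchange_big/=; apply: lee_sum => j _.
rewrite mxE -sumEFin ge0_sume_distrl; last first.
  by move=> k _; rewrite lee_fin mulr_ge0.
by apply: lee_sum => k _; rewrite muleA EFinM.
Qed.

End contraction.

(** Pass from [x] to [y] by exchanging one coordinate at a time. [D] will be the transport distance
    between conditional laws, and also the increment of a Lipschitz function. *)
Lemma coordinatewise_le {R : realType} {T : Type} {N : nat}
    (D : N.-tuple T -> N.-tuple T -> \bar R) (a : 'I_N -> T -> T -> R) :
  (forall x, D x x <= 0) -> (forall x y z, D x z <= D x y + D y z) ->
  (forall j x y, agree_off j x y -> D x y <= (a j (tnth x j) (tnth y j))%:E) ->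
  forall x y, D x y <= (\sum_j a j (tnth x j) (tnth y j))%:E.
Proof.
move=> D0 tri Da x y.
pose z m : N.-tuple T := [tuple if (j < m)%N then tnth y j else tnth x j | j < N].
have zE m j : tnth (z m) j = if (j < m)%N then tnth y j else tnth x j.
  by rewrite tnth_mktuple.
have H m : (m <= N)%N ->
    D x (z m) <= (\sum_(j < N | (j < m)%N) a j (tnth x j) (tnth y j))%:E.
  elim: m => [_|m IH mN].
    by rewrite big1// (_ : z 0%N = x)//; apply/eq_from_tnth => j; rewrite zE.
  apply: (le_trans (tri x (z m) (z m.+1))).
  rewrite (bigD1 (Ordinal mN))//= addrC EFinD; apply: leeD.
    rewrite (eq_bigl (fun j : 'I_N => (j < m)%N)); first exact/IH/ltnW.
    by move=> j; rewrite -val_eqE/= ltnS ltn_neqAle andbC.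
  apply: le_trans (Da (Ordinal mN) _ _ _) _.
    move=> j jm; rewrite !zE [(j < m.+1)%N]ltnS [(j <= m)%N]leq_eqVlt.
    by have /negbTE -> : (j : nat) != m := jm.
  by rewrite !zE/= ltnn ltnSn.
rewrite (_ : y = z N) ?(le_trans (H N _))//; last first.
  by apply/eq_from_tnth => j; rewrite zE ltn_ord.
rewrite lee_fin le_eqVlt; apply/orP; left; apply/eqP/eq_big => [j|j _].
  by rewrite ltn_ord.
by rewrite zE ltn_ord.
Qed.

Section contraction_resample.
Context {dT : measure_display} {T : measurableType dT} {R : realType} {N : nat}.
Variables (rho d : T -> T -> R) (B : nat -> set T).
Hypothesis lscd : lsc_metric rho d B.
Local Notation TN := (N.-tuple T).

Let d_ge0 x y : (0 <= d x y)%R.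
Proof. by have [_ _ [+ _ _ _] _] := lscd; exact. Qed.

Lemma W1_coordinatewise (K : R.-pker TN ~> T) (c : 'I_N -> R) :
  (forall j x y, agree_off j x y ->
     W1 d (K x) (K y) <= (c j * d (tnth x j) (tnth y j))%:E) ->
  forall x y, W1 d (K x) (K y) <= (\sum_j c j * d (tnth x j) (tnth y j))%:E.
Proof.
move=> Kc; apply: (coordinatewise_le (D := fun x y => W1 d (K x) (K y))
  (a := fun j u v => (c j * d u v)%R)) => //.
- by move=> x; exact: (W1_refl lscd (kernel_probability K x)).
- by move=> x y z; exact: W1_triangle lscd _ _ _.
Qed.

(** The matrix of a single Gauss-Seidel relaxation of coordinate [i]. *)
Definition resample_matrix (i : 'I_N) (c : 'I_N -> R) : 'M[R]_N :=
  \matrix_(a, b) (if a == i then c b else (a == b)%:R)%R.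

Lemma contracts_resample (i : 'I_N) (K : R.-pker TN ~> T) (c : 'I_N -> R) :
  (forall j, (0 <= c j)%R) ->
  (forall j x y, agree_off j x y ->
     W1 d (K x) (K y) <= (c j * d (tnth x j) (tnth y j))%:E) ->
  contracts d (resample i K) (resample_matrix i c).
Proof.
move=> c0 /W1_coordinatewise Kc; split.
  by move=> a b; rewrite mxE; case: ifP.
move=> nu1 nu2 g cg.
pose h (z : TN * TN) := (\sum_j c j * d (tnth z.1 j) (tnth z.2 j))%R.
have mdj j : measurable_fun [set: TN * TN] (fun z => d (tnth z.1 j) (tnth z.2 j)).
  by apply/measurable_EFinP; exact: measurable_coord_cost lscd j.
have mh : measurable_fun [set: TN * TN] h.
  by apply: measurable_sum => j; apply: measurable_funM.
have h0 z : (0 <= h z)%R by apply: sumr_ge0 => j _; rewrite mulr_ge0.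
have [g' [cg' gi gj]] := step_coupling lscd i mh h0 (fun z => Kc z.1 z.2) cg.
exists g' => // a; have [ai|ai] := eqVneq a i; last first.
  apply: (le_trans (gj a ai)); rewrite (bigD1 a)//= mxE (negbTE ai) eqxx mul1e.
  rewrite leeDl// sume_ge0// => b _.
  by rewrite mule_ge0 ?coord_cost_ge0// lee_fin mxE (negbTE ai).
rewrite ai; apply: (le_trans gi).
rewrite /h; under eq_integral do rewrite -sumEFin.
rewrite ge0_integral_sum//; last 2 first.
- by move=> j; apply/measurable_EFinP; exact: measurable_funM.
- by move=> j z _; rewrite lee_fin mulr_ge0.
apply: lee_sum => j _; rewrite mxE eqxx.
under eq_integral do rewrite EFinM.
rewrite (ge0_integralZl_EFin g measurableT _ _ (c0 j))//.
- by move=> z _; rewrite lee_fin.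
- exact/measurable_EFinP.
Qed.

Variables (mui : 'I_N -> R.-pker TN ~> T) (c : 'I_N -> 'I_N -> R) (r : R).
Hypothesis c_ge0 : forall i j, (0 <= c i j)%R.
Hypothesis muic : forall i j x y, agree_off j x y ->
  W1 d (mui i x) (mui i y) <= (c i j * d (tnth x j) (tnth y j))%:E.
Hypothesis c_row : forall i, (\sum_j c i j <= r)%R.
Hypothesis r_le1 : (r <= 1)%R.

(* Gauss-Seidel: once coordinate i has been resampled its cost is at most r times
   the largest initial one, so later updates only see smaller costs. *)
Lemma contracts_big_resample (s : seq 'I_N) : exists2 A,
  contracts d (\big[kmul/kid]_(i <- s) resample i (mui i)) A &
  forall (v : 'I_N -> R) (S : {pred 'I_N}), (forall j, (v j <= 1)%R) ->
    (forall j, j \in S -> (v j <= r)%R) ->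
  forall i, (\sum_j A i j * v j <= 1)%R /\
    ((i \in s) || (i \in S) -> (\sum_j A i j * v j <= r)%R).
Proof.
elim: s => [|i s [A cA hA]].
  exists 1%:M; first by rewrite big_nil; exact: contracts_kid.
  move=> v S v1 vS i.
  rewrite (bigD1 i)//= mxE eqxx mul1r big1 ?addr0//.
    by split; [exact: v1|exact: vS].
  by move=> j ji; rewrite mxE eq_sym (negbTE ji) mul0r.
exists (A *m resample_matrix i (c i)).
  rewrite big_cons; apply: contracts_kmul => //.
  by apply: contracts_resample => //; exact: muic.
move=> v S v1 vS j.
(* The cost vector after the update of [i]. Its entry at [i] is at most [r], so [i] joins the set
   [S] of coordinates known to be small before the remaining updates. *)
pose w b := (\sum_a resample_matrix i (c i) b a * v a)%R.
have wE : (\sum_a (A *m resample_matrix i (c i)) j a * v a = \sum_b A j b * w b)%R.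
  rewrite /w; under [RHS]eq_bigr do rewrite mulr_sumr.
  rewrite exchange_big/=; apply: eq_bigr => a _; rewrite mxE mulr_suml.
  by apply: eq_bigr => b _; rewrite mulrA.
have wi : (w i <= r)%R.
  apply: le_trans (c_row i); apply: ler_sum => a _; rewrite mxE eqxx.
  by rewrite ler_piMr.
have wn b : b != i -> w b = v b.
  move=> bi; rewrite /w (bigD1 b)//= mxE (negbTE bi) eqxx mul1r big1 ?addr0//.
  by move=> a ab; rewrite mxE (negbTE bi) eq_sym (negbTE ab) mul0r.
have w1 b : (w b <= 1)%R.
  have [->|bi] := eqVneq b i; first exact: le_trans wi r_le1.
  by rewrite wn.
have wS b : b \in [predU1 i & S] -> (w b <= r)%R.
   rewrite !inE => /predU1P[->//|bS].
  by have [->//|bi] := eqVneq b i; rewrite wn// vS.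
have [h1 h2] := hA w _ w1 wS j.
rewrite wE; split => // H; apply: h2; move: H; rewrite !inE.
by rewrite orbCA orbA.
Qed.

Lemma contracts_gibbs : exists2 A, contracts d (gibbs_sampler mui) A &
  forall i, (\sum_j A i j <= r)%R.
Proof.
have [A cA hA] := contracts_big_resample (index_enum 'I_N).
exists A => // i.
(* All costs start at 1 with no coordinate known to be small; a full sweep reaches every
   coordinate. *)
have [//|_] := hA (fun=> 1%R) pred0 (fun=> lexx _) _ i.
rewrite mem_index_enum => /(_ isT); apply: le_trans.
by apply: ler_sum => j _; rewrite mulr1.
Qed.

End contraction_resample.

Section contraction_power.
Context {dT : measure_display} {T : measurableType dT} {R : realType} {N : nat}.
Variables (d : T -> T -> R).
Local Notation TN := (N.-tuple T).
Hypothesis d_ge0 : forall x y, (0 <= d x y)%R.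

Lemma contracts_kpow (P : R.-pker TN ~> TN) (A : 'M[R]_N) (r : R) k :
  contracts d P A -> (0 <= r)%R -> (forall i, (\sum_j A i j <= r)%R) ->
  exists2 C, contracts d (kpow P k) C & forall i, (\sum_j C i j <= r ^+ k)%R.
Proof.
move=> cA r0 Ar; elim: k => [|k [C cC Cr]].
  exists 1%:M; first exact: contracts_kid.
  move=> i; rewrite (bigD1 i)//= mxE eqxx big1 ?addr0//.
  by move=> j ji; rewrite mxE eq_sym (negbTE ji).
exists (C *m A); first exact: contracts_kmul.
move=> i; under eq_bigr do rewrite mxE.
rewrite exchange_big/=; under eq_bigr do rewrite -mulr_sumr.
apply: (@le_trans _ _ (\sum_j C i j * r)%R).
  by apply: ler_sum => j _; rewrite ler_wpM2l//; exact: cC.1.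
by rewrite -mulr_suml exprSr ler_wpM2r.
Qed.

End contraction_power.

(** * Dobrushin coefficients and invariance of the Gibbs measure *)

Section dobrushin_real.
Context {dT : measure_display} {T : measurableType dT} {R : realType} {N : nat}.
Variables (rho d : T -> T -> R) (B : nat -> set T).
Hypothesis lscd : lsc_metric rho d B.
Local Notation TN := (N.-tuple T).
Variable mui : 'I_N -> R.-pker TN ~> T.

Lemma dobrushin_ge0 i j : 0 <= dobrushin d mui i j.
Proof. by rewrite /dobrushin le_max lexx. Qed.

Lemma row_le_inf_norm (C : 'I_N -> 'I_N -> \bar R) i :
  \sum_j C i j <= inf_norm C.
Proof. exact: (le_bigmax -oo (fun i => \sum_j C i j) i). Qed.

Lemma inf_norm_dobrushin_ge0 : (0 < N)%N -> 0 <= inf_norm (dobrushin d mui).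
Proof.
move=> N0; apply: le_trans (row_le_inf_norm _ (Ordinal N0)).
by apply: sume_ge0 => j _; exact: dobrushin_ge0.
Qed.

Lemma W1_le_dobrushin i j (x y : TN) (c : R) : dobrushin d mui i j = c%:E ->
  agree_off j x y ->
  W1 d (mui i x) (mui i y) <= (c * d (tnth x j) (tnth y j))%:E.
Proof.
move=> cE xy; have [_ _ [d0 eq0 _ _] _] := lscd.
(* The supremum skips pairs with equal [j]-th coordinates; there [x = y], and the diagonal coupling
   has cost 0. *)
have [xyj|xyj] := pselect (tnth x j = tnth y j).
  have <- : x = y.
    apply/eq_from_tnth => k; have [->//|kj] := eqVneq k j.
    exact: xy.
  by rewrite (proj2 (eq0 _ _))// mulr0; exact: W1_refl lscd (kernel_probability _ _).
have dgt0 : (0 < d (tnth x j) (tnth y j))%R.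
  by rewrite lt_neqAle d0 andbT eq_sym; apply/eqP => /eq0.
have : W1 d (mui i x) (mui i y) / (d (tnth x j) (tnth y j))%:E <= c%:E.
  rewrite -cE /dobrushin le_max; apply/orP; right.
  by apply: ereal_sup_ubound; exists x, y.
by rewrite inver gt_eqF// lee_pdivrMr.
Qed.

Lemma dobrushin_fin : inf_norm (dobrushin d mui) < 1 -> forall i j,
  dobrushin d mui i j \is a fin_num.
Proof.
move=> r1 i j; rewrite ge0_fin_numE ?dobrushin_ge0//.
apply: (@le_lt_trans _ _ (\sum_j dobrushin d mui i j)).
  rewrite (bigD1 j)//= leeDl// sume_ge0// => k _; exact: dobrushin_ge0.
apply: le_lt_trans (row_le_inf_norm _ i) _.
by apply: lt_trans r1 _; rewrite ltry.
Qed.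

End dobrushin_real.

Section gibbs_invariance.
Context {dT : measure_display} {T : measurableType dT} {R : realType} {N : nat}.
Local Notation TN := (N.-tuple T).

Definition box : set (set TN) :=
  [set S | exists2 A : 'I_N -> set T, (forall j, measurable (A j)) &
     S = [set x | forall j, A j (tnth x j)]].

Lemma measurable_box S : box S -> measurable S.
Proof.
move=> [A mA ->]; rewrite (_ : [set x | _] =
    \bigcap_(j in [set: 'I_N]) [set x : TN | A j (tnth x j)]).
  apply: fin_bigcap_measurable => [|j _]; first exact: finite_finset.
  by have := measurable_tnth j measurableT (mA j); rewrite setTI.
by apply/seteqP; split => [x Ax j _|x Ax j]; exact: Ax.
Qed.

Lemma measure_box_unique (m1 m2 : {measure set TN -> \bar R}) :
  m1 setT < +oo -> (forall S, box S -> m1 S = m2 S) ->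
  forall S, measurable S -> m1 S = m2 S.
Proof.
move=> fm H; apply: (measure_unique box (fun=> setT)) => //.
- apply/seteqP; split; last first.
    by apply: smallest_sub; [exact: sigma_algebra_measurable|exact: measurable_box].
  apply: smallest_sub; first exact: smallest_sigma_algebra.
  rewrite -bigcup_seq => _ [i _ [A mA <-]]; rewrite setTI; apply: sub_sigma_algebra.
  exists (fun j => if j == i then A else setT).
    by move=> j; case: ifP.
  apply/seteqP; split => x /= => [Ax j|/(_ i)]; last by rewrite eqxx.
  by case: eqP => [->|].
- move=> _ _ [A mA ->] [A' mA' ->]; exists (fun j => A j `&` A' j).
    by move=> j; exact: measurableI.
  apply/seteqP; split => x /=; first by move=> [h1 h2] j; split.
  by move=> h; split => j; have [] := h j.
- by move=> _; exists (fun=> setT) => //; apply/seteqP; split.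
- by rewrite bigcup_const//; exists 0%N.
Qed.

Variable mu : probability TN R.

(** A box is an event [D] on the other coordinates intersected with a condition on coordinate [i];
    the defining property of the conditional law, applied to [D], is the identity on that box. *)
Lemma resample_invariant i (K : R.-pker TN ~> T) : is_regular_conditional mu i K ->
  forall S, measurable S -> nuK mu (resample i K) S = mu S.
Proof.
move=> [_ HK]; apply: measure_box_unique.
  by rewrite (le_lt_trans (probability_le1 _ _)) ?ltry.
move=> S bS; have mS := measurable_box bS; move: bS mS => [A mA ->] mS.
pose D : set TN := [set x | forall j, j != i -> A j (tnth x j)].
(* The generators of [sigma_off i], named so that this sigma-field can be viewed as that of a
   measurable type. *)
pose gens := [set D' : set TN | exists j : 'I_N, exists A' : set T,
  [/\ j != i, measurable A' & D' = [set x | A' (tnth x j)]] ].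
have sD : sigma_off i D.
  rewrite (_ : D = \bigcap_(j in [set j | j != i]) [set x : TN | A j (tnth x j)]).
    have : @measurable _ (g_sigma_algebraType gens)
        (\bigcap_(j in [set j | j != i]) [set x : TN | A j (tnth x j)]).
      apply: fin_bigcap_measurable => [|j ji]; first exact: finite_finset.
      by apply: sub_sigma_algebra; exists j, (A j).
    by [].
  by apply/seteqP; split => x Dx j; exact: Dx.
have mD : measurable D.
  rewrite (_ : D = [set x | forall j, (if j == i then setT else A j) (tnth x j)]).
    apply: measurable_box; exists (fun j => if j == i then setT else A j) => //.
    by move=> j; case: ifP.
  apply/seteqP; split => x Dx j; first by case: (eqVneq j i) => [//|/Dx].
  by move=> ji; have := Dx j; rewrite (negbTE ji).
have -> : [set x | forall j, A j (tnth x j)] = D `&` [set x | A i (tnth x i)].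
  apply/seteqP; split => x /= => [h|[h1 h2] j]; first by split.
  by have [->|/h1] := eqVneq j i.
rewrite (HK _ _ (mA i) sD) integral_mkcond; apply: eq_integral => x _.
rewrite patchE /resample /= /resample_meas /= /resample_fun /pushforward.
case: ifPn => [/set_mem Dx|/negP nDx].
  congr (K x _); apply/seteqP; split => y /=.
    by move=> [_]; rewrite tnth_mktuple eqxx.
  move=> Ay; split; last by rewrite tnth_mktuple eqxx.
  by move=> j ji; rewrite tnth_mktuple (negbTE ji); exact: Dx.
rewrite (_ : _ @^-1` _ = set0) ?measure0//; apply/seteqP; split => // y [/= h _].
apply: nDx; apply/mem_set => j ji; have := h j ji.
by rewrite tnth_mktuple (negbTE ji).
Qed.

Variable mui : 'I_N -> R.-pker TN ~> T.
Hypothesis mui_cond : forall i, is_regular_conditional mu i (mui i).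

Lemma gibbs_sampler_invariant S : measurable S ->
  nuK mu (gibbs_sampler mui) S = mu S.
Proof.
rewrite /gibbs_sampler; elim: (index_enum _) S => [|i s IH] S mS.
  by rewrite big_nil nuK_kid.
rewrite big_cons nuK_kmul// -[RHS]IH//; apply: eq_nuK => //.
exact: resample_invariant.
Qed.

Lemma kpow_invariant (P : R.-pker TN ~> TN) k :
  (forall S, measurable S -> nuK mu P S = mu S) ->
  forall S, measurable S -> nuK mu (kpow P k) S = mu S.
Proof.
move=> muP; elim: k => [|k IH] S mS; first exact: nuK_kid.
rewrite nuK_kmul// -[RHS]IH//; exact: eq_nuK.
Qed.

End gibbs_invariance.

(** * Lipschitz functions and the conclusion *)

Lemma integrable_marginal {d1 d2 : measure_display} {T1 : measurableType d1}
    {T2 : measurableType d2} {R : realType} (g : probability T1 R)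
    (m : {measure set T2 -> \bar R}) (f : T1 -> T2) (h : T2 -> \bar R) :
  measurable_fun [set: T1] f ->
  (forall A, measurable A -> g (f @^-1` A) = m A) -> m.-integrable setT h ->
  g.-integrable setT (h \o f) /\ \int[g]_x h (f x) = \int[m]_y h y.
Proof.
move=> mf gm /integrableP[mh ih]; split.
  apply/integrableP; split; first exact: measurableT_comp.
  rewrite (integral_marginal (h := fun y => `|h y|) mf gm)//.
  exact: measurableT_comp.
rewrite [LHS]integralE [RHS]integralE; congr (_ - _).
  rewrite -(integral_marginal mf gm (measurable_funepos mh))//.
  by apply: eq_integral => x _; rewrite -[fun x => h (f x)]/(h \o f) funepos_comp.
rewrite -(integral_marginal mf gm (measurable_funeneg mh))//.
by apply: eq_integral => x _; rewrite -[fun x => h (f x)]/(h \o f) funeneg_comp.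
Qed.

Section lipschitz.
Context {dT : measure_display} {T : measurableType dT} {R : realType} {N : nat}.
Variables (rho d : T -> T -> R) (B : nat -> set T).
Hypothesis lscd : lsc_metric rho d B.
Local Notation TN := (N.-tuple T).
Variable f : TN -> R.
Hypothesis mf : measurable_fun [set: TN] f.

Let d_ge0 x y : (0 <= d x y)%R.
Proof. by have [_ _ [+ _ _ _] _] := lscd; exact. Qed.

Lemma delta_ge0 i : 0 <= delta d f i.
Proof. by rewrite /delta le_max lexx. Qed.

Lemma delta_fin i : lipschitz_fun d f -> delta d f i \is a fin_num.
Proof.
move=> [L fL]; rewrite ge0_fin_numE ?delta_ge0//.
(* [delta] is a maximum with 0, while the constant [L] is not assumed nonnegative. *)
apply: (@le_lt_trans _ _ (Num.max 0 L)%:E); last exact: ltry.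
have [_ _ [_ eq0 _ _] _] := lscd.
rewrite /delta ge_max lee_fin le_max lexx/=.
apply: ub_ereal_sup => _ [x [y [xy xyi ->]]].
have dgt0 : (0 < d (tnth x i) (tnth y i))%R.
  by rewrite lt_neqAle d_ge0 andbT eq_sym; apply/eqP => /eq0.
rewrite lee_fin le_max; apply/orP; right; rewrite ler_pdivrMr//.
apply: le_trans (fL x y) _; rewrite /dL1 (bigD1 i)//= big1 ?addr0// => j ji.
by rewrite xy//; exact/eq0.
Qed.

Lemma le_delta (x y : TN) : lipschitz_fun d f ->
  (`|f x - f y| <= \sum_i fine (delta d f i) * d (tnth x i) (tnth y i))%R.
Proof.
move=> lf; rewrite -lee_fin.
apply: (coordinatewise_le (D := fun x y => `|f x - f y|%:E)
  (a := fun i u v => fine (delta d f i) * d u v)%R).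
- by move=> u; rewrite subrr normr0.
- move=> u v w; rewrite -EFinD lee_fin.
  by rewrite -[(f u - f w)%R](subrKA (f v)) ler_normD.
have [_ _ [_ eq0 _ _] _] := lscd.
move=> j u v uv; have [uvj|uvj] := pselect (tnth u j = tnth v j).
  have <- : u = v.
    apply/eq_from_tnth => k; have [->//|kj] := eqVneq k j.
    exact: uv.
  by rewrite subrr normr0 (proj2 (eq0 _ _))// mulr0.
have dgt0 : (0 < d (tnth u j) (tnth v j))%R.
  by rewrite lt_neqAle d_ge0 andbT eq_sym; apply/eqP => /eq0.
rewrite lee_fin -ler_pdivrMr// -lee_fin fineK ?delta_fin//.
by rewrite /delta le_max; apply/orP; right; apply: ereal_sup_ubound; exists u, v.
Qed.

Lemma coupling_integral_diff (g : probability (TN * TN)%type R)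
    (m1 m2 : {measure set TN -> \bar R}) : lipschitz_fun d f ->
  is_coupling g m1 m2 ->
  m1.-integrable setT (EFin \o f) -> m2.-integrable setT (EFin \o f) ->
  `|\int[m1]_x (f x)%:E - \int[m2]_x (f x)%:E| <=
    \sum_i delta d f i * coord_cost d g i.
Proof.
move=> lf cg i1 i2.
have g1 A : measurable A -> g (fst @^-1` A) = m1 A.
  by move=> mA; rewrite -setXT (cg _ mA).1.
have g2 A : measurable A -> g (snd @^-1` A) = m2 A.
  by move=> mA; rewrite -setTX (cg _ mA).2.
have [i1' <-] := integrable_marginal measurable_fst g1 i1.
have [i2' <-] := integrable_marginal measurable_snd g2 i2.
rewrite -integralB//.
apply: (le_trans (le_abse_integral _ _ _)) => //.
  by apply: emeasurable_funB; [move/integrableP: i1' => []|move/integrableP: i2' => []].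
have mdj j : measurable_fun [set: TN * TN] (fun z => (d (tnth z.1 j) (tnth z.2 j))%:E).
  exact: measurable_coord_cost lscd j.
have fd0 j : (0 <= fine (delta d f j))%R by rewrite fine_ge0// delta_ge0.
have -> : \sum_i delta d f i * coord_cost d g i =
    \int[g]_z (\sum_i (fine (delta d f i))%:E * (d (tnth z.1 i) (tnth z.2 i))%:E).
  rewrite ge0_integral_sum//; last 2 first.
  - by move=> i; apply: emeasurable_funM.
  - by move=> i z _; rewrite mule_ge0// lee_fin.
  apply: eq_bigr => i _; rewrite (ge0_integralZl_EFin g measurableT _ _ (fd0 i))//.
    by rewrite fineK ?delta_fin.
  by move=> z _; rewrite lee_fin.
apply: ge0_le_integral => //.
- apply: measurableT_comp => //.
  by apply: emeasurable_funB; [move/integrableP: i1' => []|move/integrableP: i2' => []].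
- by apply: emeasurable_sum => i; apply: emeasurable_funM.
move=> z _; rewrite -[leLHS]/(`|(f z.1 - f z.2)%:E|) abse_EFin.
under eq_bigr do rewrite -EFinM.
by rewrite sumEFin lee_fin; exact: le_delta.
Qed.

End lipschitz.

(** * Integrability and oscillation bounds derived from a contraction matrix *)

Section coupling_bounds.
Context {dT : measure_display} {T : measurableType dT} {R : realType} {N : nat}.
Variables (rho d : T -> T -> R) (B : nat -> set T).
Hypothesis lscd : lsc_metric rho d B.
Local Notation TN := (N.-tuple T).

Let d_ge0 x y : (0 <= d x y)%R.
Proof. by have [_ _ [+ _ _ _] _] := lscd; exact. Qed.

Lemma row_sum_bound (A : 'M[R]_N) (r : R) (e : 'I_N -> \bar R) (M : \bar R) i :
  (forall i j, (0 <= A i j)%R) -> (forall i, (\sum_j A i j <= r)%R) ->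
  (forall j, e j <= M) -> 0 <= M ->
  \sum_j (A i j)%:E * e j <= r%:E * M.
Proof.
move=> A0 Ar eM M0.
apply: (@le_trans _ _ (\sum_j (A i j)%:E * M)).
  by apply: lee_sum => j _; apply: lee_wpmul2l => //; rewrite lee_fin.
rewrite -ge0_sume_distrl; last by move=> j _; rewrite lee_fin.
by rewrite sumEFin; apply: lee_wpmul2r => //; rewrite lee_fin.
Qed.

Lemma W1_dL1_le (g : probability (TN * TN)%type R)
    (m1 m2 : {measure set TN -> \bar R}) : is_coupling g m1 m2 ->
  W1 (dL1 d) m1 m2 <= \sum_i coord_cost d g i.
Proof.
move=> cg; apply: (le_trans (W1_le _ cg)).
rewrite /dL1; under eq_integral do rewrite -sumEFin.
rewrite ge0_integral_sum//.
- by move=> j; exact: measurable_coord_cost lscd j.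
- by move=> j z _; rewrite lee_fin.
Qed.

Variables (P : R.-pker TN ~> TN) (A : 'M[R]_N) (mu : probability TN R).
Hypothesis cP : contracts d P A.
Hypothesis muP : forall S, measurable S -> nuK mu P S = mu S.
Hypothesis mu_moment : exists x0 : N.-tuple T, forall i,
  \int[mu]_y (d (tnth y i) (tnth x0 i))%:E < +oo.

Let mdc j (x : TN) : measurable_fun [set: TN] (fun y => (d (tnth y j) (tnth x j))%:E).
Proof. by apply: (measurable_lsc_metric lscd) => //; exact: measurable_tnth. Qed.

(** Contraction applied to the independent coupling of the Dirac mass at [x] with [mu] yields, by
    invariance, a coupling of [P x] with [mu] of finite cost; finite moments pass from [mu] to
    [P x]. *)
Lemma contracts_moment (x : TN) i (y0 : TN) :
  \int[P x]_y (d (tnth y i) (tnth y0 i))%:E < +oo.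
Proof.
have [x0 hx0] := mu_moment.
have [prho _ [_ eq0 sym tri] _] := lscd.
have mud j (z : TN) : \int[mu]_y (d (tnth y j) (tnth z j))%:E < +oo.
  apply: (@le_lt_trans _ _ (\int[mu]_y ((d (tnth y j) (tnth x0 j))%:E +
      (d (tnth x0 j) (tnth z j))%:E))).
    apply: ge0_le_integral => //.
    - by move=> y _; rewrite lee_fin.
    - by apply: emeasurable_funD; [exact: (@mdc j _)|exact: measurable_cst].
    - by move=> y _; rewrite -EFinD lee_fin.
  rewrite ge0_integralD//; last 2 first.
  - by move=> y _; rewrite lee_fin.
  - by move=> y _; rewrite lee_fin.
  by rewrite integral_probability_cst lte_add_pinfty// ltry.
have mx : measurable_fun [set: TN] (fun y : TN => (x, y)).
  by apply: measurable_fun_pair => //; exact: measurable_cst.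
pose g := image_probability mu mx.
have cg : is_coupling g \d_x mu.
  move=> S mS; split.
    transitivity ((x \in S)%:R%:E : \bar R); last exact/esym/diracE.
    case: (boolP (x \in S)) => xS.
      rewrite -(probability_setT mu); congr (mu _); apply/seteqP; split => // y _ /=.
      by split => //; exact: set_mem.
    rewrite -[RHS](measure0 mu); congr (mu _); apply/seteqP; split => // y [/= /mem_set].
    by rewrite (negbTE xS).
  by congr (mu _); apply/seteqP; split => y //= [].
have [g' cg' hg'] := cP.2 _ _ _ cg.
have cost_fin : coord_cost d g' i < +oo.
  apply: le_lt_trans (hg' i) _; apply/lte_sum_pinfty => j _.
  apply: lte_mul_pinfty; [by rewrite lee_fin cP.1|by []|].
  rewrite /coord_cost ge0_integral_image_probability//=; last 2 first.
  - exact: measurable_coord_cost lscd j.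
  - by move=> z; rewrite lee_fin.
  by under eq_integral do rewrite sym; exact: mud.
have cg1 S : measurable S -> g' (fst @^-1` S) = P x S.
  by move=> mS; rewrite -setXT (cg' _ mS).1; exact: nuK_dirac.
have cg2 S : measurable S -> g' (snd @^-1` S) = mu S.
  by move=> mS; rewrite -setTX (cg' _ mS).2; exact: muP.
rewrite -(integral_marginal measurable_fst cg1 (@mdc i y0)); last first.
  by move=> y; rewrite lee_fin.
apply: (@le_lt_trans _ _ (coord_cost d g' i + \int[mu]_y (d (tnth y i) (tnth y0 i))%:E)); last first.
  by rewrite lte_add_pinfty.
rewrite -(integral_marginal measurable_snd cg2 (@mdc i y0)); last first.
  by move=> y; rewrite lee_fin.
have ms : measurable_fun [set: TN * TN] (fun z => (d (tnth z.2 i) (tnth y0 i))%:E).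
  exact: (measurableT_comp (@mdc i y0) measurable_snd).
rewrite /coord_cost -ge0_integralD//; last 3 first.
- by move=> z _; rewrite lee_fin.
- exact: measurable_coord_cost lscd i.
- by move=> z _; rewrite lee_fin.
apply: ge0_le_integral => //.
- by move=> z _; rewrite lee_fin.
- exact: (measurableT_comp (@mdc i y0) measurable_fst).
- by apply: emeasurable_funD => //; exact: measurable_coord_cost lscd i.
- by move=> z _; rewrite -EFinD lee_fin.
Qed.

Variable f : TN -> R.
Hypothesis mf : measurable_fun [set: TN] f.
Hypothesis lf : lipschitz_fun d f.

Lemma kfun_integrable (x : TN) : (P x).-integrable setT (EFin \o f).
Proof.
apply/integrableP; split; first exact/measurable_EFinP.
have mi i : measurable_fun [set: TN] (fun y => (fine (delta d f i) *
    d (tnth y i) (tnth x i))%:E).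
  apply/measurable_EFinP; apply: measurable_funM; first exact: measurable_cst.
  by apply/measurable_EFinP; exact: (@mdc i x).
have fd0 j : (0 <= fine (delta d f j))%R by rewrite fine_ge0// delta_ge0.
apply: (@le_lt_trans _ _ (\int[P x]_y (`|f x|%:E + \sum_i (fine (delta d f i) *
    d (tnth y i) (tnth x i))%:E))).
  apply: ge0_le_integral => //.
  - exact/measurableT_comp/measurable_EFinP.
  - by apply: emeasurable_funD => //; exact: emeasurable_sum.
  move=> y _ /=; rewrite sumEFin -EFinD lee_fin.
  rewrite -[f y](subrK (f x)) addrC (le_trans (ler_normD _ _))// lerD2l.
  exact: (le_delta lscd).
rewrite ge0_integralD//; last 2 first.
- by move=> y _; apply: sume_ge0 => i _; rewrite lee_fin mulr_ge0.
- exact: emeasurable_sum.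
have -> : \int[P x]_y `|f x|%:E = `|f x|%:E.
  exact: (integral_probability_cst (kernel_probability P x)).
rewrite lte_add_pinfty ?ltry// ge0_integral_sum//; last first.
  by move=> i y _; rewrite lee_fin mulr_ge0.
apply/lte_sum_pinfty => i _; under eq_integral do rewrite EFinM.
rewrite (ge0_integralZl_EFin _ measurableT _ _ (fd0 i))//; last first.
  by move=> y _; rewrite lee_fin.
by apply: lte_mul_pinfty; [rewrite lee_fin| |exact: contracts_moment].
Qed.

(** Between Dirac masses the initial coordinate costs are the distances themselves. *)
Lemma kfun_diff (x y : TN) :
  `|kfun P f x - kfun P f y| <= \sum_i delta d f i *
     \sum_j (A i j)%:E * (d (tnth x j) (tnth y j))%:E.
Proof.
have cg : is_coupling (dirac (x, y) : probability (TN * TN)%type R) \d_x \d_y.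
  move=> S mS; split.
    transitivity (((x, y) \in S `*` [set: TN])%:R%:E : \bar R); first exact: diracE.
    by rewrite in_setX in_setT andbT; exact/esym/diracE.
  transitivity (((x, y) \in [set: TN] `*` S)%:R%:E : \bar R); first exact: diracE.
  by rewrite in_setX in_setT; exact/esym/diracE.
have [g cg' hg] := cP.2 _ _ _ cg.
have {}cg' : is_coupling g (P x) (P y).
  by apply: eq_coupling cg' => S mS; exact: nuK_dirac.
have := coupling_integral_diff lscd lf cg' (kfun_integrable x) (kfun_integrable y).
move=> /le_trans; apply.
apply: lee_sum => i _; apply: lee_wpmul2l; first exact: delta_ge0.
apply: le_trans (hg i) _; apply: lee_sum => j _.
apply: lee_wpmul2l; first by rewrite lee_fin cP.1.
rewrite /coord_cost integral_dirac//; last exact: measurable_coord_cost lscd j.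
by rewrite diracT mul1e.
Qed.

(** [kfun_diff] is linear in the distances, so integrating it against [g] brings in only the costs
    of single coordinates. *)
Lemma kfun_integral_diff (g : probability (TN * TN)%type R)
    (m1 m2 : {measure set TN -> \bar R}) : is_coupling g m1 m2 ->
  m1.-integrable setT (kfun P f) -> m2.-integrable setT (kfun P f) ->
  `|\int[m1]_x kfun P f x - \int[m2]_x kfun P f x| <=
    \sum_i delta d f i * \sum_j (A i j)%:E * coord_cost d g j.
Proof.
move=> cg i1 i2.
have g1 S : measurable S -> g (fst @^-1` S) = m1 S.
  by move=> mS; rewrite -setXT (cg _ mS).1.
have g2 S : measurable S -> g (snd @^-1` S) = m2 S.
  by move=> mS; rewrite -setTX (cg _ mS).2.
have [i1' <-] := integrable_marginal measurable_fst g1 i1.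
have [i2' <-] := integrable_marginal measurable_snd g2 i2.
have mF : measurable_fun [set: TN * TN] (fun z => kfun P f z.1 - kfun P f z.2).
  by apply: emeasurable_funB; [move/integrableP: i1' => []|move/integrableP: i2' => []].
rewrite -integralB//; apply: (le_trans (le_abse_integral _ _ _)) => //.
have mdj j : measurable_fun [set: TN * TN] (fun z => (d (tnth z.1 j) (tnth z.2 j))%:E).
  exact: measurable_coord_cost lscd j.
have mcdj i j : measurable_fun [set: TN * TN]
    (fun z => (A i j)%:E * (d (tnth z.1 j) (tnth z.2 j))%:E).
  exact: emeasurable_funM.
have fd0 j : (0 <= fine (delta d f j))%R by rewrite fine_ge0// delta_ge0.
have A0 i j : (0 <= A i j)%R by exact: cP.1.
have s0 i z : 0 <= \sum_j (A i j)%:E * (d (tnth z.1 j) (tnth z.2 j))%:E :> \bar R.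
  by apply: sume_ge0 => j _; rewrite mule_ge0// lee_fin.
have -> : \sum_i delta d f i * \sum_j (A i j)%:E * coord_cost d g j =
    \int[g]_z (\sum_i (fine (delta d f i))%:E *
      \sum_j (A i j)%:E * (d (tnth z.1 j) (tnth z.2 j))%:E).
  rewrite ge0_integral_sum//; last 2 first.
  - by move=> i; apply: emeasurable_funM => //; exact: emeasurable_sum.
  - by move=> i z _; rewrite mule_ge0// lee_fin.
  apply: eq_bigr => i _.
  rewrite (ge0_integralZl_EFin g measurableT _ _ (fd0 i))//; last first.
    exact: emeasurable_sum.
  rewrite fineK ?(delta_fin lscd)// (ge0_integral_sum g measurableT (mcdj i)); last first.
    by move=> j z _; rewrite mule_ge0// lee_fin.
  congr (_ * _); apply: eq_bigr => j _.
  by rewrite (ge0_integralZl_EFin g measurableT _ _ (A0 i j))// => z _; rewrite lee_fin.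
apply: ge0_le_integral => //.
- exact: measurableT_comp.
- apply: emeasurable_sum => i; apply: emeasurable_funM => //; exact: emeasurable_sum.
move=> z _; apply: le_trans (kfun_diff z.1 z.2) _.
by apply: lee_sum => i _; rewrite fineK ?(delta_fin lscd).
Qed.

End coupling_bounds.

(** Open neighbourhoods are traded for sets of a countable base, the form in which semicontinuity
    makes the cell costs converge to [d]. *)
Lemma lsc_metric_borel {R : realType} {E : ptopologicalType}
    (d : borel E -> borel E -> R) : is_polish R E -> is_metric d ->
  lower_semicontinuous (fun p : (E * E)%type => (d p.1 p.2)%:E) ->
  exists rho B, lsc_metric rho d B.
Proof.
move=> /polish_metric_borel[rho [prho oE]] md dlsc.
have [B bB] := polish_metric_base prho.
exists rho, B; split => // x y a axy.
have := dlsc (x, y) a; rewrite lte_fin => /(_ axy)[V [[V1 V2] [V1x V2y] V12V] Va].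
have base (z : E) (W : set E) : nbhs z W -> exists2 k, B k z & B k `<=` W.
  move=> zW; have [_ bBo] := bB.
  have oW : metric_open rho (W° : set (borel E)) by apply/oE; exact: open_interior.
  have [k Bz BW] := bBo _ z oW zW.
  by exists k => // u /BW; exact: interior_subset.
have [k kx kV1] := base x V1 V1x; have [l ly lV2] := base y V2 V2y.
exists k, l; split => // x' y' /kV1 V1x' /lV2 V2y'.
by rewrite -lte_fin; exact: (Va (x', y') (V12V (x', y') _)).
Qed.

Theorem theorem2p3 (R : realType) (E : ptopologicalType) (hE : is_polish R E)
  (d : borel E -> borel E -> R) (hd : is_metric d)
  (hd_lsc : lower_semicontinuous (fun p : (E * E)%type => (d p.1 p.2)%:E))
  (N : nat) (hN : (1 <= N)%N)
  (pi : {sigma_finite_measure set (borel E) -> \bar R})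
  (V : N.-tuple (borel E) -> R) (hV : measurable_fun [set: N.-tuple (borel E)] V)
  (mu : probability (N.-tuple (borel E)) R) (hmu : is_gibbs pi V mu)
  (mui : 'I_N -> R.-pker (N.-tuple (borel E)) ~> (borel E))
  (hmui_cond : forall i, is_regular_conditional mu i (mui i))
  (hmui_gibbs : forall i, has_gibbs_density pi V mu i (mui i))
  (hmu_moment : exists x0 : N.-tuple (borel E), forall i,
     \int[mu]_y (d (tnth y i) (tnth x0 i))%:E < +oo)
  (hmui_moment : forall i x, M1d d (mui i x))
  (hmui_lip : forall i, lipschitz_kernel d (mui i)) :
  let r := inf_norm (dobrushin d mui) in
  let P := gibbs_sampler mui in
  r < 1 ->
  (forall (f : N.-tuple (borel E) -> R),
     measurable_fun [set: N.-tuple (borel E)] f -> lipschitz_fun d f ->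
   forall (nu1 nu2 : probability (N.-tuple (borel E)) R)
     (dO : measure_display) (O : measurableType dO) (Pr : probability O R)
     (Z1 Z2 : {RV Pr >-> N.-tuple (borel E)}),
     has_law Z1 nu1 -> has_law Z2 nu2 ->
   forall k, (1 <= k)%N ->
     nu1.-integrable setT (kfun (kpow P k) f) ->
     nu2.-integrable setT (kfun (kpow P k) f) ->
     `| (\int[nu1]_x kfun (kpow P k) f x) - (\int[nu2]_x kfun (kpow P k) f x) |
       <= r ^+ k
          * (\big[maxe/-oo]_(i < N)
               'E_Pr [fun w => d (tnth (Z1 w) i) (tnth (Z2 w) i)])
          * \sum_(i < N) delta d f i)
  /\
  (forall (nu : probability (N.-tuple (borel E)) R)
     (dO : measure_display) (O : measurableType dO) (Pr : probability O R)
     (Z1 Z2 : {RV Pr >-> N.-tuple (borel E)}),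
     has_law Z1 nu -> has_law Z2 mu ->
   forall k, (1 <= k)%N ->
     W1 (dL1 d) (nuK nu (kpow P k)) mu
       <= N%:R%:E * r ^+ k
          * (\big[maxe/-oo]_(i < N)
               'E_Pr [fun w => d (tnth (Z1 w) i) (tnth (Z2 w) i)])).
Proof.
move=> r P r1.
have [rho [B lscd]] := @lsc_metric_borel R E d hE hd hd_lsc.
have [_ _ [d0 _ _ _] _] := lscd.
(* Over an empty index set, [r] and the maxima of expectations below would be [-oo]; [hN] excludes
   this. *)
have r0 : 0 <= r by exact: inf_norm_dobrushin_ge0.
have rfin : r \is a fin_num by rewrite ge0_fin_numE// (lt_trans r1)// ltry.
have cfin := dobrushin_fin r1.
pose c i j := fine (dobrushin d mui i j).
have cE i j : dobrushin d mui i j = (c i j)%:E by rewrite fineK.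
have c0 i j : (0 <= c i j)%R by rewrite fine_ge0// dobrushin_ge0.
have c_row i : (\sum_j c i j <= fine r)%R.
  rewrite -lee_fin fineK// -sumEFin; under eq_bigr do rewrite -cE.
  exact: row_le_inf_norm.
have r1' : (fine r <= 1)%R by rewrite -lee_fin fineK// ltW.
have [A cA Ar] := contracts_gibbs lscd c0
  (fun i j x y h => W1_le_dobrushin lscd (cE i j) h) c_row r1'.
have [C' cC' Cr'] : exists2 C : nat -> 'M[R]_N,
    forall k, contracts d (kpow P k) (C k) &
    forall k i, (\sum_j C k i j <= fine r ^+ k)%R.
  have /choice[C hC] : forall k, exists C, contracts d (kpow P k) C /\
      forall i, (\sum_j C i j <= fine r ^+ k)%R.
    move=> k; have [|C cC Cr] := contracts_kpow d0 k cA _ Ar; first exact: fine_ge0.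
    by exists C.
  by exists C => k; have [] := hC k.
have muPk k S : measurable S -> nuK mu (kpow P k) S = mu S.
  by apply: kpow_invariant => S' mS'; exact: gibbs_sampler_invariant.
have rk k : r ^+ k = (fine r ^+ k)%:E by rewrite EFin_expe fineK.
have coupled (nu1 nu2 : probability (N.-tuple (borel E)) R) (dO : measure_display)
    (O : measurableType dO) (Pr : probability O R)
    (Z1 Z2 : {RV Pr >-> N.-tuple (borel E)}) : has_law Z1 nu1 -> has_law Z2 nu2 ->
    exists2 g : probability (N.-tuple (borel E) * N.-tuple (borel E))%type R,
      is_coupling g nu1 nu2 &
      forall i, coord_cost d g i = 'E_Pr [fun w => d (tnth (Z1 w) i) (tnth (Z2 w) i)].
  move=> l1 l2; have mZ : measurable_fun [set: O] (fun w => (Z1 w, Z2 w)).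
    by apply: measurable_fun_pair; exact: measurable_funPT.
  exists (image_probability Pr mZ).
    move=> S mS; rewrite -l1// -l2//; split; congr (Pr _);
      by apply/seteqP; split => w //= [].
  move=> i; rewrite /coord_cost ge0_integral_image_probability/=.
  - by rewrite unlock.
  - exact: measurable_coord_cost lscd i.
  - by move=> z; rewrite lee_fin.
have leM (e : 'I_N -> \bar R) i : e i <= \big[maxe/-oo]_(i < N) e i.
  exact: (le_bigmax -oo e i).
split.
- move=> f mf lf nu1 nu2 dO O Pr Z1 Z2 l1 l2 k _ i1 i2.
  have [g cg gE] := coupled _ _ _ _ _ _ _ l1 l2.
  apply: le_trans (kfun_integral_diff lscd (cC' k) (muPk k) hmu_moment mf lf cg i1 i2) _.
  rewrite rk; set M := \big[maxe/_]_(_ < _) _.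
  have gM j : coord_cost d g j <= M by rewrite gE; exact: leM.
  have M0 : 0 <= M by exact: le_trans (coord_cost_ge0 d0 g (Ordinal hN)) (gM _).
  rewrite ge0_sume_distrr; last by move=> i _; exact: delta_ge0.
  apply: lee_sum => i _; rewrite [leRHS]muleC; apply: lee_wpmul2l.
    exact: delta_ge0.
  by apply: row_sum_bound => //; exact: (cC' k).1.
- move=> nu dO O Pr Z1 Z2 l1 l2 k _.
  have [g cg gE] := coupled _ _ _ _ _ _ _ l1 l2.
  rewrite rk; set M := \big[maxe/_]_(_ < _) _.
  have gM j : coord_cost d g j <= M by rewrite gE; exact: leM.
  have M0 : 0 <= M by exact: le_trans (coord_cost_ge0 d0 g (Ordinal hN)) (gM _).
  have [g' cg' hg'] := (cC' k).2 _ _ _ cg.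
  have {}cg' : is_coupling g' (nuK nu (kpow P k)) mu.
    by apply: eq_coupling cg' => S mS //; exact: muPk.
  apply: (le_trans (W1_dL1_le lscd cg')).
  apply: (@le_trans _ _ (\sum_(i < N) (fine r ^+ k)%:E * M)).
    apply: lee_sum => i _; apply: le_trans (hg' i) _.
    by apply: row_sum_bound => //; exact: (cC' k).1.
  (* Each coordinate contributes the same bound, whence the factor [N], obtained as a sum of
     ones. *)
  rewrite (eq_bigr (fun=> 1%:E * ((fine r ^+ k)%:E * M))); last first.
    by move=> i _; rewrite mul1e.
  by rewrite -ge0_sume_distrl// sumEFin sumr_const card_ord muleA.
Qed.
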